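(* Let $X$ be a quasi-projective complex manifold and $L$ a pseudo-effective line bundle on $X$ with a positive singular hermitian metric $h$ which has analytic singularities. Then for every smooth (projective, irreducible) curve $C\subset X$ with $h_{|C}\not\equiv+\infty$, $$(L,h).C=\limsup_{m\to\infty}\frac1m h^0\bigl(C,\mathcal{O}_C(mL)\otimes\mathcal{I}(h^m)\cdot\mathcal{O}_C\bigr),$$ where $\mathcal{I}(h^m)\cdot\mathcal{O}_C$ is the image of $\mathcal{I}(h^m)\otimes\mathcal{O}_C$ in $\mathcal{O}_C$.
   Context: A singular hermitian metric $h$ on $L$ is given on a trivialization $\theta:L_{|\Omega}\simeq\Omega\times\mathbb{C}$ by $\|\xi\|=|\theta(\xi)|e^{-\phi(x)}$, $\xi\in L_x$, with weight $\phi\in L^1_{\mathrm{loc}}(\Omega)$; it is positive iff all weights $\phi$ are plurisubharmonic. The metric $h^m$ on $mL=L^{\otimes m}$ has weights $m\phi$. The metric $h$ has analytic singularities if its plurisubharmonic weights can locally be written as $\phi=\frac{\alpha}{2}\log(\sum_i|f_i|^2)+v$ with $\alpha\in\mathbb{R}^+$, $v$ locally bounded and $f_i$ germs of holomorphic functions. $h_{|C}\not\equiv+\infty$ means that the weights are not identically $-\infty$ on $C$. Multiplier ideal sheaf: $\mathcal{I}(h)$ is the ideal sheaf of germs of holomorphic functions $f$ with $|f|^2e^{-2\phi}$ locally integrable. Intersection number: if $C\subset X$ is an irreducible curve with normalization $\pi:\tilde C\to C$ and $h_{|C}\not\equiv+\infty$, then $$(L,h).C:=\limsup_{m\to\infty}\frac1m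 h^0\bigl(\tilde C,\mathcal{O}_{\tilde C}(m\pi^*L)\otimes\mathcal{I}((\pi^*h)^m)\bigr).$$ *)

(* Defs.v *)
From HB Require Import structures.
From mathcomp Require Import all_boot all_order all_algebra.
From mathcomp Require Import all_classical all_reals all_analysis.
From mathcomp Require Import complex.
From mathcomp Require mpoly.

Set Implicit Arguments.
Unset Strict Implicit.
Unset Printing Implicit Defensive.

Import Order.TTheory GRing.Theory Num.Theory.
Import numFieldNormedType.Exports.

Local Open Scope complex_scope.
Local Open Scope classical_set_scope.
Local Open Scope ring_scope.

(* The normed field structure of R[i] over itself: [differentiable] for maps
   between the spaces 'rV[R[i]]_n is then complex (Frechet) differentiability. *)
HB.instance Definition _ (R : realType) := PseudoMetric.copy R[i] (R[i])^o.
HB.instance Definition _ (R : realType) := Pointed.copy R[i] (R[i])^o.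
HB.instance Definition _ (R : realType) := NormedModule.copy R[i] (R[i])^o.

(** * Complex manifolds *)

Definition holomorphic_on (R : realType) (n k : nat) (A : set 'rV[R[i]]_n)
    (f : 'rV[R[i]]_n -> 'rV[R[i]]_k) : Prop :=
  forall z, A z -> differentiable f z.

(* The coordinates [crd] and the inverse parametrization [par] are total
   functions, meaningful only on [dom] and on its image. *)
Record chart (R : realType) (T : topologicalType) (n : nat) := Chart {
  dom : set T;
  crd : T -> 'rV[R[i]]_n;
  par : 'rV[R[i]]_n -> T;
  open_dom : open dom;
  open_crd_dom : open (crd @` dom);
  crdK : forall x, dom x -> par (crd x) = x;
  crd_continuous : forall x, dom x -> {for x, continuous crd};
  par_continuous : forall z, (crd @` dom) z -> {for z, continuous par} }.

Definition compatible (R : realType) (T : topologicalType) (n : nat)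
    (c d : chart R T n) : Prop :=
  holomorphic_on (crd c @` (dom c `&` dom d)) (crd d \o par c) /\
  holomorphic_on (crd d @` (dom c `&` dom d)) (crd c \o par d).

(* Complex manifolds of pure dimension n; connectedness is not assumed. *)
Record complex_manifold (R : realType) (n : nat) := ComplexManifold {
  carrier :> topologicalType;
  atlas : set (chart R carrier n);
  manifold_hausdorff : hausdorff_space carrier;
  manifold_second_countable : @second_countable carrier;
  atlas_cover : forall x : carrier, exists2 c, atlas c & dom c x;
  atlas_compatible : forall c d, atlas c -> atlas d -> compatible c d }.

(* The charts of the maximal atlas whose domain contains x. *)
Definition chart_at (R : realType) (n : nat) (M : complex_manifold R n) (x : M)
    (c : chart R M n) : Prop :=
  dom c x /\ forall d, atlas d -> compatible c d.

Definition holomorphic_at (R : realType) (n : nat) (M : complex_manifold R n)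
    (f : M -> R[i]) (x : M) : Prop :=
  forall c, chart_at x c -> differentiable (f \o par c) (crd c x).

(* f represents a germ in the stalk of the structure sheaf at x. *)
Definition holomorphic_germ (R : realType) (n : nat) (M : complex_manifold R n)
    (x : M) (f : M -> R[i]) : Prop :=
  \forall y \near x, holomorphic_at f y.

Definition holomorphic_map (R : realType) (n k : nat)
    (M : complex_manifold R n) (N : complex_manifold R k) (F : M -> N) : Prop :=
  continuous F /\
  forall (x : M) c d, chart_at x c -> chart_at (F x) d ->
    differentiable (crd d \o F \o par c) (crd c x).

(* X is isomorphic to a locally closed algebraic subset of P^N.  The latter is
   handled through its cone Z in C^(N+1) minus the origin, and the isomorphism
   through the quotient map q from Z to X: the fibres of q are the orbits of the
   nonzero scalars, q is locally the restriction of an ambient holomorphic map,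
   and q has local holomorphic sections, so that X is Z / C^* as a complex
   manifold. *)
Definition projective_cone (R : realType) (N : nat)
    (S T : set (mpoly.mpoly N.+1 R[i])) : set 'rV[R[i]]_N.+1 :=
  [set v | v != 0 /\ (forall P, S P -> mpoly.meval (v ord0) P = 0)
           /\ ~ (forall P, T P -> mpoly.meval (v ord0) P = 0)].

Definition homogeneous_set (R : realType) (N : nat)
    (S : set (mpoly.mpoly N.+1 R[i])) : Prop :=
  forall P, S P ->
    exists d, forall m, mpoly.mcoeff m P != 0 -> mpoly.mdeg m = d.

Definition quasi_projective (R : realType) (n : nat)
    (X : complex_manifold R n) : Prop :=
  exists (N : nat) (S T : set (mpoly.mpoly N.+1 R[i]))
      (q : 'rV[R[i]]_N.+1 -> X),
    let Z := projective_cone S T in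
    [/\ homogeneous_set S /\ homogeneous_set T,
        forall v w, Z v -> Z w ->
          (q v = q w <-> exists2 a : R[i], a != 0 & w = a *: v),
        forall v, Z v ->
          exists (c : chart R X n) (V : set 'rV[R[i]]_N.+1)
              (r : 'rV[R[i]]_N.+1 -> 'rV[R[i]]_n),
            [/\ chart_at (q v) c, open V, V v, holomorphic_on V r &
                forall w, V w -> Z w -> dom c (q w) /\ crd c (q w) = r w] &
        forall x : X,
          exists (U : set X) (s : X -> 'rV[R[i]]_N.+1),
            [/\ open U, U x,
                forall y j, U y -> holomorphic_at (fun t => s t ord0 j) y &
                forall y, U y -> Z (s y) /\ q (s y) = y]].

(** * Integration *)

(* The Lebesgue integral over C^n = R^(2n) of a nonnegative function, as an
   iterated integral (Tonelli).  The integrands below are Borel functions, since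
   plurisubharmonic weights are upper semicontinuous. *)
Fixpoint cintegral (R : realType) (n : nat) :
    ('rV[R[i]]_n -> \bar R) -> \bar R :=
  match n with
  | 0 => fun g => g 0
  | n'.+1 => fun g =>
      (\int[@lebesgue_measure R]_x \int[@lebesgue_measure R]_y
        @cintegral R n' (fun z => g (row_mx (x +i* y)%:M z : 'rV_(1 + n'))))%E
  end.

(* Local integrability of g >= 0 at x, for the Lebesgue measure in charts. *)
Definition locally_integrable_at (R : realType) (n : nat)
    (M : complex_manifold R n) (g : M -> \bar R) (x : M) : Prop :=
  forall c, chart_at x c ->
    exists V : set 'rV[R[i]]_n,
      [/\ open V, V (crd c x), V `<=` crd c @` dom c &
          (cintegral ((g \o par c) \_ V) < +oo)%E].

(** * Line bundles *)

(* A line bundle given by its transition functions: the trivializations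
   theta_i over [lb_dom i] satisfy theta_i = [lb_trans i j] * theta_j. *)
Record cocycle (R : realType) (T : Type) := Cocycle {
  lb_idx : Type;
  lb_dom : lb_idx -> set T;
  lb_trans : lb_idx -> lb_idx -> T -> R[i] }.

Definition is_line_bundle (R : realType) (n : nat) (M : complex_manifold R n)
    (L : cocycle R M) : Prop :=
  [/\ forall i : lb_idx L, open (lb_dom i),
      forall x, exists i : lb_idx L, lb_dom i x,
      forall (i j : lb_idx L) x, lb_dom i x -> lb_dom j x ->
        lb_trans i j x != 0 /\ holomorphic_at (lb_trans i j) x &
      forall (i j k : lb_idx L) x, lb_dom i x -> lb_dom j x -> lb_dom k x ->
        lb_trans i j x * lb_trans j k x = lb_trans i k x].

(* mL *)
Definition lb_pow (R : realType) (T : Type) (L : cocycle R T) (m : nat) :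
    cocycle R T :=
  Cocycle (@lb_dom R T L) (fun i j x => lb_trans i j x ^+ m).

(* F^*L *)
Definition lb_pull (R : realType) (T T' : Type) (F : T' -> T)
    (L : cocycle R T) : cocycle R T' :=
  Cocycle (fun i : lb_idx L => F @^-1` lb_dom i)
          (fun i j x => lb_trans i j (F x)).

(** * Singular metrics *)

(* [phi i] is the weight over [lb_dom i]; its values elsewhere are irrelevant. *)
Definition weights (R : realType) (T : Type) (L : cocycle R T) :=
  lb_idx L -> T -> \bar R.

(* h^m, as a metric on mL *)
Definition weights_pow (R : realType) (T : Type) (L : cocycle R T)
    (phi : weights L) (m : nat) : weights (lb_pow L m) :=
  fun i x => (m%:R%:E * phi i x)%E.
Arguments weights_pow {R T L} phi m i x.

(* F^*h, as a metric on F^*L *)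
Definition weights_pull (R : realType) (T T' : Type) (F : T' -> T)
    (L : cocycle R T) (phi : weights L) : weights (lb_pull F L) :=
  fun i x => phi i (F x).
Arguments weights_pull {R T T'} F {L} phi i x.

Definition cabs (R : realType) (z : R[i]) : R := ComplexField.Normc.normc z.

Definition upper_semicontinuous_at (R : realType) (T : topologicalType)
    (u : T -> \bar R) (x : T) : Prop :=
  forall a : R, (u x < a%:E)%E -> \forall y \near x, (u y < a%:E)%E.

(* Upper semicontinuous with values in [-oo, +oo[, and satisfying the sub-mean
   value inequality on the circles a + e^(it) b of all complex discs. *)
Definition psh_on (R : realType) (n : nat) (M : complex_manifold R n)
    (U : set M) (u : M -> \bar R) : Prop :=
  [/\ forall x, U x -> (u x < +oo)%E,
      forall x, U x -> upper_semicontinuous_at u x &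
      forall (c : chart R M n) (a b : 'rV[R[i]]_n),
        (forall d, atlas d -> compatible c d) ->
        (forall z : R[i], cabs z <= 1 ->
           (crd c @` (dom c `&` U)) (a + z *: b)) ->
        (u (par c a) <=
           ((2 * pi)^-1)%:E *
           \int[@lebesgue_measure R]_(t in `[0%R, (2 * pi)%R])
             u (par c (a + (cos t +i* sin t) *: b)%R))%E].

(* The first condition says that ||xi|| = |theta_i(xi)| e^(- phi_i) does not
   depend on the trivialization used. *)
Definition positive_singular_metric (R : realType) (n : nat)
    (M : complex_manifold R n) (L : cocycle R M) (phi : weights L) : Prop :=
  [/\ forall (i j : lb_idx L) x (t : R[i]), lb_dom i x -> lb_dom j x ->
        ((cabs (lb_trans i j x * t))%:E * expeR (- phi i x) =
         (cabs t)%:E * expeR (- phi j x))%E,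
      forall (i : lb_idx L) x, lb_dom i x ->
        locally_integrable_at (fun y => `|phi i y|%E) x &
      forall i : lb_idx L, psh_on (lb_dom i) (phi i)].

Definition pseudo_effective (R : realType) (n : nat) (M : complex_manifold R n)
    (L : cocycle R M) : Prop :=
  exists phi : weights L, positive_singular_metric phi.

(* [lne 0 = -oo], and [0 * -oo = 0] when alpha = 0. *)
Definition analytic_singularities (R : realType) (n : nat)
    (M : complex_manifold R n) (L : cocycle R M) (phi : weights L) : Prop :=
  forall (i : lb_idx L) x, lb_dom i x ->
    exists (V : set M) (alpha : R) (k : nat) (f : 'I_k -> M -> R[i])
        (v : M -> R),
      [/\ open V /\ V x, V `<=` lb_dom i /\ 0 <= alpha,
          forall l y, V y -> holomorphic_at (f l) y,
          exists B : R, forall y, V y -> `|v y| <= B &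
          forall y, V y ->
            phi i y = ((alpha / 2)%:E * lne (\sum_(l < k) cabs (f l y) ^+ 2)%:E
                       + (v y)%:E)%E].

(** * Ideal sheaves and global sections *)

(* An ideal sheaf is given by its stalks: [J x f] means that f is holomorphic
   near x and that its germ at x belongs to the ideal. *)
Definition ideal_sheaf (R : realType) (T : Type) := T -> set (T -> R[i]).

Definition multiplier_ideal (R : realType) (n : nat) (M : complex_manifold R n)
    (L : cocycle R M) (phi : weights L) : ideal_sheaf R M :=
  fun x f => holomorphic_germ x f /\
    forall i : lb_idx L, lb_dom i x ->
      locally_integrable_at
        (fun y => ((cabs (f y) ^+ 2)%:E * expeR (- (2%:E * phi i y)))%E) x.

(* J.O_C, for F : C -> M: the image in O_C of the tensor product of J and O_C,
   i.e. the germs of finite sums of a_l * (f_l o F) with f_l in J. *)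
Definition restricted_ideal (R : realType) (n k : nat)
    (C : complex_manifold R k) (M : complex_manifold R n) (F : C -> M)
    (J : ideal_sheaf R M) : ideal_sheaf R C :=
  fun p g => exists (r : nat) (a : 'I_r -> C -> R[i]) (f : 'I_r -> M -> R[i]),
    [/\ forall l, holomorphic_germ p (a l),
        forall l, J (F p) (f l) &
        \forall q \near p, g q = \sum_(l < r) a l q * f l (F q)].

(* Global sections of O(L) tensored with J, i.e. (as L is invertible) of the
   subsheaf J.O(L) of O(L).  Only the values of [s i] on [lb_dom i] matter. *)
Definition is_section (R : realType) (n : nat) (M : complex_manifold R n)
    (L : cocycle R M) (J : ideal_sheaf R M) (s : lb_idx L -> M -> R[i]) : Prop :=
  [/\ forall i x, lb_dom i x -> holomorphic_at (s i) x,
      forall i j x, lb_dom i x -> lb_dom j x ->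
        s i x = lb_trans i j x * s j x &
      forall i x, lb_dom i x -> J x (s i)].

Definition independent_sections (R : realType) (T : Type) (L : cocycle R T)
    (k : nat) (s : 'I_k -> lb_idx L -> T -> R[i]) : Prop :=
  forall a : 'I_k -> R[i],
    (forall (i : lb_idx L) x, lb_dom i x -> \sum_(l < k) a l * s l i x = 0) ->
    forall l, a l = 0.

(* Dimension (possibly +oo) of the space of global sections. *)
Definition h0 (R : realType) (n : nat) (M : complex_manifold R n)
    (L : cocycle R M) (J : ideal_sheaf R M) : \bar R :=
  ereal_sup [set k%:R%:E | k in
    [set k : nat | exists s : 'I_k -> lb_idx L -> M -> R[i],
       (forall l, is_section J (s l)) /\ independent_sections s]].

(** * Curves *)

(* A smooth projective irreducible curve in X, as a compact connected Riemann
   surface C with an embedding in X: near each point, there are charts of C and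
   X in which [inc] is the inclusion of the first coordinate axis. *)
Definition smooth_curve_in (R : realType) (n : nat) (X : complex_manifold R n)
    (C : complex_manifold R 1) (inc : C -> X) : Prop :=
  [/\ compact [set: C], connected [set: C], injective inc &
      forall p : C, exists (c : chart R C 1) (d : chart R X n),
        [/\ chart_at p c, chart_at (inc p) d &
            forall q, dom c q -> dom d (inc q) /\
              crd d (inc q) =
                \row_(j < n) (if val j == 0%N then crd c q ord0 ord0 else 0)]].

Definition nonconstant (T T' : Type) (F : T -> T') : Prop :=
  exists x y, F x <> F y.

(* Normalization of the irreducible curve A in X, by its universal property:
   a connected Riemann surface with a nonconstant holomorphic map nu to A,
   through which every such map to A factors in a unique way. *)
Definition is_normalization (R : realType) (n : nat) (X : complex_manifold R n)
    (A : set X) (Ct : complex_manifold R 1) (nu : Ct -> X) : Prop :=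
  [/\ connected [set: Ct], holomorphic_map nu, nonconstant nu,
      range nu `<=` A &
      forall (S : complex_manifold R 1) (f : S -> X),
        connected [set: S] -> holomorphic_map f -> nonconstant f ->
        range f `<=` A ->
        exists! g : S -> Ct, holomorphic_map g /\ nu \o g = f].

Definition weights_not_minus_infty_on (R : realType) (T : Type)
    (L : cocycle R T) (phi : weights L) (A : set T) : Prop :=
  exists (i : lb_idx L) (x : T), [/\ A x, lb_dom i x & phi i x <> -oo%E].

(* (L,h).C, for nu : Ct -> X the normalization of the curve C in X. *)
Definition intersection_number (R : realType) (n : nat)
    (X : complex_manifold R n) (L : cocycle R X) (phi : weights L)
    (Ct : complex_manifold R 1) (nu : Ct -> X) : \bar R :=
  limn_esup (fun m : nat =>
    ((m%:R^-1)%:E *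
     h0 (lb_pow (lb_pull nu L) m)
        (multiplier_ideal (weights_pow (weights_pull nu phi) m)))%E).

(* Main.v *)
(* The normalization of a smooth curve C is an isomorphism, so both sides concern
   sections over C.  At a point p of C the analytic weight restricts to
   a * alpha * log |t| up to a bounded term, where t is a coordinate of C at p and a
   is the smallest order along C of the f_l; a vanishes outside a finite set.  Let
   N be a times m alpha rounded up.  Every germ of order at least N belongs to both
   ideals: it is a multiple of the restriction of a power of some f_l.  Conversely
   both ideals only contain germs of order at least N - a * (n + 2), because the
   integrability of |F|^2 e^(-2 m phi) on X, together with the sub-mean value
   inequality on polydiscs of radius comparable to |t|^a around the points of C,
   bounds the order of F along C from below.  Hence the two dimensions differ by a
   constant independent of m, which is killed by the factor 1 / m. *)
Require Import Defs.
From HB Require Import structures.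
From mathcomp Require Import all_boot all_order all_algebra.
From mathcomp Require Import all_classical all_reals all_analysis.
From mathcomp Require Import measurable_realfun complex.
From mathcomp Require Import ring lra.
Set Implicit Arguments.
Unset Strict Implicit.
Unset Printing Implicit Defensive.
Import Order.TTheory GRing.Theory Num.Theory.
Import numFieldNormedType.Exports.
Local Open Scope complex_scope.
Local Open Scope classical_set_scope.
Local Open Scope ring_scope.

(** The integrals that define multiplier ideals are iterated integrals in charts, whose inner
    integrals are not known to be measurable. Weighted functions are therefore compared by
    monotonicity alone, and integrability acts through one lower bound: by the value at the centre
    of a product of squares. In one variable that bound is Cauchy's formula for the square of a
    function, on a rectangle whose edges are picked by averaging; hence the Cauchy theory on
    rectangles. A single estimate serves for both ideals. Along the embedding in [X] it bounds the
    order below by [a * (m alpha - n)]; for the pulled-back metric it is applied to the identity of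
    the curve, with [n = 1]. Rounding up costs one more [a], and [n + 2] covers both [n + 1] and
    [2]. That [a] is finite at every point comes from connectedness: the points around which the
    weight is [-oo] along the curve form an open and closed set, and compactness then leaves
    finitely many points with [a] nonzero. Dimensions are compared in the extended reals, one
    independent family of sections at a time. *)

(** * Real-valued modulus and neighbourhoods on [R[i]] *)

Section cabs.
Variable R : realType.
Implicit Types z w : R[i].

Lemma normC_cabs z : `|z| = (cabs z)%:C.
Proof. by []. Qed.

Lemma cabs_ge0 z : 0 <= cabs z.
Proof. by rewrite /cabs; case: z => a b /=; rewrite sqrtr_ge0. Qed.

Lemma cabs0 : cabs (0 : R[i]) = 0.
Proof. exact: ComplexField.Normc.normc0. Qed.

Lemma cabs1 : cabs (1 : R[i]) = 1.
Proof. exact: ComplexField.Normc.normc1. Qed.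

Lemma cabsM z w : cabs (z * w) = cabs z * cabs w.
Proof. exact: ComplexField.Normc.normcM. Qed.

Lemma cabsV z : cabs z^-1 = (cabs z)^-1.
Proof. exact: ComplexField.Normc.normcV. Qed.

Lemma cabsN z : cabs (- z) = cabs z.
Proof. exact: normcN. Qed.

Lemma cabsB z w : cabs (z - w) = cabs (w - z).
Proof. by rewrite -cabsN opprB. Qed.

Lemma cabsX z n : cabs (z ^+ n) = cabs z ^+ n.
Proof. by elim: n => [|n IH]; rewrite ?expr0 ?cabs1// !exprS cabsM IH. Qed.

Lemma cabs_leD z w : cabs (z + w) <= cabs z + cabs w.
Proof. exact: le_normcD. Qed.

Lemma cabs_leB z w : cabs z - cabs w <= cabs (z - w).
Proof. by rewrite lerBlDr (le_trans _ (cabs_leD _ _))// subrK. Qed.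

Lemma cabs_eq0 z : (cabs z == 0) = (z == 0).
Proof.
apply/eqP/eqP => [|->]; last exact: cabs0.
exact: ComplexField.Normc.eq0_normc.
Qed.

Lemma cabs_gt0 z : (0 < cabs z) = (z != 0).
Proof. by rewrite lt_neqAle cabs_ge0 andbT eq_sym cabs_eq0. Qed.

Lemma Re_le_cabs z : `|complex.Re z| <= cabs z.
Proof.
case: z => a b /=; rewrite /cabs /= -sqrtr_sqr ler_wsqrtr// lerDl sqr_ge0 //.
Qed.

Lemma Im_le_cabs z : `|complex.Im z| <= cabs z.
Proof.
case: z => a b /=; rewrite /cabs /= -sqrtr_sqr ler_wsqrtr// lerDr sqr_ge0 //.
Qed.

Lemma cabs_le_ReIm z : cabs z <= `|complex.Re z| + `|complex.Im z|.
Proof.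
case: z => a b /=; rewrite /cabs /=.
rewrite -[leRHS]ger0_norm ?addr_ge0// -sqrtr_sqr ler_wsqrtr// sqrrD.
have := mulr_ge0 (normr_ge0 a) (normr_ge0 b).
rewrite -(real_normK (num_real a)) -(real_normK (num_real b)).
by set x := `|a|; set y := `|b|; rewrite mulr2n => h; nra.
Qed.

Lemma cabs_real (x : R) : cabs x%:C = `|x|.
Proof. by rewrite /cabs /= expr0n /= addr0 sqrtr_sqr. Qed.

Lemma cabs_i : cabs ('i : R[i]) = 1.
Proof. by rewrite /cabs /= expr0n /= add0r expr1n sqrtr1. Qed.

(** The norm of [R[i]] has values in [R[i]], so its balls have complex radii; a positive complex
    number being real, radii in [R] describe the same neighbourhoods. *)
Lemma nbhs_cabs z (P : set R[i]) :
  nbhs z P <-> exists2 e : R, 0 < e & forall w, cabs (w - z) < e -> P w.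
Proof.
split.
  case/nbhs_normP => /= e e0 eP.
  have [d d0 de] : exists2 d : R, 0 < d & e = d%:C.
    exists (complex.Re e); first by move: e0; rewrite ltcE/= => /andP[].
    by move: e0; rewrite ltcE/= => /andP[/eqP]; case: (e) => a b /= -> .
  exists d => // w wz; apply: eP => /=.
  by rewrite de normC_cabs cabsB ltcR.
case=> e e0 eP; apply/nbhs_normP; exists e%:C => /=; first by rewrite ltcR.
by move=> w /=; rewrite normC_cabs ltcR => wz; apply: eP; rewrite cabsB.
Qed.

Lemma nbhs_rV_cabs n (z : 'rV[R[i]]_n) (P : set 'rV[R[i]]_n) :
  nbhs z P <-> exists2 e : R, 0 < e &
    forall w : 'rV[R[i]]_n, (forall j, cabs (w ord0 j - z ord0 j) < e) -> P w.
Proof.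
split.
  case/nbhs_ballP => /= e e0 eP.
  have [d d0 de] : exists2 d : R, 0 < d & e = d%:C.
    exists (complex.Re e); first by move: e0; rewrite ltcE/= => /andP[].
    by move: e0; rewrite ltcE/= => /andP[/eqP]; case: (e) => a b /= -> .
  exists d => // w wz; apply: eP; split=> // i j; rewrite ord1 -ball_normE /=.
  by rewrite de normC_cabs cabsB ltcR.
case=> e e0 eP; apply/nbhs_ballP; exists e%:C => /=; first by rewrite ltcR.
move=> w /= [_ bw]; apply: eP => j; have := bw ord0 j.
by rewrite -ball_normE /= normC_cabs ltcR cabsB.
Qed.

Lemma cvg_cabsP (T : Type) (F : set_system T) (FF : Filter F) (f : T -> R[i]) z :
  f @ F --> z <-> forall e : R, 0 < e -> \forall t \near F, cabs (f t - z) < e.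
Proof.
split=> [fz e e0|fz].
  have /fz : nbhs z [set w | cabs (w - z) < e] by apply/nbhs_cabs; exists e.
  by [].
by move=> P /nbhs_cabs [e e0 eP]; apply: filterS (fz _ e0) => t; exact: eP.
Qed.

Lemma cvg_complex (T : Type) (F : set_system T) (FF : Filter F) (u v : T -> R) a b :
  u @ F --> a -> v @ F --> b -> (fun t => u t +i* v t) @ F --> (a +i* b).
Proof.
move=> ua vb; apply/cvg_cabsP => e e0.
have e20 : 0 < e / 2 by rewrite divr_gt0.
move/cvgrPdist_lt/(_ _ e20) : ua => ua; move/cvgrPdist_lt/(_ _ e20) : vb => vb.
near=> t; rewrite (le_lt_trans (cabs_le_ReIm _))//= (splitr e) ltrD// distrC.
- by near: t.
- by near: t.
Unshelve. all: by end_near. Qed.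

Lemma continuous_Re : continuous (@complex.Re R : R[i] -> R).
Proof.
move=> z; apply/(@cvgrPdist_lt _ _ _ (nbhs z) _) => e e0; apply/nbhs_cabs; exists e => // w.
by rewrite cabsB; apply: le_lt_trans; rewrite (le_trans _ (Re_le_cabs _))//;
  case: (z) (w) => a b [c d].
Qed.

Lemma continuous_Im : continuous (@complex.Im R : R[i] -> R).
Proof.
move=> z; apply/(@cvgrPdist_lt _ _ _ (nbhs z) _) => e e0; apply/nbhs_cabs; exists e => // w.
by rewrite cabsB; apply: le_lt_trans; rewrite (le_trans _ (Im_le_cabs _))//;
  case: (z) (w) => a b [c d].
Qed.

Lemma continuous_cabs : continuous (@cabs R : R[i] -> R).
Proof.
move=> z; apply/(@cvgrPdist_lt _ _ _ (nbhs z) _) => e e0; apply/nbhs_cabs; exists e => // w.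
apply: le_lt_trans; rewrite ler_norml lerBrDl lerBlDl.
by rewrite -lerBlDr cabs_leB cabsB cabs_leB.
Qed.

(** Scalars are complex, so the derivative in the single direction [1] is already the complex
    derivative; its difference quotients give the first-order estimate that Goursat's argument
    consumes. *)
Lemma differentiable_cabs (f : R[i] -> R[i]) z : differentiable f z ->
  exists d : R[i], forall e : R, 0 < e ->
    \forall w \near z, cabs (f w - f z - d * (w - z)) <= e * cabs (w - z).
Proof.
move=> /(@diff_derivable _ _ _ f z (1 : R[i])) df.
pose d : R[i] := 'D_(1 : R[i]) f z.
exists d => e e0.
have df' : h^-1 *: (f (h *: (1 : R[i]) + z) - f z) @[h --> (0 : R[i])^'] --> d by exact: df.
move/cvg_cabsP : df' => /(_ _ e0).
rewrite /dnbhs /within /= => /nbhs_cabs[r r0 rP].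
apply/nbhs_cabs; exists r => // w wz.
have [->|wz0] := eqVneq w z; first by rewrite !subrr mulr0 subr0 cabs0 mulr0.
have wz1 : w - z != 0 by rewrite subr_eq0.
have := rP (w - z); rewrite subr0 => /(_ wz wz1).
have -> : (w - z) *: (1 : R[i]) + z = w by rewrite /GRing.scale /= mulr1 subrK.
move=> /ltW h.
have -> : f w - f z - d * (w - z) = ((w - z)^-1 * (f w - f z) - d) * (w - z).
  by rewrite mulrBl mulrAC mulVf// mul1r.
by rewrite cabsM ler_wpM2r ?cabs_ge0.
Qed.
End cabs.
Arguments cabs : simpl never.

Section pointwise_continuity.
Variables (R : realType) (T : topologicalType).
Implicit Types (f g : T -> R[i]) (x : T).

Lemma for_continuousB f g x : {for x, continuous f} -> {for x, continuous g} ->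
  {for x, continuous (fun t => f t - g t : R[i])}.
Proof. by move=> cf cg; apply: cvgB; [exact: cf|exact: cg]. Qed.

Lemma for_continuousM f g x : {for x, continuous f} -> {for x, continuous g} ->
  {for x, continuous (fun t => f t * g t : R[i])}.
Proof. by move=> cf cg; apply: cvgM; [exact: cf|exact: cg]. Qed.

Lemma for_continuous_cst (k : R[i]) x : {for x, continuous (fun _ : T => k)}.
Proof. exact: cst_continuous. Qed.

End pointwise_continuity.

(** * Integrals of complex functions along segments *)

(** Continuity at the end points is two-sided in [R], not relative to the segment: the integrands
    come from functions on [R[i]] that are continuous at every point of a closed edge. *)
Definition cont_on (R : realType) (T : topologicalType) (a b : R) (g : R -> T) :=
  forall x, a <= x <= b -> {for x, continuous g}.

Definition RI (R : realType) (a b : R) (u : R -> R) : R :=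
  (\int[@lebesgue_measure R]_(x in `[a, b]) u x)%R.

Definition CI (R : realType) (a b : R) (g : R -> R[i]) : R[i] :=
  RI a b (@complex.Re R \o g) +i* RI a b (@complex.Im R \o g).

Arguments CI : simpl never.

Section intervals.
Variable R : realType.
Implicit Types (a b c M : R) (u v : R -> R) (g h : R -> R[i]).

Lemma cont_on_integrable a b u : cont_on a b u ->
  (@lebesgue_measure R).-integrable `[a, b] (EFin \o u).
Proof.
move=> cu; apply: continuous_compact_integrable; first exact: segment_compact.
by apply: continuous_in_subspaceT => x; rewrite inE /= in_itv /=; exact: cu.
Qed.

Lemma RID a b u v : cont_on a b u -> cont_on a b v ->
  RI a b (fun x => u x + v x) = RI a b u + RI a b v.
Proof. by move=> cu cv; rewrite /RI RintegralD//; exact: cont_on_integrable. Qed.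

Lemma RIB a b u v : cont_on a b u -> cont_on a b v ->
  RI a b (fun x => u x - v x) = RI a b u - RI a b v.
Proof. by move=> cu cv; rewrite /RI RintegralB//; exact: cont_on_integrable. Qed.

Lemma RIZ a b k u : cont_on a b u -> RI a b (fun x => k * u x) = k * RI a b u.
Proof. by move=> cu; rewrite /RI RintegralZl//; exact: cont_on_integrable. Qed.

Lemma RI_le a b u v : cont_on a b u -> cont_on a b v ->
  (forall x, a <= x <= b -> u x <= v x) -> RI a b u <= RI a b v.
Proof.
by move=> cu cv uv; apply: le_Rintegral => //; exact: cont_on_integrable.
Qed.

Lemma eq_RI a b u v : (forall x, a <= x <= b -> u x = v x) -> RI a b u = RI a b v.
Proof.
by move=> uv; apply: eq_Rintegral => x; rewrite inE /= in_itv /=; exact: uv.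
Qed.

Lemma RI_cst a b k : a <= b -> RI a b (fun=> k) = k * (b - a).
Proof.
move=> ab; rewrite /RI Rintegral_cst//= lebesgue_measure_itv /= lte_fin.
case: ltP => [_|ba]; first by rewrite -EFinD.
have -> : a = b by apply/eqP; rewrite eq_le ab.
by rewrite subrr.
Qed.

Lemma cont_onS (T : topologicalType) a b a' b' (u : R -> T) : a <= a' -> b' <= b ->
  cont_on a b u -> cont_on a' b' u.
Proof.
move=> aa bb cu x /andP[ax xb]; apply: cu.
by rewrite (le_trans aa)//= (le_trans xb).
Qed.

Lemma RI_split c a b u : a <= c -> c <= b -> cont_on a b u ->
  RI a b u = RI a c u + RI c b u.
Proof.
move=> ac cb cu; rewrite /RI.
have := @Rintegral_itvB R u (BLeft a) (BRight b) c (cont_on_integrable cu).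
rewrite !bnd_simp => /(_ ac cb) /eqP; rewrite subr_eq addrC => /eqP ->.
congr (_ + _); rewrite Rintegral_itv_obnd_cbnd//.
have cu' : cont_on c b u by apply: cont_onS cu.
apply: integrableS (cont_on_integrable cu') => //.
by apply: subset_itvr; rewrite bnd_simp.
Qed.

Lemma RI_norm a b u : cont_on a b u -> `|RI a b u| <= RI a b (fun x => `|u x|).
Proof. by move=> cu; apply: le_normr_Rintegral => //; exact: cont_on_integrable. Qed.

Lemma RI_FTC a b F u : a < b -> cont_on a b u ->
  (forall x, a <= x <= b -> is_derive x 1 F (u x)) -> RI a b u = F b - F a.
Proof.
move=> ab cu dF; rewrite /RI /Rintegral.
rewrite (@continuous_FTC2 _ u F)//.
- by apply: continuous_in_subspaceT => x; rewrite inE /= in_itv /=; exact: cu.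
- have cF x : a <= x <= b -> {for x, continuous F}.
    by move=> /dF[dFx _]; apply/differentiable_continuous/derivable1_diffP.
  split.
  + by move=> x; rewrite in_itv /= => /andP[ax xb]; case: (dF x) => //; rewrite !ltW.
  + by apply: cvg_at_right_filter; apply: cF; rewrite lexx ltW.
  + by apply: cvg_at_left_filter; apply: cF; rewrite lexx ltW.
- move=> x; rewrite in_itv /= => /andP[ax xb]; rewrite derive1E.
  by apply: derive_val; apply: dF; rewrite !ltW.
Qed.

Lemma cont_on_Re a b g : cont_on a b g -> cont_on a b (@complex.Re R \o g).
Proof. by move=> cg x /cg cx; apply: continuous_comp => //; exact: continuous_Re. Qed.

Lemma cont_on_Im a b g : cont_on a b g -> cont_on a b (@complex.Im R \o g).
Proof. by move=> cg x /cg cx; apply: continuous_comp => //; exact: continuous_Im. Qed.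

Lemma cont_on_cabs a b g : cont_on a b g -> cont_on a b (fun x => cabs (g x)).
Proof. by move=> cg x /cg cx; apply: (continuous_comp cx); exact: continuous_cabs. Qed.

Lemma eq_CI a b g h : (forall x, a <= x <= b -> g x = h x) -> CI a b g = CI a b h.
Proof. by move=> gh; congr (_ +i* _); apply: eq_RI => x /gh /= ->. Qed.

Lemma CID a b g h : cont_on a b g -> cont_on a b h ->
  CI a b (fun x => g x + h x) = CI a b g + CI a b h.
Proof.
move=> cg ch; have [gR gI] := (cont_on_Re cg, cont_on_Im cg).
have [hR hI] := (cont_on_Re ch, cont_on_Im ch).
transitivity (RI a b (fun x => complex.Re (g x) + complex.Re (h x)) +i*
    RI a b (fun x => complex.Im (g x) + complex.Im (h x))).
  by congr (_ +i* _); apply: eq_RI => x _ /=; case: (g x) (h x) => ? ? [].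
by rewrite (RID gR hR) (RID gI hI).
Qed.

Lemma CIZ a b k g : cont_on a b g ->
  CI a b (fun x => k * g x) = k * CI a b g.
Proof.
move=> cg; have cR := cont_on_Re cg; have cI := cont_on_Im cg.
have cM r (u : R -> R) : cont_on a b u -> cont_on a b (fun x => r * u x).
  by move=> cu x /cu cx; apply: continuousM => //; exact: cst_continuous.
case: k => k l.
transitivity (RI a b (fun x => k * complex.Re (g x) - l * complex.Im (g x)) +i*
    RI a b (fun x => k * complex.Im (g x) + l * complex.Re (g x))).
  by congr (_ +i* _); apply: eq_RI => x _ /=; case: (g x).
rewrite (RIB (cM k _ cR) (cM l _ cI)) (RID (cM k _ cI) (cM l _ cR)).
by rewrite (RIZ k cR) (RIZ l cI) (RIZ k cI) (RIZ l cR).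
Qed.

Lemma CI_split c a b g : a <= c -> c <= b -> cont_on a b g ->
  CI a b g = CI a c g + CI c b g.
Proof.
move=> ac cb cg.
by rewrite /CI /GRing.add /=; congr (_ +i* _); apply: RI_split => //;
  [exact: cont_on_Re|exact: cont_on_Im].
Qed.

(** Real and imaginary parts are bounded separately, whence the factor 2; the constants further on
    leave room for it. *)
Lemma CI_cabs a b g : cont_on a b g ->
  cabs (CI a b g) <= 2 * RI a b (fun x => cabs (g x)).
Proof.
move=> cg; rewrite (le_trans (cabs_le_ReIm _))//= mulr_natl mulr2n.
have cn (u : R -> R) : cont_on a b u -> cont_on a b (fun x => `|u x|).
  by move=> cu x /cu cx; apply: (continuous_comp cx); exact: norm_continuous.
apply: lerD.
  rewrite (le_trans (RI_norm (cont_on_Re cg)))//; apply: RI_le.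
  - exact/cn/cont_on_Re.
  - exact: cont_on_cabs.
  - by move=> x _; exact: Re_le_cabs.
rewrite (le_trans (RI_norm (cont_on_Im cg)))//; apply: RI_le.
- exact/cn/cont_on_Im.
- exact: cont_on_cabs.
- by move=> x _; exact: Im_le_cabs.
Qed.

Lemma CI_cabs_le a b M g : a <= b -> cont_on a b g ->
  (forall x, a <= x <= b -> cabs (g x) <= M) -> cabs (CI a b g) <= 2 * M * (b - a).
Proof.
move=> ab cg gM; rewrite (le_trans (CI_cabs cg))// -mulrA ler_wpM2l//.
rewrite -RI_cst//; apply: RI_le => //; first exact: cont_on_cabs.
by move=> x _; exact: cst_continuous.
Qed.

End intervals.

(** * Contour integrals over rectangles and Goursat's theorem *)

Definition rect (R : realType) (x0 x1 y0 y1 : R) : set R[i] :=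
  [set z | x0 <= complex.Re z <= x1 /\ y0 <= complex.Im z <= y1].

(** This is the integral of [f z dz] along the boundary, counterclockwise; the vertical edges carry
    ['i] since [dz = 'i dy] there. *)
Definition rect_int (R : realType) (f : R[i] -> R[i]) (x0 x1 y0 y1 : R) : R[i] :=
  CI x0 x1 (fun x => f (x +i* y0)) + 'i * CI y0 y1 (fun y => f (x1 +i* y))
  - CI x0 x1 (fun x => f (x +i* y1)) - 'i * CI y0 y1 (fun y => f (x0 +i* y)).

Definition edges_cont (R : realType) (f : R[i] -> R[i]) (x0 x1 y0 y1 : R) :=
  [/\ cont_on x0 x1 (fun x => f (x +i* y0)), cont_on y0 y1 (fun y => f (x1 +i* y)),
      cont_on x0 x1 (fun x => f (x +i* y1)) & cont_on y0 y1 (fun y => f (x0 +i* y))].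

Arguments rect_int : simpl never.

Section rectangles.
Variable R : realType.
Implicit Types (f g : R[i] -> R[i]) (x y M : R) (z : R[i]).

Lemma continuous_hline y : continuous (fun x : R => x +i* y).
Proof. by move=> x; apply: cvg_complex; [exact: cvg_id|exact: cvg_cst]. Qed.

Lemma continuous_vline x : continuous (fun y : R => x +i* y).
Proof. by move=> y; apply: cvg_complex; [exact: cvg_cst|exact: cvg_id]. Qed.

Lemma cont_on_hline f a b y : (forall x, a <= x <= b -> {for x +i* y, continuous f}) ->
  cont_on a b (fun x => f (x +i* y)).
Proof. by move=> cf x /cf; apply: continuous_comp; exact: continuous_hline. Qed.

Lemma cont_on_vline f a b x : (forall y, a <= y <= b -> {for x +i* y, continuous f}) ->
  cont_on a b (fun y => f (x +i* y)).
Proof. by move=> cf y /cf; apply: continuous_comp; exact: continuous_vline. Qed.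

Lemma rect_edges_cont f x0 x1 y0 y1 : x0 <= x1 -> y0 <= y1 ->
  (forall z, rect x0 x1 y0 y1 z -> {for z, continuous f}) ->
  edges_cont f x0 x1 y0 y1.
Proof.
move=> x01 y01 cf; split; (apply: cont_on_hline || apply: cont_on_vline);
  by move=> t tab; apply: cf; split; rewrite /= ?lexx ?x01 ?y01.
Qed.

Lemma edges_contD f g x0 x1 y0 y1 : edges_cont f x0 x1 y0 y1 ->
  edges_cont g x0 x1 y0 y1 -> edges_cont (fun z => f z + g z) x0 x1 y0 y1.
Proof.
have cD a b (u v : R -> R[i]) : cont_on a b u -> cont_on a b v ->
    cont_on a b (fun t => u t + v t).
  by move=> cu cv t tab; apply: cvgD; [exact: cu|exact: cv].
by move=> [f1 f2 f3 f4] [g1 g2 g3 g4]; split; apply: cD.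
Qed.

Lemma edges_contM f g x0 x1 y0 y1 : edges_cont f x0 x1 y0 y1 ->
  edges_cont g x0 x1 y0 y1 -> edges_cont (fun z => f z * g z) x0 x1 y0 y1.
Proof.
have cD a b (u v : R -> R[i]) : cont_on a b u -> cont_on a b v ->
    cont_on a b (fun t => u t * v t).
  by move=> cu cv t tab; apply: cvgM; [exact: cu|exact: cv].
by move=> [f1 f2 f3 f4] [g1 g2 g3 g4]; split; apply: cD.
Qed.

Lemma edges_cont_cst k x0 x1 y0 y1 : edges_cont (fun=> k) x0 x1 y0 y1.
Proof. by split=> t _; exact: cst_continuous. Qed.

Lemma rect_intD f g x0 x1 y0 y1 : edges_cont f x0 x1 y0 y1 ->
  edges_cont g x0 x1 y0 y1 ->
  rect_int (fun z => f z + g z) x0 x1 y0 y1 =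
  rect_int f x0 x1 y0 y1 + rect_int g x0 x1 y0 y1.
Proof.
move=> [f1 f2 f3 f4] [g1 g2 g3 g4]; rewrite /rect_int.
by rewrite (CID f1 g1) (CID f2 g2) (CID f3 g3) (CID f4 g4); ring.
Qed.

Lemma rect_intZ f k x0 x1 y0 y1 : edges_cont f x0 x1 y0 y1 ->
  rect_int (fun z => k * f z) x0 x1 y0 y1 = k * rect_int f x0 x1 y0 y1.
Proof.
move=> [f1 f2 f3 f4]; rewrite /rect_int.
by rewrite (CIZ k f1) (CIZ k f2) (CIZ k f3) (CIZ k f4); ring.
Qed.

Definition bdry x0 x1 y0 y1 : set R[i] := [set z | rect x0 x1 y0 y1 z /\
  (complex.Re z = x0 \/ complex.Re z = x1 \/ complex.Im z = y0 \/ complex.Im z = y1)].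

Lemma eq_rect_int f g x0 x1 y0 y1 : x0 <= x1 -> y0 <= y1 ->
  (forall z, bdry x0 x1 y0 y1 z -> f z = g z) ->
  rect_int f x0 x1 y0 y1 = rect_int g x0 x1 y0 y1.
Proof.
move=> x01 y01 fg; rewrite /rect_int.
congr (_ + 'i * _ - _ - 'i * _); apply: eq_CI => t tab; apply: fg;
  split; [split|idtac|split|idtac|split|idtac|split|idtac]; rewrite /= ?lexx ?x01 ?y01 //; tauto.
Qed.

Lemma edges_cont_bdry f x0 x1 y0 y1 : x0 <= x1 -> y0 <= y1 ->
  (forall z, bdry x0 x1 y0 y1 z -> {for z, continuous f}) ->
  edges_cont f x0 x1 y0 y1.
Proof.
move=> x01 y01 cf; split; (apply: cont_on_hline || apply: cont_on_vline);
  move=> t tab; apply: cf; (split; [split|idtac]); rewrite /= ?lexx ?x01 ?y01 //; tauto.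
Qed.

Lemma rect_int_cabs f M x0 x1 y0 y1 : x0 <= x1 -> y0 <= y1 ->
  edges_cont f x0 x1 y0 y1 ->
  (forall z, bdry x0 x1 y0 y1 z -> cabs (f z) <= M) ->
  cabs (rect_int f x0 x1 y0 y1) <= 4 * M * ((x1 - x0) + (y1 - y0)).
Proof.
move=> x01 y01 [c1 c2 c3 c4] fM; rewrite /rect_int.
have h1 : cabs (CI x0 x1 (fun x => f (x +i* y0))) <= 2 * M * (x1 - x0).
  apply: CI_cabs_le => // t tab; apply: fM; split; first split;
  rewrite /= ?lexx ?x01 ?y01 //; tauto.
have h2 : cabs ('i * CI y0 y1 (fun y => f (x1 +i* y))) <= 2 * M * (y1 - y0).
  rewrite cabsM cabs_i mul1r.
  apply: CI_cabs_le => // t tab; apply: fM; split; first split;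
  rewrite /= ?lexx ?x01 ?y01 //; tauto.
have h3 : cabs (CI x0 x1 (fun x => f (x +i* y1))) <= 2 * M * (x1 - x0).
  apply: CI_cabs_le => // t tab; apply: fM; split; first split;
  rewrite /= ?lexx ?x01 ?y01 //; tauto.
have h4 : cabs ('i * CI y0 y1 (fun y => f (x0 +i* y))) <= 2 * M * (y1 - y0).
  rewrite cabsM cabs_i mul1r.
  apply: CI_cabs_le => // t tab; apply: fM; split; first split;
  rewrite /= ?lexx ?x01 ?y01 //; tauto.
move: h1 h2 h3 h4.
set a := CI _ _ _; set b := 'i * _; set c := CI _ _ _; set d := 'i * _.
move=> h1 h2 h3 h4.
have := cabs_leD (a + b - c) (- d); have := cabs_leD (a + b) (- c).
have := cabs_leD a b; rewrite !cabsN; lra.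
Qed.

Lemma rect_int_splitx f c x0 x1 y0 y1 : x0 <= c -> c <= x1 ->
  cont_on x0 x1 (fun x => f (x +i* y0)) -> cont_on x0 x1 (fun x => f (x +i* y1)) ->
  rect_int f x0 x1 y0 y1 = rect_int f x0 c y0 y1 + rect_int f c x1 y0 y1.
Proof.
move=> x0c cx1 c0 c1; rewrite /rect_int.
by rewrite (CI_split x0c cx1 c0) (CI_split x0c cx1 c1); ring.
Qed.

Lemma rect_int_splity f c x0 x1 y0 y1 : y0 <= c -> c <= y1 ->
  cont_on y0 y1 (fun y => f (x0 +i* y)) -> cont_on y0 y1 (fun y => f (x1 +i* y)) ->
  rect_int f x0 x1 y0 y1 = rect_int f x0 x1 y0 c + rect_int f x0 x1 c y1.
Proof.
move=> x0c cx1 c0 c1; rewrite /rect_int.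
by rewrite (CI_split x0c cx1 c0) (CI_split x0c cx1 c1); ring.
Qed.

Lemma RI_id (a b : R) : a <= b -> RI a b id = (b ^+ 2 - a ^+ 2) / 2.
Proof.
rewrite le_eqVlt => /predU1P[->|ab].
  by rewrite subrr mul0r /RI set_itv1 Rintegral_set1.
have dF (x : R) : is_derive x 1 (fun t : R => t ^+ 2 / 2) x.
  apply: is_derive_eq.
  by rewrite /GRing.scale /=; field.
rewrite mulrBl; apply: (RI_FTC (F := fun t : R => t ^+ 2 / 2) ab) => x _.
exact: cvg_id.
Qed.

Lemma rect_int_affine A B x0 x1 y0 y1 : x0 <= x1 -> y0 <= y1 ->
  rect_int (fun z => A + B * z) x0 x1 y0 y1 = 0.
Proof.
move=> x01 y01.
have cid : edges_cont (id : R[i] -> R[i]) x0 x1 y0 y1.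
  by apply: rect_edges_cont => // z _; exact: cvg_id.
rewrite rect_intD; last 2 first.
  exact: edges_cont_cst.
  by apply: (edges_contM (edges_cont_cst _ _ _ _ _)).
rewrite rect_intZ// (_ : rect_int (fun=> A) _ _ _ _ = 0); last first.
  by rewrite /rect_int; ring.
have E a b (u v : R -> R) : CI a b (fun t => u t +i* v t) = RI a b u +i* RI a b v by [].
rewrite /rect_int !E RI_id// RI_id// !RI_cst// add0r.
rewrite [X in B * X](_ : _ = 0) ?mulr0//.
by apply/eqP; rewrite eq_complex /= ; apply/andP; split; apply/eqP; field.
Qed.

End rectangles.

Lemma continuous_sub_affine (R : realType) (f : R[i] -> R[i]) (k d c z : R[i]) :
  {for z, continuous f} -> {for z, continuous (fun w => f w - k - d * (w - c) : R[i])}.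
Proof.
move=> cz; apply: for_continuousB.
  by apply: for_continuousB; [exact: cz|exact: for_continuous_cst].
apply: for_continuousM; first exact: for_continuous_cst.
by apply: for_continuousB; [exact: cvg_id|exact: for_continuous_cst].
Qed.

Section goursat.
Variable R : realType.
Implicit Types (f g : R[i] -> R[i]) (x y : R) (z : R[i]).

(** The inner edges cancel, so the integral is the sum of those over the four quarters, and one of
    them carries at least a fourth of the modulus. [s] and [t] select the right and the upper
    halves. *)
Lemma rect_int_quarter f x y a b : 0 <= a -> 0 <= b ->
  (forall z, rect x (x + 2 * a) y (y + 2 * b) z -> {for z, continuous f}) ->
  exists s t : bool,
  cabs (rect_int f x (x + 2 * a) y (y + 2 * b)) <=
  4 * cabs (rect_int f (x + s%:R * a) (x + s%:R * a + a)
                       (y + t%:R * b) (y + t%:R * b + b)).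
Proof.
move=> a0 b0 cf.
have ch v : y <= v <= y + 2 * b -> cont_on x (x + 2 * a) (fun t => f (t +i* v)).
  by move=> vb; apply: cont_on_hline => t tab; apply: cf.
have cv v : x <= v <= x + 2 * a -> cont_on y (y + 2 * b) (fun t => f (v +i* t)).
  by move=> vb; apply: cont_on_vline => t tab; apply: cf.
rewrite (@rect_int_splitx _ f (x + a)); [|lra|lra|apply: ch; lra|apply: ch; lra].
rewrite (@rect_int_splity _ f (y + b) x); [|lra|lra|apply: cv; lra|apply: cv; lra].
rewrite (@rect_int_splity _ f (y + b) (x + a)); [|lra|lra|apply: cv; lra|apply: cv; lra].
(* The four integrals are named through existentials so that they become opaque variables for
   [lra]. *)
have E (s t : bool) : exists2 r : R[i], r = (rect_int f (x + s%:R * a) (x + s%:R * a + a)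
                       (y + t%:R * b) (y + t%:R * b + b)) & r = r by exists (rect_int f (x + s%:R * a) (x + s%:R * a + a)
                       (y + t%:R * b) (y + t%:R * b + b)).
have [r1 e1 _] := E false false; have [r2 e2 _] := E false true.
have [r3 e3 _] := E true false; have [r4 e4 _] := E true true.
have x2 : x + a + a = x + 2 * a by ring.
have y2 : y + b + b = y + 2 * b by ring.
move: e1 e2 e3 e4; rewrite !mul0r !mul1r !addr0 x2 y2 => e1 e2 e3 e4.
have h1 := cabs_leD r1 r2; have h2 := cabs_leD r3 r4.
have h3 := cabs_leD (r1 + r2) (r3 + r4).
have [l1|l1] := leP (cabs (r1 + r2 + (r3 + r4))) (4 * cabs r1).
  by exists false, false; rewrite !mul0r !addr0 -e1 -e2 -e3 -e4.
have [l2|l2] := leP (cabs (r1 + r2 + (r3 + r4))) (4 * cabs r2).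
  by exists false, true; rewrite !mul0r !mul1r !addr0 y2 -e1 -e2 -e3 -e4.
have [l3|l3] := leP (cabs (r1 + r2 + (r3 + r4))) (4 * cabs r3).
  by exists true, false; rewrite !mul0r !mul1r !addr0 x2 -e1 -e2 -e3 -e4.
exists true, true; rewrite !mul1r x2 y2 -e1 -e2 -e3 -e4; lra.
Qed.

Lemma nested_intervals (u l : nat -> R) : (forall n, 0 <= l n) ->
  (forall n, u n <= u n.+1 /\ u n.+1 + l n.+1 <= u n + l n) ->
  exists c : R, forall n, u n <= c <= u n + l n.
Proof.
move=> l0 ul.
have um n m : u n <= u (n + m)%N.
  by elim: m => [|m IH]; rewrite ?addn0// addnS (le_trans IH)//; case: (ul (n + m)%N).
have lm n m : u (n + m)%N + l (n + m)%N <= u n + l n.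
  by elim: m => [|m IH]; rewrite ?addn0// addnS (le_trans _ IH)//; case: (ul (n + m)%N).
have ub n m : u m <= u n + l n.
  have [nm|mn] := leqP n m.
    by rewrite -(subnKC nm) (le_trans _ (lm n (m - n)%N))// lerDl.
  by rewrite (le_trans (um m (n - m)%N))// subnKC ?(ltnW mn)// lerDl.
exists (sup (range u)) => n; apply/andP; split.
  apply: ub_le_sup; last by exists n.
  by exists (u 0%N + l 0%N) => _ [m _ <-].
by apply: ge_sup; [exists (u 0%N), 0%N|move=> _ [m _ <-]].
Qed.

Lemma half_pow_small (x e : R) : 0 < e -> exists n, x / 2 ^+ n < e.
Proof.
move=> e0; exists (Num.Def.archi_bound (`|x| / e)).
rewrite ltr_pdivrMr ?exprn_gt0// mulrC -ltr_pdivrMr//.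
have := archi_boundP (divr_ge0 (normr_ge0 x) (ltW e0)).
set n := Num.Def.archi_bound _ => h.
rewrite (le_lt_trans (y := `|x| / e)) ?ler_wpM2r ?invr_ge0 ?(ltW e0) ?ler_norm//.
by rewrite (lt_trans h)// -natrX ltr_nat ltn_expl.
Qed.

(** The affine part integrates to zero. On a rectangle containing [c] the remainder is at most [e]
    times width plus height, and the length of the boundary supplies the second such factor. *)
Lemma rect_int_near_affine f c d e x0 x1 y0 y1 : 0 <= e -> rect x0 x1 y0 y1 c ->
  (forall z, rect x0 x1 y0 y1 z -> {for z, continuous f}) ->
  (forall z, rect x0 x1 y0 y1 z -> cabs (f z - f c - d * (z - c)) <= e * cabs (z - c)) ->
  cabs (rect_int f x0 x1 y0 y1) <= 4 * e * ((x1 - x0) + (y1 - y0)) ^+ 2.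
Proof.
move=> e0 [/andP[xc cx] /andP[yc cy]] cf fe.
have x01 := le_trans xc cx; have y01 := le_trans yc cy.
pose g z : R[i] := f z - f c - d * (z - c).
have ecg : edges_cont g x0 x1 y0 y1.
  apply: rect_edges_cont; [exact: x01|exact: y01|move=> z /cf cz].
  by apply: continuous_sub_affine; exact: cz.
have ecl : edges_cont (fun z => (f c - d * c) + d * z) x0 x1 y0 y1.
  apply: edges_contD; first exact: edges_cont_cst.
  apply: edges_contM; first exact: edges_cont_cst.
  by apply: rect_edges_cont; [exact: x01|exact: y01|move=> z _; exact: cvg_id].
have -> : rect_int f x0 x1 y0 y1 = rect_int g x0 x1 y0 y1.
  rewrite (@eq_rect_int _ f (fun z => g z + ((f c - d * c) + d * z)))//.
    by rewrite rect_intD// rect_int_affine// addr0.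
  by move=> z _; rewrite /g; ring.
rewrite expr2 !mulrA -(mulrA 4); apply: rect_int_cabs => // z [zin _].
rewrite (le_trans (fe _ zin))// ler_wpM2l// (le_trans (cabs_le_ReIm _))//.
move: zin => [/andP[z1 z2] /andP[z3 z4]].
case: z c {fe g ecg ecl} xc cx yc cy z1 z2 z3 z4 => a b [a' b'] /= xc cx yc cy z1 z2 z3 z4.
by apply: lerD; rewrite ler_norml; apply/andP; split; lra.
Qed.

Theorem goursat f x0 x1 y0 y1 : x0 <= x1 -> y0 <= y1 ->
  (forall z, rect x0 x1 y0 y1 z -> differentiable f z) ->
  rect_int f x0 x1 y0 y1 = 0.
Proof.
move=> x01 y01 df.
have alg (E x y v k t : R) : t != 0 ->
    t * t * (4 * E * (x + v / t - x + (y + k / t - y)) ^+ 2) = E * (4 * (v + k) ^+ 2).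
  by move=> t0; field.
pose w := x1 - x0; pose h := y1 - y0.
have w0 : 0 <= w by rewrite subr_ge0.
have h0 : 0 <= h by rewrite subr_ge0.
have cf z : rect x0 x1 y0 y1 z -> {for z, continuous f}.
  by move=> /df; exact: differentiable_continuous.
pose N := cabs (rect_int f x0 x1 y0 y1).
(* A state is a number of bisections together with a lower left corner; the number of bisections
   determines the side lengths. *)
pose P (s : nat * (R * R)) := [/\ N <= 4 ^+ s.1 *
    cabs (rect_int f s.2.1 (s.2.1 + w / 2 ^+ s.1) s.2.2 (s.2.2 + h / 2 ^+ s.1)),
    x0 <= s.2.1, s.2.1 + w / 2 ^+ s.1 <= x1,
    y0 <= s.2.2 & s.2.2 + h / 2 ^+ s.1 <= y1].
(* Being an implication, [Q] holds trivially at states that violate [P], so bisection is a total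
   function on states and can be iterated. *)
pose Q (s s' : nat * (R * R)) := P s -> [/\ P s', s'.1 = s.1.+1,
   s.2.1 <= s'.2.1 /\ s'.2.1 + w / 2 ^+ s.1.+1 <= s.2.1 + w / 2 ^+ s.1 &
   s.2.2 <= s'.2.2 /\ s'.2.2 + h / 2 ^+ s.1.+1 <= s.2.2 + h / 2 ^+ s.1].
have step s : {s' | Q s s'}.
  apply: cid; have [Ps|nPs] := pselect (P s); last by exists s.
  move: s Ps => [n [x y]] [/= hN xl xr yl yr].
  have E (a : R) : a / 2 ^+ n = 2 * (a / 2 ^+ n.+1) by rewrite exprS; field.
  have wn0 : 0 <= w / 2 ^+ n.+1 by rewrite divr_ge0// exprn_ge0.
  have hn0 : 0 <= h / 2 ^+ n.+1 by rewrite divr_ge0// exprn_ge0.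
  move: hN xr yr; rewrite !E => hN xr yr.
  have /(rect_int_quarter wn0 hn0) [s [t st]] : forall z,
      rect x (x + 2 * (w / 2 ^+ n.+1)) y (y + 2 * (h / 2 ^+ n.+1)) z ->
      {for z, continuous f}.
    move=> z [/andP[z1 z2] /andP[z3 z4]]; apply: cf; split; apply/andP; split;
      clear -z1 z2 z3 z4 xl xr yl yr; lra.
  have sb (b : bool) (a : R) : 0 <= a -> 0 <= b%:R * a <= a.
    by case: b; rewrite ?mul1r ?mul0r lexx ?andbT => ->.
  have /andP[sa1 sa2] := sb s _ wn0; have /andP[sb1 sb2] := sb t _ hn0.
  exists (n.+1, (x + s%:R * (w / 2 ^+ n.+1), y + t%:R * (h / 2 ^+ n.+1))).
  move=> _; split => //=.
  - split=> /=; try lra.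
    by rewrite (le_trans hN)// [4 ^+ n.+1]exprSr -mulrA ler_wpM2l// exprn_ge0.
  - rewrite E; split; lra.
  - rewrite E; split; lra.
pose s n := iter n (fun s => sval (step s)) (0%N, (x0, y0)).
have sS n : Q (s n) (s n.+1) by rewrite /s iterS; exact: svalP (step _).
have sP n : P (s n) /\ (s n).1 = n.
  elim: n => [|n [Pn n1]].
    split=> //; split; rewrite /= ?expr0 ?divr1 ?mul1r ?lexx //.
    - by rewrite /w /h !subrKC.
    - by rewrite /w; lra.
    - by rewrite /h; lra.
  by have [Pn1 -> _ _] := sS n Pn; rewrite n1.
have wn0 (a : R) n : 0 <= a -> 0 <= a / 2 ^+ n.
  by move=> a0; rewrite divr_ge0// exprn_ge0.
have [X hX] : exists c : R, forall n, (s n).2.1 <= c <= (s n).2.1 + w / 2 ^+ n.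
  apply: nested_intervals => [n|n]; first exact: wn0.
  by have [Pn n1] := sP n; have [_ _] := sS n Pn; rewrite n1.
have [Y hY] : exists c : R, forall n, (s n).2.2 <= c <= (s n).2.2 + h / 2 ^+ n.
  apply: nested_intervals => [n|n]; first exact: wn0.
  by have [Pn n1] := sP n; have [_ _ _] := sS n Pn; rewrite n1.
have XYin : rect x0 x1 y0 y1 (X +i* Y).
  have := hX 0%N; have := hY 0%N; rewrite /= expr0 !divr1 /w /h.
  by rewrite !subrKC.
have [d dd] := differentiable_cabs (df _ XYin).
apply/eqP; rewrite -cabs_eq0; apply/eqP/le_anti; rewrite cabs_ge0 andbT.
apply/ler_addgt0Pl => e e0; rewrite addr0 -/N.
(* The factor [4 ^+ n] lost in [n] bisections cancels against the square of the side lengths, each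
   divided by [2 ^+ n]: the slope error gets multiplied by [K - 1]. The added 1 keeps [K] positive
   for a degenerate rectangle. *)
pose K := 4 * (w + h) ^+ 2 + 1.
have K0 : 0 < K by rewrite ltr_wpDl// mulr_ge0// exprn_ge0// addr_ge0.
have [r r0 rP] := (nbhs_cabs _ _).1 (dd (e / K) (divr_gt0 e0 K0)).
have [n nr] := half_pow_small (w + h) r0.
have [[hN xl xr yl yr] n1] := sP n; move: hN xl xr yl yr; rewrite n1.
have := hX n; have := hY n.
set x := (s n).2.1; set y := (s n).2.2 => /andP[Yl Yr] /andP[Xl Xr] hN xl xr yl yr.
have eK : 0 <= e / K by rewrite divr_ge0 ?ltW.
have zin : rect x (x + w / 2 ^+ n) y (y + h / 2 ^+ n) (X +i* Y).
  by split; apply/andP.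
have H : cabs (rect_int f x (x + w / 2 ^+ n) y (y + h / 2 ^+ n)) <=
    4 * (e / K) * ((x + w / 2 ^+ n - x) + (y + h / 2 ^+ n - y)) ^+ 2.
  apply: (rect_int_near_affine (d := d) eK zin) => z [/andP[z1 z2] /andP[z3 z4]].
    apply: cf; split; rewrite ?(le_trans xl z1) ?(le_trans yl z3) /=.
      exact: le_trans xr.
    exact: le_trans yr.
  apply: rP; rewrite (le_lt_trans _ nr)// mulrDl (le_trans (cabs_le_ReIm _))//.
  case: z z1 z2 z3 z4 => a b /=.
  clear -Xl Xr Yl Yr; move=> z1 z2 z3 z4.
  by apply: lerD; rewrite ler_norml; apply/andP; split; lra.
apply: (le_trans hN); apply: (@le_trans _ _ (e / K * (K - 1))); last first.
  by rewrite mulrBr mulr1 mulfVK ?gt_eqF// gerBl.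
apply: (le_trans (ler_wpM2l _ H)); first by rewrite exprn_ge0.
rewrite le_eqVlt; apply/orP; left; apply/eqP.
have -> : (4 : R) ^+ n = 2 ^+ n * 2 ^+ n.
  by rewrite -exprMn; congr (_ ^+ _); rewrite -natrM.
have -> : K - 1 = 4 * (w + h) ^+ 2 by rewrite /K addrK.
by apply: alg; rewrite expf_neq0.
Qed.
End goursat.

(** * Cauchy's formula and Taylor expansions *)

Section cauchy.
Variable R : realType.
Implicit Types (f g : R[i] -> R[i]) (x y t M : R) (b z w : R[i]).

Lemma cabs_differentiable f z d :
  (forall e : R, 0 < e ->
    \forall w \near z, cabs (f w - f z - d * (w - z)) <= e * cabs (w - z)) ->
  differentiable f z.
Proof.
move=> fd; apply/derivable1_diffP.
have H : h^-1 *: (f (h *: (1 : R[i]) + z) - f z) @[h --> (0 : R[i])^'] --> d.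
  apply/cvg_cabsP => e e0; have e20 : 0 < e / 2 by rewrite divr_gt0.
  have [r r0 rP] := (nbhs_cabs _ _).1 (fd _ e20).
  rewrite /dnbhs /within /=; apply/nbhs_cabs; exists r => // h; rewrite subr0 => hr h0.
  have -> : h *: (1 : R[i]) + z = h + z by rewrite /GRing.scale /= mulr1.
  have := rP (h + z); rewrite addrK => /(_ hr) H.
  have -> : h^-1 *: (f (h + z) - f z) - d = (f (h + z) - f z - d * h) * h^-1.
    by rewrite mulrBl mulfK// /GRing.scale /= mulrC.
  rewrite cabsM cabsV ltr_pdivrMr ?cabs_gt0// (le_lt_trans H)// ltr_pM2r ?cabs_gt0//.
  by lra.
by apply/cvg_ex; exists d.
Qed.

(** The primitive [atan ((x - c) / t)] runs from [- pi / 4] to [pi / 4]. *)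
Lemma RI_atan (c t : R) : 0 < t ->
  RI (c - t) (c + t) (fun x => t / ((x - c) ^+ 2 + t ^+ 2)) = pi / 2.
Proof.
move=> t0; have ct : c - t < c + t by lra.
have D0 x : (x - c) ^+ 2 + t ^+ 2 != 0.
  by rewrite gt_eqF// ltr_wpDl ?sqr_ge0// exprn_gt0.
have dF x : is_derive x 1 (fun u : R => atan ((u - c) / t)) (t / ((x - c) ^+ 2 + t ^+ 2)).
  have d1 : is_derive x 1 (fun u : R => (u - c) / t) t^-1.
    apply: is_derive_eq; rewrite /GRing.scale /=; field; lra.
  have := @is_derive1_comp _ atan (fun u : R => (u - c) / t) x _ _ (is_derive1_atan _) d1.
  move=> h; apply: (is_derive_eq h); move: (D0 x) => D0x; field.
  by rewrite (gt_eqF t0) D0x.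
have cu : cont_on (c - t) (c + t) (fun x => t / ((x - c) ^+ 2 + t ^+ 2)).
  move=> x _; apply: continuousM; first exact: cst_continuous.
  apply: continuousV; first exact: D0.
  apply: continuousD; last exact: cst_continuous.
  by apply: continuousM; apply: continuousB; (exact: cst_continuous || exact: cvg_id).
rewrite (RI_FTC (F := fun u : R => atan ((u - c) / t)) ct cu).
have -> : (c + t - c) / t = 1 by field; lra.
have -> : (c - t - c) / t = - 1 by field; lra.
by rewrite atanN atan1; field.
Qed.

Lemma RIN (a c : R) (u : R -> R) : cont_on a c u -> RI a c (fun x => - u x) = - RI a c u.
Proof.
by move=> cu; rewrite -mulN1r -RIZ//; apply: eq_RI => x _; rewrite mulN1r.
Qed.

Lemma rect_int_inv b t : 0 < t ->
  rect_int (fun z => (z - b)^-1) (complex.Re b - t) (complex.Re b + t)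
     (complex.Im b - t) (complex.Im b + t) = 0 +i* (2 * pi).
Proof.
case: b => p q t0 /=.
pose D (c x : R) := (x - c) ^+ 2 + t ^+ 2.
have D0 c x : D c x != 0.
  by rewrite gt_eqF// ltr_wpDl ?sqr_ge0// exprn_gt0.
(* These parts of the four edge integrals are never evaluated, since they cancel between opposite
   edges. Each edge contributes a quarter of [2 pi i] besides. *)
pose A c := RI (c - t) (c + t) (fun x => (x - c) / D c x).
have cD c x : {for x, continuous (fun x => (D c x)^-1)}.
  apply: continuousV; first exact: D0.
  apply: continuousD; last exact: cst_continuous.
  by apply: continuousM; apply: continuousB; (exact: cst_continuous || exact: cvg_id).
have cA c : cont_on (c - t) (c + t) (fun x => (x - c) / D c x).
  move=> x _; apply: continuousM; last exact: cD.
  by apply: continuousB; (exact: cst_continuous || exact: cvg_id).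
have cK c : cont_on (c - t) (c + t) (fun x => t / D c x).
  by move=> x _; apply: continuousM; last exact: cD; exact: cst_continuous.
have E1 : CI (p - t) (p + t) (fun x => ((x +i* (q - t)) - (p +i* q))^-1) = A p +i* (pi / 2).
  rewrite -(RI_atan p t0); congr (_ +i* _); apply: eq_RI => x _; rewrite /= /D.
    by congr (_ / (_ + _)); ring.
  rewrite -mulNr; congr (_ / (_ + _)); ring.
have E3 : CI (p - t) (p + t) (fun x => ((x +i* (q + t)) - (p +i* q))^-1) = A p +i* - (pi / 2).
  rewrite -(RI_atan p t0) -RIN//; congr (_ +i* _); apply: eq_RI => x _; rewrite /= /D.
    by congr (_ / (_ + _)); ring.
  congr (- (_ / (_ + _))); ring.
have E2 : CI (q - t) (q + t) (fun y => (((p + t) +i* y) - (p +i* q))^-1) = (pi / 2) +i* - A q.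
  rewrite -(RI_atan q t0) -RIN//; congr (_ +i* _); apply: eq_RI => x _; rewrite /= /D.
    rewrite [X in _ / X]addrC; congr (_ / (_ + _)); ring.
  rewrite [X in - (_ / X)]addrC; congr (- (_ / (_ + _))); ring.
have E4 : CI (q - t) (q + t) (fun y => (((p - t) +i* y) - (p +i* q))^-1) = - (pi / 2) +i* - A q.
  rewrite -(RI_atan q t0) -!RIN//; congr (_ +i* _); apply: eq_RI => x _; rewrite /= /D.
    rewrite [X in _ / X]addrC -mulNr; congr (_ / (_ + _)); ring.
  rewrite [X in - (_ / X)]addrC; congr (- (_ / (_ + _))); ring.
rewrite /rect_int E1 E2 E3 E4.
by apply/eqP; rewrite eq_complex /=; apply/andP; split; apply/eqP; field.
Qed.

(** Cutting along the lines that bound the small square leaves four outer rectangles that avoid [b];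
    their integrals vanish by [goursat]. *)
Lemma rect_int_deform f x0 x1 y0 y1 b t : 0 < t ->
  x0 <= complex.Re b - t -> complex.Re b + t <= x1 ->
  y0 <= complex.Im b - t -> complex.Im b + t <= y1 ->
  (forall z, rect x0 x1 y0 y1 z -> z != b -> differentiable f z) ->
  rect_int f x0 x1 y0 y1 =
  rect_int f (complex.Re b - t) (complex.Re b + t) (complex.Im b - t) (complex.Im b + t).
Proof.
case: b => p q /= t0 hx0 hx1 hy0 hy1 df.
have cf z : rect x0 x1 y0 y1 z -> z != p +i* q -> {for z, continuous f}.
  by move=> zr zb; apply: differentiable_continuous; exact: df.
have ch y : y0 <= y <= y1 -> y != q -> cont_on x0 x1 (fun x => f (x +i* y)).
  move=> yy yq; apply: cont_on_hline => x xx; apply: cf; first by split.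
  by rewrite eq_complex negb_and /= yq orbT.
have cv x : x0 <= x <= x1 -> x != p -> cont_on y0 y1 (fun y => f (x +i* y)).
  move=> xx xp; apply: cont_on_vline => y yy; apply: cf; first by split.
  by rewrite eq_complex negb_and /= xp.
have gour a a' c c' : x0 <= a -> a <= a' -> a' <= x1 -> y0 <= c -> c <= c' -> c' <= y1 ->
    (a' < p \/ p < a \/ c' < q \/ q < c) -> rect_int f a a' c c' = 0.
  move=> h1 h2 h3 h4 h5 h6 h7; apply: goursat; [exact: h2|exact: h5|].
  move=> [u v] [/= /andP[ua ua'] /andP[vc vc']]; apply: df.
    by split; apply/andP; split; rewrite /=; lra.
  rewrite eq_complex negb_and /=.
  by case: h7 => [h|[h|[h|h]]]; apply/orP; [left|left|right|right]; apply/eqP; lra.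
rewrite (@rect_int_splitx _ f (p - t)); [|lra|lra|apply: ch; [lra|apply/eqP; lra]..].
rewrite (gour x0 (p - t)); [|lra..|left; lra].
rewrite add0r (@rect_int_splitx _ f (p + t)); [|lra|lra| |]; last 2 first.
- by apply: cont_onS (ch y0 _ _); [lra|lra|lra|apply/eqP; lra].
- by apply: cont_onS (ch y1 _ _); [lra|lra|lra|apply/eqP; lra].
rewrite (gour (p + t) x1); [|lra..|right; left; lra].
rewrite addr0 (@rect_int_splity _ f (q - t)); [|lra|lra|apply: cv; [lra|apply/eqP; lra]..].
rewrite (gour (p - t) (p + t)); [|lra..|right; right; left; lra].
rewrite add0r (@rect_int_splity _ f (q + t)); [|lra|lra| |]; last 2 first.
- by apply: cont_onS (cv (p - t) _ _); [lra|lra|lra|apply/eqP; lra].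
- by apply: cont_onS (cv (p + t) _ _); [lra|lra|lra|apply/eqP; lra].
rewrite (gour (p - t) (p + t) (q + t) y1); [|lra..|right; right; right; lra].
by rewrite addr0.
Qed.

End cauchy.

Section cauchy_formula.
Variable R : realType.
Implicit Types (f g : R[i] -> R[i]) (x y t M : R) (b c z w : R[i]).

Definition ctpi : R[i] := 0 +i* (2 * pi).

Lemma cabs_ctpi : 4 <= cabs ctpi.
Proof.
rewrite /cabs /= expr0n /= add0r sqrtr_sqr ger0_norm ?mulr_ge0 ?pi_ge0//.
by have := pi_ge2 R; lra.
Qed.

Lemma ctpi_neq0 : ctpi != 0.
Proof. by rewrite -cabs_gt0 (lt_le_trans _ cabs_ctpi). Qed.

Lemma differentiable_sub_inv b z : z != b ->
  differentiable (fun w : R[i] => (w - b)^-1 : R[i]) z.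
Proof.
move=> zb; apply: differentiableV; last by rewrite subr_eq0.
by apply: differentiableB.
Qed.

Lemma continuous_sub_inv b z : z != b ->
  {for z, continuous (fun w : R[i] => (w - b)^-1 : R[i])}.
Proof. by move=> zb; apply: differentiable_continuous; exact: differentiable_sub_inv. Qed.

(** Split [f z] as [(f z - f b) + f b]. The difference quotient is bounded near [b], so its
    integral, deformed to a shrinking square around [b], is zero; the kernel alone gives [ctpi]. *)
Lemma cauchy_formula f x0 x1 y0 y1 b :
  x0 < complex.Re b < x1 -> y0 < complex.Im b < y1 ->
  (forall z, rect x0 x1 y0 y1 z -> differentiable f z) ->
  rect_int (fun z => f z * (z - b)^-1) x0 x1 y0 y1 = ctpi * f b.
Proof.
move=> /andP[xb bx] /andP[yb by'] df.
have inb : rect x0 x1 y0 y1 b by split; apply/andP; split; exact: ltW.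
have x01 : x0 <= x1 by lra.
have y01 : y0 <= y1 by lra.
pose h z : R[i] := (f z - f b) * (z - b)^-1.
have dh z : rect x0 x1 y0 y1 z -> z != b -> differentiable h z.
  move=> zr zb; apply: differentiableM; last exact: differentiable_sub_inv.
  by apply: differentiableB; [exact: df|].
have [d dd] := differentiable_cabs (df _ inb).
have [r r0 rP] := (nbhs_cabs _ _).1 (dd 1 ltr01).
pose M := cabs d + 1.
have M0 : 0 < M by rewrite ltr_wpDl ?cabs_ge0.
have hM z : cabs (z - b) < r -> cabs (h z) <= M.
  move=> /rP; rewrite mul1r => zP.
  have [->|zb] := eqVneq z b; first by rewrite /h subrr mul0r cabs0 ltW.
  have zb0 : 0 < cabs (z - b) by rewrite cabs_gt0 subr_eq0.
  rewrite /h cabsM cabsV ler_pdivrMr// /M mulrDl mul1r.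
  rewrite -[f z - f b](subrK (d * (z - b))) (le_trans (cabs_leD _ _))// addrC.
  by rewrite cabsM lerD2l.
have ndef z : bdry x0 x1 y0 y1 z -> z != b.
  case=> _ zb; apply/eqP => zE; rewrite zE in zb.
  by case: zb => [|[|[|]]] E; rewrite E ltxx in xb bx yb by'.
have h0 : rect_int h x0 x1 y0 y1 = 0.
  apply/eqP; rewrite -cabs_eq0; apply/eqP/le_anti; rewrite cabs_ge0 andbT.
  apply/ler_addgt0Pl => e e0; rewrite addr0.
  (* The first four terms keep the square inside the rectangle, [r / 4] keeps it in the disc where
     [h] is bounded by [M]; the bound on the integral is then [16 * M * t], hence the last term. *)
  pose t := Num.min (Num.min (complex.Re b - x0) (x1 - complex.Re b))
     (Num.min (Num.min (complex.Im b - y0) (y1 - complex.Im b))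
       (Num.min (r / 4) (e / (16 * M)))).
  have t0 : 0 < t by rewrite !lt_min !subr_gt0 xb bx yb by' !divr_gt0// mulr_gt0.
  have : t <= t by [].
  rewrite {2}/t !le_min => /andP[/andP[t1 t2] /andP[/andP[t3 t4] /andP[t5 t6]]].
  rewrite (@rect_int_deform _ h _ _ _ _ b t); [|lra..|exact: dh].
  have xx : complex.Re b - t <= complex.Re b + t by lra.
  have yy : complex.Im b - t <= complex.Im b + t by lra.
  apply: (le_trans (@rect_int_cabs _ h M _ _ _ _ xx yy _ _)).
  - apply: edges_cont_bdry; [exact: xx|exact: yy|].
    move=> z [[z1 z2] z3]; apply: differentiable_continuous; apply: dh.
      by move: z1 z2 => /andP[? ?] /andP[? ?]; split; apply/andP; split; lra.
    by apply/eqP => zE; rewrite zE in z3; case: z3 => [|[|[|]]]; lra.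
  - move=> z [[/andP[z1 z2] /andP[z3 z4]] _]; apply: hM.
    apply: (le_lt_trans (cabs_le_ReIm _)).
    have -> : complex.Re (z - b) = complex.Re z - complex.Re b by case: (z) (b) => ? ? [].
    have -> : complex.Im (z - b) = complex.Im z - complex.Im b by case: (z) (b) => ? ? [].
    apply: (@le_lt_trans _ _ (t + t)); last lra.
    by apply: lerD; rewrite ler_norml; apply/andP; split; lra.
  - have : t * (16 * M) <= e by rewrite -ler_pdivlMr ?mulr_gt0.
    by lra.
have ech : edges_cont h x0 x1 y0 y1.
  apply: edges_cont_bdry; [exact: x01|exact: y01|move=> z zb].
  by apply: differentiable_continuous; apply: dh; [case: zb|exact: ndef].
have eci : edges_cont (fun z => (z - b)^-1 : R[i]) x0 x1 y0 y1.
  apply: edges_cont_bdry; [exact: x01|exact: y01|move=> z /ndef].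
  exact: continuous_sub_inv.
have eci' := edges_contM (edges_cont_cst (f b) _ _ _ _) eci.
rewrite (@eq_rect_int _ _ (fun z => h z + f b * (z - b)^-1) _ _ _ _ x01 y01); last first.
  by move=> z _; rewrite /h; ring.
rewrite (rect_intD ech eci') h0 add0r (rect_intZ _ eci) mulrC; congr (_ * _).
pose t := Num.min (Num.min (complex.Re b - x0) (x1 - complex.Re b))
     (Num.min (complex.Im b - y0) (y1 - complex.Im b)).
have t0 : 0 < t by rewrite !lt_min !subr_gt0 xb bx yb by'.
have : t <= t by [].
rewrite {2}/t !le_min => /andP[/andP[t1 t2] /andP[t3 t4]].
rewrite (@rect_int_deform _ _ _ _ _ _ b t); [|lra..|]; first exact: rect_int_inv.
by move=> z _; exact: differentiable_sub_inv.
Qed.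

(** Differentiation under the integral sign rests on the exact identity [1/(z-w) = 1/(z-b) +
    (w-b)/(z-b)^2 + (w-b)^2/((z-b)^2 (z-w))]. For [w] within [rho / 2] of [b], the last term
    integrates to at most [K |w-b|^2]. *)
Lemma cauchy_type_differentiable (phi : R[i] -> R[i]) M (rho : R) x0 x1 y0 y1 b :
  x0 <= x1 -> y0 <= y1 -> 0 < rho -> 0 <= M ->
  edges_cont phi x0 x1 y0 y1 ->
  (forall z, bdry x0 x1 y0 y1 z -> cabs (phi z) <= M /\ rho <= cabs (z - b)) ->
  differentiable (fun w => rect_int (fun z => phi z * (z - w)^-1) x0 x1 y0 y1 : R[i]) b.
Proof.
move=> x01 y01 rho0 M0 cphi phiM.
have nz w z : cabs (w - b) < rho / 2 -> bdry x0 x1 y0 y1 z -> rho / 2 <= cabs (z - w).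
  move=> wb /phiM[_ zb]; have := cabs_leD (z - w) (w - b); rewrite addrA subrK; lra.
have ndef w z : cabs (w - b) < rho / 2 -> bdry x0 x1 y0 y1 z -> z != w.
  move=> wb /(nz _ _ wb) zw; rewrite -subr_eq0 -cabs_gt0; apply: lt_le_trans zw; lra.
have eci w : cabs (w - b) < rho / 2 ->
    edges_cont (fun z => (z - w)^-1 : R[i]) x0 x1 y0 y1.
  move=> wb; apply: edges_cont_bdry; [exact: x01|exact: y01|].
  by move=> z /(ndef _ _ wb); exact: continuous_sub_inv.
have bb : cabs (b - b) < rho / 2 by rewrite subrr cabs0; lra.
have e1 := edges_contM cphi (eci _ bb).
have e2 := edges_contM e1 (eci _ bb).
pose D := rect_int (fun z => phi z * (z - b)^-1 * (z - b)^-1) x0 x1 y0 y1.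
pose K := 4 * (M * rho^-1 * rho^-1 * (rho / 2)^-1) * ((x1 - x0) + (y1 - y0)).
have K0 : 0 <= K.
  have ri : 0 <= rho^-1 by rewrite invr_ge0 ltW.
  have r2i : 0 <= (rho / 2)^-1 by rewrite invr_ge0 divr_ge0 ?ltW.
  by rewrite /K; repeat (apply: mulr_ge0 => //); rewrite addr_ge0 ?subr_ge0.
apply: (@cabs_differentiable _ _ _ D) => e e0.
apply/nbhs_cabs; exists (Num.min (rho / 2) (e / (K + 1))).
  by rewrite lt_min !divr_gt0// ltr_wpDl.
move=> w; rewrite lt_min => /andP[wr we].
have e3 := edges_contM e2 (eci _ wr).
have -> : rect_int (fun z => phi z * (z - w)^-1) x0 x1 y0 y1 =
    rect_int (fun z => phi z * (z - b)^-1) x0 x1 y0 y1 + ((w - b) * D +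
    (w - b) ^+ 2 * rect_int (fun z => phi z * (z - b)^-1 * (z - b)^-1 * (z - w)^-1) x0 x1 y0 y1).
  have k2 := edges_contM (edges_cont_cst (w - b) _ _ _ _) e2.
  have k3 := edges_contM (edges_cont_cst ((w - b) ^+ 2) _ _ _ _) e3.
  have := rect_intD e1 (edges_contD k2 k3).
  rewrite (rect_intD k2 k3) (rect_intZ _ e2) (rect_intZ _ e3) => <-.
  apply: eq_rect_int; [exact: x01|exact: y01|move=> z zb].
  have := ndef _ _ wr zb; have := ndef _ _ bb zb; rewrite -!(subr_eq0 z) => zb0 zw0.
  by field; rewrite zb0 zw0.
have alg (A B d X : R[i]) : A + (B * d + X) - A - d * B = X by ring.
rewrite alg cabsM cabsX.
have H : cabs (rect_int (fun z => phi z * (z - b)^-1 * (z - b)^-1 * (z - w)^-1) x0 x1 y0 y1) <= K.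
  apply: rect_int_cabs; [exact: x01|exact: y01|exact: e3|].
  move=> z zb; have [zM zr] := phiM _ zb; have zw := nz _ _ wr zb.
  have h1 : cabs (z - b)^-1 <= rho^-1.
    rewrite cabsV lef_pV2 ?posrE// (lt_le_trans rho0)//.
  have h2 : cabs (z - w)^-1 <= (rho / 2)^-1.
    rewrite cabsV lef_pV2 ?posrE//; first by apply: (lt_le_trans _ zw); lra.
    lra.
  by rewrite !cabsM; do 3 (apply: ler_pM; rewrite ?mulr_ge0 ?cabs_ge0//).
apply: (le_trans (ler_wpM2l _ H)); first by rewrite exprn_ge0 ?cabs_ge0.
rewrite expr2 -mulrA mulrC ler_wpM2r ?cabs_ge0//.
apply: (le_trans (ler_wpM2r K0 (ltW we))).
rewrite mulrAC ler_pdivrMr ?ltr_wpDl// ler_wpM2l ?ltW//; lra.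
Qed.

End cauchy_formula.

Section taylor.
Variable R : realType.
Implicit Types (f g : R[i] -> R[i]) (s M : R) (b c z w : R[i]).

(** Squares take the place of discs because contours are rectangles; a square of half side [s] lies
    between the discs of radii [s] and [2 s]. *)
Definition square c s : set R[i] :=
  rect (complex.Re c - s) (complex.Re c + s) (complex.Im c - s) (complex.Im c + s).

Lemma square_cabs c s z : square c s z -> cabs (z - c) <= 2 * s.
Proof.
case: z c => a b [a' b'] [/= /andP[h1 h2] /andP[h3 h4]].
rewrite (le_trans (cabs_le_ReIm _))//= mulr_natl mulr2n.
by apply: lerD; rewrite ler_norml; apply/andP; split; lra.
Qed.

Lemma cabs_square c s z : cabs (z - c) <= s -> square c s z.
Proof.
move=> zc; have := le_trans (Re_le_cabs _) zc; have := le_trans (Im_le_cabs _) zc.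
case: z c {zc} => a b [a' b'] /=; rewrite !ler_norml => /andP[h1 h2] /andP[h3 h4].
by split; apply/andP; split; rewrite /=; lra.
Qed.

Lemma cabs_square_interior c s z : cabs (z - c) < s ->
  complex.Re c - s < complex.Re z < complex.Re c + s /\
  complex.Im c - s < complex.Im z < complex.Im c + s.
Proof.
move=> zc; have := le_lt_trans (Re_le_cabs _) zc; have := le_lt_trans (Im_le_cabs _) zc.
case: z c {zc} => a b [a' b'] /=; rewrite !ltr_norml => /andP[h1 h2] /andP[h3 h4].
by split; apply/andP; split; lra.
Qed.

Lemma square_bdry c s z :
  bdry (complex.Re c - s) (complex.Re c + s) (complex.Im c - s) (complex.Im c + s) z ->
  0 <= s -> s <= cabs (z - c).
Proof.
case: z c => a b [a' b'] [_ /= zb] s0.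
have := Re_le_cabs ((a +i* b) - (a' +i* b')); have := Im_le_cabs ((a +i* b) - (a' +i* b')).
move=> /=; set u := cabs _.
case: zb => [->|[->|[->|->]]] h1 h2.
- by apply: le_trans h2; rewrite addrAC subrr add0r normrN ger0_norm.
- by apply: le_trans h2; rewrite addrAC subrr add0r ger0_norm.
- by apply: le_trans h1; rewrite addrAC subrr add0r normrN ger0_norm.
- by apply: le_trans h1; rewrite addrAC subrr add0r ger0_norm.
Qed.

(* The quotient of [f] minus its Taylor polynomial of degree [k - 1] at [c] by
   [(b - c) ^+ k], as a Cauchy integral that also makes sense at [b = c]. *)
Definition taylor_quot f c s k b : R[i] := (ctpi R)^-1 *
  rect_int (fun z => f z * (z - c)^-1 ^+ k * (z - b)^-1)
    (complex.Re c - s) (complex.Re c + s) (complex.Im c - s) (complex.Im c + s).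

Section fixed_square.
Variables (f : R[i] -> R[i]) (c : R[i]) (s M : R).
Hypotheses (s0 : 0 < s) (df : forall z, square c s z -> differentiable f z)
  (fM : forall z, square c s z -> cabs (f z) <= M).

Let x01 : complex.Re c - s <= complex.Re c + s. Proof. move: s0; lra. Qed.
Let y01 : complex.Im c - s <= complex.Im c + s. Proof. move: s0; lra. Qed.
Let M0 : 0 <= M.
Proof.
by apply: le_trans (fM (z := c) _); rewrite ?cabs_ge0//; apply: cabs_square; rewrite subrr cabs0 ltW.
Qed.

Local Notation econt g := (edges_cont g
  (complex.Re c - s) (complex.Re c + s) (complex.Im c - s) (complex.Im c + s)).
Local Notation bd := (bdry
  (complex.Re c - s) (complex.Re c + s) (complex.Im c - s) (complex.Im c + s)).

Let bd_far b z : cabs (b - c) < s / 2 -> bd z -> s / 2 <= cabs (z - b).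
Proof.
move=> bc /square_bdry/(_ (ltW s0)) zc.
have := cabs_leD (z - b) (b - c); rewrite addrA subrK.
by move: zc bc; lra.
Qed.

Let bd_neq b z : cabs (b - c) < s / 2 -> bd z -> z != b.
Proof.
move=> bc zb; rewrite -subr_eq0 -cabs_gt0.
by apply: lt_le_trans (bd_far bc zb); rewrite divr_gt0.
Qed.

Let cc : cabs (c - c) < s / 2. Proof. by rewrite subrr cabs0 divr_gt0. Qed.

Let ec_inv b : cabs (b - c) < s / 2 -> econt (fun z => (z - b)^-1 : R[i]).
Proof.
move=> bc; apply: edges_cont_bdry; [exact: x01|exact: y01|].
by move=> z /(bd_neq bc); exact: continuous_sub_inv.
Qed.

Let ec_f : econt f.
Proof.
apply: rect_edges_cont; [exact: x01|exact: y01|].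
by move=> z zs; apply: differentiable_continuous; apply: df.
Qed.

Let ec_k k : econt (fun z => f z * (z - c)^-1 ^+ k : R[i]).
Proof.
apply: edges_contM; first exact: ec_f.
elim: k => [|k IH]; first exact: edges_cont_cst.
have := edges_contM (ec_inv cc) IH.
by under [X in edges_cont X _ _ _ _ -> _]eq_fun do rewrite -exprS.
Qed.

Let ec_kb k b : cabs (b - c) < s / 2 ->
  econt (fun z => f z * (z - c)^-1 ^+ k * (z - b)^-1 : R[i]).
Proof. by move=> bc; exact: edges_contM (ec_k k) (ec_inv bc). Qed.

Lemma taylor_quot0 b : cabs (b - c) < s / 2 -> taylor_quot f c s 0 b = f b.
Proof.
move=> bc; have bcs : cabs (b - c) < s by move: s0 bc; lra.
have [bx by_] := cabs_square_interior bcs.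
rewrite /taylor_quot (@eq_rect_int _ _ (fun z => f z * (z - b)^-1) _ _ _ _ x01 y01); last first.
  by move=> z _; rewrite expr0 mulr1.
by rewrite (cauchy_formula bx by_ df) mulKf// ctpi_neq0.
Qed.

(** Under the integral this is [1/(z-b) = 1/(z-c) + (b-c)/((z-c)(z-b))]. Iterated, it produces the
    Taylor polynomial, with coefficients [taylor_quot f c s k c]. *)
Lemma taylor_quotS k b : cabs (b - c) < s / 2 ->
  taylor_quot f c s k b = taylor_quot f c s k c + (b - c) * taylor_quot f c s k.+1 b.
Proof.
move=> bc; rewrite /taylor_quot [_ * (_^-1 * _)]mulrCA -mulrDr; congr (_ * _).
rewrite -(rect_intZ _ (ec_kb k.+1 bc)).
rewrite -(rect_intD (ec_kb k cc) (edges_contM (edges_cont_cst (b - c) _ _ _ _) (ec_kb k.+1 bc))).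
apply: eq_rect_int; [exact: x01|exact: y01|move=> z zb].
have := bd_neq bc zb; have := bd_neq cc zb; rewrite -!(subr_eq0 z) => zc0 zb0.
rewrite exprS; move: ((z - c)^-1 ^+ k) => t.
by field; rewrite zc0 zb0.
Qed.

Lemma taylor_quot_differentiable k b : cabs (b - c) < s / 2 ->
  differentiable (taylor_quot f c s k) b.
Proof.
move=> bc; apply: differentiableM; first exact: differentiable_cst.
pose rho := s / 2 - cabs (b - c).
have rho0 : 0 < rho by rewrite subr_gt0.
have Ms0 : 0 <= M * s^-1 ^+ k by rewrite mulr_ge0// exprn_ge0// invr_ge0 ltW.
apply: (cauchy_type_differentiable x01 y01 rho0 Ms0 (ec_k k)) => z zb; split.
  rewrite cabsM cabsX; apply: ler_pM; rewrite ?exprn_ge0 ?cabs_ge0//.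
    by apply: fM; case: zb.
  apply: lerXn2r; rewrite ?nnegrE ?cabs_ge0 ?invr_ge0 ?(ltW s0)//.
  rewrite cabsV lef_pV2 ?posrE//; first exact: square_bdry (ltW s0).
  by apply: lt_le_trans s0 _; exact: square_bdry (ltW s0).
have := square_bdry zb (ltW s0); have := cabs_leD (z - b) (b - c); rewrite addrA subrK /rho.
by move: s0; lra.
Qed.

(** For such [b] the kernel is at most [2 / s] on the edges, so the contour integral is at most
    [32 * M * s^-1 ^+ k]; [|ctpi| >= 4] turns 32 into 8. *)
Lemma taylor_quot_le k b : cabs (b - c) < s / 2 ->
  cabs (taylor_quot f c s k b) <= 8 * M * s^-1 ^+ k.
Proof.
move=> bc; rewrite /taylor_quot cabsM cabsV.
have H : cabs (rect_int (fun z => f z * (z - c)^-1 ^+ k * (z - b)^-1)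
    (complex.Re c - s) (complex.Re c + s) (complex.Im c - s) (complex.Im c + s)) <=
    4 * (M * s^-1 ^+ k * (s / 2)^-1) * ((complex.Re c + s - (complex.Re c - s)) + (complex.Im c + s - (complex.Im c - s))).
  apply: rect_int_cabs; [exact: x01|exact: y01|exact: ec_kb|move=> z zb].
  rewrite !cabsM cabsX !cabsV; apply: ler_pM; rewrite ?mulr_ge0 ?exprn_ge0 ?invr_ge0 ?cabs_ge0//.
    apply: ler_pM; rewrite ?exprn_ge0 ?invr_ge0 ?cabs_ge0//; first by apply: fM; case: zb.
    apply: lerXn2r; rewrite ?nnegrE ?invr_ge0 ?cabs_ge0 ?(ltW s0)//.
    rewrite lef_pV2 ?posrE//; first exact: square_bdry (ltW s0).
    by apply: lt_le_trans s0 _; exact: square_bdry (ltW s0).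
  have zs := bd_far bc zb; rewrite lef_pV2 ?posrE ?divr_gt0//.
  by apply: lt_le_trans zs; rewrite divr_gt0.
have c4 := cabs_ctpi R; rewrite ler_pdivrMl ?(lt_le_trans _ c4)//.
apply: (le_trans H); rewrite [leLHS](_ : _ = 4 * (8 * M * s^-1 ^+ k)); last first.
  move: (s^-1 ^+ k) => t; field.
  by rewrite gt_eqF.
by rewrite ler_wpM2r// mulr_ge0 ?mulr_ge0// exprn_ge0// invr_ge0 ltW.
Qed.

Lemma taylor_expansion k b : cabs (b - c) < s / 2 ->
  f b = \sum_(j < k) taylor_quot f c s j c * (b - c) ^+ j +
        (b - c) ^+ k * taylor_quot f c s k b.
Proof.
move=> bc; elim: k => [|k IH].
  by rewrite big_ord0 add0r expr0 mul1r taylor_quot0.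
by rewrite IH big_ord_recr /= (taylor_quotS k bc) exprS; ring.
Qed.

(** The factor [1 / s] is the point: a function bounded on a very large square hardly varies at unit
    distance from its centre. *)
Lemma square_lipschitz b : cabs (b - c) < s / 2 ->
  cabs (f b - f c) <= 8 * M / s * cabs (b - c).
Proof.
move=> bc; rewrite -(taylor_quot0 bc) (taylor_quotS 0 bc) (taylor_quot0 cc).
rewrite addrAC subrr add0r cabsM mulrC ler_wpM2r ?cabs_ge0//.
by rewrite (le_trans (taylor_quot_le 1 bc))// expr1.
Qed.

End fixed_square.

Lemma near_square f c : (\forall z \near c, differentiable f z) ->
  exists s M, [/\ 0 < s, forall z, square c s z -> differentiable f z &
    forall z, square c s z -> cabs (f z) <= M].
Proof.
move=> df; have /nbhs_cabs[r r0 rP] := df.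
have /differentiable_continuous cf : differentiable f c.
  by apply: rP; rewrite subrr cabs0.
have /cvg_cabsP/(_ _ ltr01)/nbhs_cabs[r' r'0 r'P] := cf.
exists (Num.min (r / 4) (r' / 4)), (cabs (f c) + 1).
have s0 : 0 < Num.min (r / 4) (r' / 4) by rewrite lt_min !divr_gt0.
have : Num.min (r / 4) (r' / 4) <= Num.min (r / 4) (r' / 4) by [].
rewrite le_min => /andP[sr sr'].
split=> [//|z /square_cabs zc|z /square_cabs zc].
  by apply: rP; apply: le_lt_trans zc _; lra.
have {}/r'P h : cabs (z - c) < r' by apply: le_lt_trans zc _; lra.
by rewrite -(subrK (f c) (f z)) (le_trans (cabs_leD _ _))// addrC lerD2l ltW.
Qed.

Lemma near_half c s : 0 < s -> \forall b \near c, cabs (b - c) < s / 2.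
Proof. by move=> s0; apply/nbhs_cabs; exists (s / 2) => //; rewrite divr_gt0. Qed.

Lemma taylor_near f c k : (\forall z \near c, differentiable f z) ->
  exists (a : nat -> R[i]) (g : R[i] -> R[i]),
    (\forall z \near c, differentiable g z) /\
    \forall z \near c, f z = \sum_(j < k) a j * (z - c) ^+ j + (z - c) ^+ k * g z.
Proof.
move=> /near_square[s [M [s0 df fM]]].
exists (fun j => taylor_quot f c s j c), (taylor_quot f c s k).
split; apply: filterS (near_half c s0) => z zc.
  exact: taylor_quot_differentiable fM _ _ zc.
exact: taylor_expansion.
Qed.

(** If all Taylor coefficients vanish, [f z] equals its remainder of every order [n], which is at
    most [8 * M / 2 ^+ n]. Otherwise [u] is the Taylor quotient at the first nonzero coefficient. *)
Lemma vanishing_order f c : (\forall z \near c, differentiable f z) ->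
  (\forall z \near c, f z = 0) \/
  exists (k : nat) (u : R[i] -> R[i]), [/\ \forall z \near c, differentiable u z,
    u c != 0 & \forall z \near c, f z = (z - c) ^+ k * u z].
Proof.
move=> /near_square[s [M [s0 df fM]]].
have [[k ak]|na] := pselect (exists k, taylor_quot f c s k c != 0); last first.
  left; apply: filterS (near_half c s0) => z zc.
  have fk k : f z = (z - c) ^+ k * taylor_quot f c s k z.
    rewrite {1}(taylor_expansion s0 df k zc) big1 ?add0r// => j _.
    have [->|aj] := eqVneq (taylor_quot f c s j c) 0; first by rewrite mul0r.
    by exfalso; apply: na; exists j.
  apply/eqP; rewrite -cabs_eq0; apply/eqP/le_anti; rewrite cabs_ge0 andbT.
  apply/ler_addgt0Pl => e e0; rewrite addr0.
  have [n ne] := half_pow_small (8 * M) e0.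
  apply: le_trans (ltW ne); rewrite (fk n) cabsM cabsX.
  apply: (le_trans (ler_wpM2l _ (taylor_quot_le s0 df fM n zc))).
    by rewrite exprn_ge0 ?cabs_ge0.
  rewrite mulrCA ler_wpM2l//.
    by rewrite mulr_ge0// (le_trans (cabs_ge0 (f z)))//; apply: fM; apply: cabs_square; lra.
  rewrite -exprMn -exprVn; apply: lerXn2r; rewrite ?nnegrE ?mulr_ge0 ?cabs_ge0 ?invr_ge0 ?(ltW s0)//.
  by rewrite ler_pdivrMr// mulrC; lra.
right; pose P k := taylor_quot f c s k c != 0.
have exP : exists k, P k by exists k.
pose m := ex_minn exP; exists m, (taylor_quot f c s m).
have [m1 m2] : P m /\ forall j, P j -> (m <= j)%N by rewrite /m; case: ex_minnP.
split=> //; apply: filterS (near_half c s0) => z zc.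
  exact: taylor_quot_differentiable fM _ _ zc.
rewrite {1}(taylor_expansion s0 df m zc) big1 ?add0r// => j _.
have [->|aj] := eqVneq (taylor_quot f c s j c) 0; first by rewrite mul0r.
by have := m2 _ aj; rewrite leqNgt ltn_ord.
Qed.

End taylor.

(** * Sub-mean value inequality on polydiscs *)

Section integration.
Local Open Scope ereal_scope.

(* The partial integrals in [cintegral] are not known to be measurable. *)
Lemma ge0_le_integral_any d (T : measurableType d) (R : realType)
    (mu : {measure set T -> \bar R}) (f g : T -> \bar R) :
  (forall x, 0 <= f x) -> (forall x, f x <= g x) ->
  \int[mu]_x f x <= \int[mu]_x g x.
Proof.
move=> f0 fg; rewrite !ge0_integralTE//; last first.
  by move=> x; exact: le_trans (fg x).
apply: ereal_sup_le => _ [h hf <-].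
by exists h => // x; exact: le_trans (hf x) (fg x).
Qed.

Variable R : realType.
Notation mu := (@lebesgue_measure R).

(** The preimage of an open ray is a countable union of open boxes with rational corners, each
    measurable for the product structure. *)
Lemma measurable_continuous2 (u : R * R -> R) :
  (forall x y (e : R), (0 < e)%R -> exists2 d : R, (0 < d)%R & forall x' y',
     (`|x' - x| < d)%R -> (`|y' - y| < d)%R -> (`|u (x', y') - u (x, y)| < e)%R) ->
  measurable_fun [set: R * R] u.
Proof.
move=> cu mD; apply: (measurability _ (measurable_realfun.RGenOInfty.measurableE R)) => //.
move=> _ [_ [a ->]] <-; rewrite setTI.
pose box (p q r s : rat) : set (R * R) :=
  `]ratr p, ratr q[%classic `*` `]ratr r, ratr s[%classic.
pose F p q r s := if `[< box p q r s `<=` u @^-1` `]a, +oo[ >] then box p q r s else set0.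
have -> : u @^-1` `]a, +oo[ = \bigcup_p \bigcup_q \bigcup_r \bigcup_s F p q r s.
  apply/seteqP; split=> [[x y] /=|xy [p _ [q _ [r _ [s _]]]]]; last first.
    by rewrite /F; case: asboolP => // h; exact: h.
  rewrite in_itv /= andbT => au.
  have [d d0 dP] := cu x y _ (eqbRL (subr_gt0 _ _) au).
  have [xd1 xd2 yd1 yd2] : [/\ x - d < x, x < x + d, y - d < y & y < y + d]%R.
    by rewrite !ltrDl !gtrDl !oppr_lt0.
  have [p] := rat_in_itvoo xd1; have [q] := rat_in_itvoo xd2.
  have [r] := rat_in_itvoo yd1; have [s] := rat_in_itvoo yd2.
  rewrite !in_itv /= => /andP[s1 s2] /andP[r1 r2] /andP[q1 q2] /andP[p1 p2].
  exists p => //; exists q => //; exists r => //; exists s => //.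
  rewrite /F; case: asboolP => [_|]; first by split; rewrite /= in_itv /= ?p2 ?q1 ?r2 ?s1.
  case=> -[x' y'] [/=]; rewrite !in_itv /= => /andP[h1 h2] /andP[h3 h4].
  have /ltr_distlCBl : (`|u (x', y') - u (x, y)| < u (x, y) - a)%R.
    apply: dP; rewrite ltr_norml; apply/andP; split; lra.
  by rewrite andbT; lra.
do 4 (apply: bigcupT_measurable_rat => ?).
rewrite /F; case: asboolP => // _.
by apply: measurableX; exact: measurable_itv.
Qed.

Lemma lebesgue_measure_ccitv (a b : R) : (a <= b)%R ->
  mu `[a, b]%classic = (b - a)%:E.
Proof.
move=> ab; rewrite lebesgue_measure_itv /= lte_fin.
case: ltP => [_|ba]; first by rewrite -EFinD.
have -> : a = b by apply/eqP; rewrite eq_le ab.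
by rewrite subrr.
Qed.

Lemma exists_le_integral (V : R -> \bar R) (a b K : R) : (a < b)%R ->
  (forall x, 0 <= V x) -> (0 <= K)%R ->
  \int[mu]_x V x < (K * (b - a))%:E ->
  exists2 x, (a <= x <= b)%R & V x <= K%:E.
Proof.
move=> ab V0 K0 VK; apply: contrapT => nx; move: VK; apply/negP; rewrite -leNgt.
have -> : (K * (b - a))%:E = \int[mu]_x (cst K%:E \_ `[a, b]%classic) x.
  by rewrite -integral_mkcond integral_cst//= lebesgue_measure_ccitv ?EFinM// ltW.
apply: ge0_le_integral_any => x; first by apply: erestrict_ge0 => t _; rewrite lee_fin.
rewrite /patch; case: ifPn => // xab; apply: contrapT => /negP; rewrite -ltNge => h.
by apply: nx; exists x; [move: xab; rewrite inE /= in_itv|exact: ltW].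
Qed.

Lemma RI_le_integral (V : R -> \bar R) (a b : R) (u : R -> R) : cont_on a b u ->
  (forall x, 0 <= V x) -> (forall x, (a <= x <= b)%R -> (0 <= u x)%R /\ (u x)%:E <= V x) ->
  (RI a b u)%:E <= \int[mu]_x V x.
Proof.
move=> cu V0 uV.
have iu := cont_on_integrable cu.
have -> : (RI a b u)%:E = \int[mu]_x ((EFin \o u) \_ `[a, b]%classic) x.
  by rewrite -integral_mkcond /RI /Rintegral fineK//; exact: integrable_fin_num.
apply: ge0_le_integral_any => x.
  by apply: erestrict_ge0 => t /=; rewrite in_itv /= => /uV[]; rewrite lee_fin.
by rewrite /patch; case: ifPn => //; rewrite inE /= in_itv /= => /uV[].
Qed.

End integration.

Section area.
Variable R : realType.
Notation mu := (@lebesgue_measure R).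

(** Retraction of the line onto a segment. Precomposed with it in both coordinates, a function
    continuous at the points of a square becomes continuous, hence measurable, on the whole
    plane. *)
Definition clamp (a r t : R) : R := Num.max (a - r) (Num.min (a + r) t).

Lemma clamp_in a r t : 0 <= r -> a - r <= clamp a r t <= a + r.
Proof.
by move=> r0; rewrite /clamp le_max lexx /= ge_max ge_min lexx /= andbT; lra.
Qed.

Lemma clamp_id a r t : a - r <= t <= a + r -> clamp a r t = t.
Proof. by case/andP => h1 h2; rewrite /clamp min_r// max_r. Qed.

Lemma clamp_lip a r t t' : `|clamp a r t' - clamp a r t| <= `|t' - t|.
Proof.
have maxl (c x y : R) : `|Num.max c x - Num.max c y| <= `|x - y|.
  have := ler_norm (x - y); have := ler_norm (y - x); rewrite (distrC y).
  by case: (leP c x); case: (leP c y) => ? ? ? ?; rewrite ler_norml;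
    apply/andP; split; lra.
have minl (c x y : R) : `|Num.min c x - Num.min c y| <= `|x - y|.
  have := ler_norm (x - y); have := ler_norm (y - x); rewrite (distrC y).
  by case: (leP c x); case: (leP c y) => ? ? ? ?; rewrite ler_norml;
    apply/andP; split; lra.
exact: le_trans (maxl _ _ _) (minl _ _ _).
Qed.

Lemma bdry_hline (x0 x1 y0 y1 t y : R) : y0 <= y1 -> x0 <= t <= x1 ->
  y = y0 \/ y = y1 -> bdry x0 x1 y0 y1 (t +i* y).
Proof.
by move=> y01 tx [->|->]; (split; [split=> //=; rewrite lexx y01|right; right; tauto]).
Qed.

Lemma bdry_vline (x0 x1 y0 y1 x t : R) : x0 <= x1 -> y0 <= t <= y1 ->
  x = x0 \/ x = x1 -> bdry x0 x1 y0 y1 (x +i* t).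
Proof.
by move=> x01 ty [->|->]; (split; [split=> //=; rewrite lexx x01|rewrite /=; tauto]).
Qed.

Lemma bdry_far (r x0 x1 y0 y1 : R) (b z : R[i]) :
  x0 <= complex.Re b - r -> complex.Re b + r <= x1 ->
  y0 <= complex.Im b - r -> complex.Im b + r <= y1 ->
  bdry x0 x1 y0 y1 z -> r <= cabs (z - b).
Proof.
case: b z => p q [u v] /= h1 h2 h3 h4 [_ /=].
have hr := Re_le_cabs ((u +i* v) - (p +i* q)); have hi := Im_le_cabs ((u +i* v) - (p +i* q)).
move: hr hi => /=; move: (cabs _) => M; rewrite !ler_norml => /andP[r1 r2] /andP[i1 i2].
by case=> [|[|[|]]] E; rewrite E in r1 r2 i1 i2; lra.
Qed.

Local Open Scope ereal_scope.

Lemma square_tonelli (f : R[i] -> R[i]) (b : R[i]) (rho : R) : (0 <= rho)%R ->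
  (forall z, square b rho z -> {for z, continuous f}) ->
  \int[mu]_x \int[mu]_y ((fun z => (cabs (f z) ^+ 2)%:E) \_ (square b rho)) (x +i* y)%R =
  \int[mu]_y \int[mu]_x ((fun z => (cabs (f z) ^+ 2)%:E) \_ (square b rho)) (x +i* y)%R.
Proof.
move=> rho0 cf.
pose cx := clamp (complex.Re b) rho; pose cy := clamp (complex.Im b) rho.
pose u (p : R * R) : R := (cabs (f (cx p.1 +i* cy p.2)) ^+ 2)%R.
have mu_ : measurable_fun [set: R * R] u.
  apply: measurable_continuous2 => x y e e0.
  have zs : square b rho (cx x +i* cy y) by split; exact: clamp_in.
  have : (fun z => cabs (f z) ^+ 2)%R @ (cx x +i* cy y)%R --> (cabs (f (cx x +i* cy y)%R) ^+ 2)%R.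
    apply: (@continuous_comp _ _ _ (fun z => cabs (f z)) (fun t : R => t ^+ 2)%R); last exact: exprn_continuous.
    apply: continuous_comp; first exact: cf.
    exact: continuous_cabs.
  move/(@cvgrPdist_lt _ _ _ (nbhs (cx x +i* cy y)%R) _) => /(_ _ e0) /nbhs_cabs[d d0 dP].
  exists (d / 2)%R; first by rewrite divr_gt0.
  move=> x' y' xx yy; rewrite distrC; apply: dP.
  rewrite (le_lt_trans (cabs_le_ReIm _))//= (splitr d); apply: ltrD.
    by apply: le_lt_trans xx; exact: clamp_lip.
  by apply: le_lt_trans yy; exact: clamp_lip.
pose D : set (R * R) := `[(complex.Re b - rho)%R, (complex.Re b + rho)%R]%classic `*`
                        `[(complex.Im b - rho)%R, (complex.Im b + rho)%R]%classic.
have mD : measurable D by apply: measurableX; exact: measurable_itv.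
pose G : R * R -> \bar R := (EFin \o u) \_ D.
have mG : measurable_fun [set: R * R] G.
  apply/(measurable_restrictT _ mD); apply: measurable_funTS.
  exact/measurable_EFinP.
have G0 p : 0 <= G p by apply: erestrict_ge0 => q _; rewrite lee_fin sqr_ge0.
have GE x y : ((fun z => (cabs (f z) ^+ 2)%:E) \_ (square b rho)) (x +i* y)%R = G (x, y).
  rewrite /G /patch /D; have E : ((x +i* y)%R \in square b rho) = ((x, y) \in D).
    by apply/idP/idP; rewrite !inE /D /square /rect /= ?in_itv /=.
  rewrite E; case: ifPn => //; rewrite inE /D /= !in_itv /= => -[hx hy].
  by rewrite /u /= /cx /cy !clamp_id.
under eq_integral do under eq_integral do rewrite GE.
under [RHS]eq_integral do under eq_integral do rewrite GE.
exact: (@fubini_tonelli _ _ _ _ R mu mu G mG G0).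
Qed.

Lemma CI_edge_le (a c k K : R) (g f : R -> R[i]) (V : R -> \bar R) : (0 <= k)%R ->
  cont_on a c g -> cont_on a c f -> (forall t, 0 <= V t) -> \int[mu]_t V t <= K%:E ->
  (forall t, (a <= t <= c)%R ->
     (cabs (g t) <= k * cabs (f t) ^+ 2)%R /\ V t = (cabs (f t) ^+ 2)%:E) ->
  (cabs (CI a c g) <= 2 * (k * K))%R.
Proof.
move=> k0 cg cf V0 VK gf.
have cf2 : cont_on a c (fun t => cabs (f t) ^+ 2)%R.
  by move=> t tac; apply: continuousM; exact: (cont_on_cabs cf).
have VK' : (RI a c (fun t => cabs (f t) ^+ 2) <= K)%R.
  rewrite -lee_fin; apply: le_trans VK; apply: RI_le_integral => // t /gf[_ ->].
  by split; [exact: sqr_ge0|].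
apply: (le_trans (CI_cabs cg)); rewrite ler_wpM2l//.
apply: le_trans (ler_wpM2l k0 VK'); rewrite -RIZ//; apply: RI_le.
- exact: cont_on_cabs.
- by move=> t tac; apply: continuousM; [exact: cst_continuous|exact: cf2].
- by move=> t /gf[].
Qed.

(** Were the integral smaller, averaging over the four outer bands of width [rho / 2] would give two
    vertical and two horizontal lines with a small integral of [|f|^2], the horizontal ones after
    exchanging the integrals. Cauchy's formula for [f * f] on the rectangle that they bound then
    makes [|f b|^2] too small. *)
Lemma area_mean (f : R[i] -> R[i]) (b : R[i]) (rho : R) : (0 < rho)%R ->
  (forall z, square b rho z -> differentiable f z) ->
  (rho ^+ 2 / 16 * cabs (f b) ^+ 2)%:E <=
  \int[mu]_x \int[mu]_y ((fun z => (cabs (f z) ^+ 2)%:E) \_ (square b rho)) (x +i* y)%R.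
Proof.
move=> rho0 df; have rho0' := ltW rho0.
have cf z : square b rho z -> {for z, continuous f}.
  by move=> /df; exact: differentiable_continuous.
have TE := square_tonelli rho0' cf.
pose G (x y : R) := ((fun z => (cabs (f z) ^+ 2)%:E) \_ (square b rho)) (x +i* y)%R.
have G0 x y : 0 <= G x y by apply: erestrict_ge0 => q _; rewrite lee_fin sqr_ge0.
have GE z : square b rho z -> G (complex.Re z) (complex.Im z) = (cabs (f z) ^+ 2)%:E.
  by move=> zs; rewrite /G /patch; case: z zs => x y zs; rewrite mem_set.
have G0x x : 0 <= \int[mu]_y G x y by exact: integral_ge0.
have G0y y : 0 <= \int[mu]_x G x y by exact: integral_ge0.
rewrite leNgt; apply/negP => lt.
pose N : R := (cabs (f b) ^+ 2)%R.
have N0 : (0 <= N)%R by rewrite /N exprn_ge0 ?cabs_ge0.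
(* [K * (rho / 2)] is the assumed bound on the integral. The edges are at distance at least
   [rho / 2] from [b] and contribute [2 * (2 / rho * K)] each, in all [2 * N], against
   [|ctpi| * N >= 4 * N]. *)
pose K : R := (rho * N / 8)%R.
have K0 : (0 <= K)%R by rewrite /K divr_ge0 // mulr_ge0.
have KE (a : R) : (rho ^+ 2 / 16 * cabs (f b) ^+ 2)%:E = (K * (a + rho / 2 - a))%:E.
  by congr (_%:E); rewrite /K -/N; field.
have aa (a : R) : (a < a + rho / 2)%R by rewrite ltrDl divr_gt0.
have getx a : exists2 x, (a <= x <= a + rho / 2)%R & \int[mu]_y G x y <= K%:E.
  by apply: exists_le_integral; [exact: aa|exact: G0x|exact: K0|rewrite -KE].
have gety a : exists2 y, (a <= y <= a + rho / 2)%R & \int[mu]_x G x y <= K%:E.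
  by apply: exists_le_integral; [exact: aa|exact: G0y|exact: K0|rewrite -KE -TE].
set p := complex.Re b in GE; set q := complex.Im b in GE.
have [x0 /andP[x0l x0r] V0] := getx (p - rho)%R.
have [x1 /andP[x1l x1r] V1] := getx (p + rho / 2)%R.
have [y0 /andP[y0l y0r] H0] := gety (q - rho)%R.
have [y1 /andP[y1l y1r] H1] := gety (q + rho / 2)%R.
clear getx gety KE aa.
have sub z : rect x0 x1 y0 y1 z -> square b rho z.
  by move=> [/andP[? ?] /andP[? ?]]; split; apply/andP; split; rewrite -/p -/q; lra.
have x01 : (x0 <= x1)%R by lra.
have y01 : (y0 <= y1)%R by lra.
pose F z : R[i] := (f z * f z)%R.
have dF z : rect x0 x1 y0 y1 z -> differentiable F z.
  by move=> /sub/df dfz; exact: differentiableM.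
have bx : (x0 < complex.Re b < x1)%R by rewrite -/p; apply/andP; split; lra.
have by_ : (y0 < complex.Im b < y1)%R by rewrite -/q; apply/andP; split; lra.
have far z : bdry x0 x1 y0 y1 z -> (rho / 2 <= cabs (z - b))%R.
  by apply: bdry_far; rewrite -/p -/q; lra.
have CF := cauchy_formula bx by_ dF.
pose g z : R[i] := (F z * (z - b)^-1)%R.
have [c1 c2 c3 c4] : edges_cont g x0 x1 y0 y1.
  apply: edges_contM.
    apply: rect_edges_cont; [exact: x01|exact: y01|].
    by move=> z zr; apply: differentiable_continuous; exact: dF.
  apply: edges_cont_bdry; [exact: x01|exact: y01|].
  move=> z /far zb; apply: continuous_sub_inv.
  by rewrite -subr_eq0 -cabs_gt0; apply: lt_le_trans zb; rewrite divr_gt0.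
have gle z : bdry x0 x1 y0 y1 z -> (cabs (g z) <= 2 / rho * cabs (f z) ^+ 2)%R.
  move=> /far zb; rewrite /g /F !cabsM cabsV -expr2 mulrC ler_wpM2r ?sqr_ge0//.
  have -> : (2 / rho = (rho / 2)^-1)%R by rewrite invf_div.
  rewrite lef_pV2 ?posrE ?divr_gt0//.
  by apply: lt_le_trans zb; rewrite divr_gt0.
have [f1 f2 f3 f4] : edges_cont f x0 x1 y0 y1.
  by apply: rect_edges_cont; [exact: x01|exact: y01|move=> z /sub; exact: cf].
have onb z : bdry x0 x1 y0 y1 z -> square b rho z by case=> /sub.
have r2 : (0 <= 2 / rho)%R by rewrite divr_ge0.
have e1 : (cabs (CI x0 x1 (fun t => g (t +i* y0))) <= 2 * (2 / rho * K))%R.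
  apply: (CI_edge_le (V := G^~ y0) r2 c1 f1 _ H0) => [t|t tx]; first exact: G0.
  have tb : bdry x0 x1 y0 y1 (t +i* y0)%R by apply: bdry_hline y01 tx _; left.
  by split; [exact: gle|rewrite -(GE _ (onb _ tb))].
have e2 : (cabs (CI y0 y1 (fun t => g (x1 +i* t))) <= 2 * (2 / rho * K))%R.
  apply: (CI_edge_le (V := G x1) r2 c2 f2 _ V1) => [t|t tx]; first exact: G0.
  have tb : bdry x0 x1 y0 y1 (x1 +i* t)%R by apply: bdry_vline x01 tx _; right.
  by split; [exact: gle|rewrite -(GE _ (onb _ tb))].
have e3 : (cabs (CI x0 x1 (fun t => g (t +i* y1))) <= 2 * (2 / rho * K))%R.
  apply: (CI_edge_le (V := G^~ y1) r2 c3 f3 _ H1) => [t|t tx]; first exact: G0.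
  have tb : bdry x0 x1 y0 y1 (t +i* y1)%R by apply: bdry_hline y01 tx _; right.
  by split; [exact: gle|rewrite -(GE _ (onb _ tb))].
have e4 : (cabs (CI y0 y1 (fun t => g (x0 +i* t))) <= 2 * (2 / rho * K))%R.
  apply: (CI_edge_le (V := G x0) r2 c4 f4 _ V0) => [t|t tx]; first exact: G0.
  have tb : bdry x0 x1 y0 y1 (x0 +i* t)%R by apply: bdry_vline x01 tx _; left.
  by split; [exact: gle|rewrite -(GE _ (onb _ tb))].
have : (cabs (rect_int g x0 x1 y0 y1) <= 16 / rho * K)%R.
  move: e1 e2 e3 e4; rewrite /rect_int.
  set A := CI _ _ _; set B := CI _ _ _; set C := CI _ _ _; set D := CI _ _ _.
  move=> e1 e2 e3 e4.
  have iB : cabs ('i * B)%R = cabs B by rewrite cabsM cabs_i mul1r.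
  have iD : cabs ('i * D)%R = cabs D by rewrite cabsM cabs_i mul1r.
  have h1 := cabs_leD (A + 'i * B - C)%R (- ('i * D))%R; have h2 := cabs_leD (A + 'i * B)%R (- C)%R.
  have h3 := cabs_leD A ('i * B)%R; move: h1 h2 h3; rewrite !cabsN iB iD.
  set r := (2 * (2 / rho * K))%R in e1 e2 e3 e4 *.
  have -> : (16 / rho * K = 4 * r)%R by rewrite /r; ring.
  by move: e1 e2 e3 e4; clear; lra.
rewrite [rect_int _ _ _ _ _]CF cabsM /F cabsM -expr2 -/N.
have -> : (16 / rho * K = 2 * N)%R by rewrite /K; field; rewrite gt_eqF.
have c4' := cabs_ctpi R => hN.
have N00 : N = 0%R.
  have h4 := ler_wpM2r N0 c4'; apply/eqP; rewrite eq_le N0 andbT.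
  by move: (le_trans h4 hN); clear; lra.
move: lt; rewrite -/N N00 mulr0; apply/negP; rewrite -leNgt.
by apply: integral_ge0 => x _; exact: G0x.
Qed.

End area.

Section several_variables.
Variable R : realType.
Notation C := R[i].
Notation mu := (@lebesgue_measure R).

Lemma differentiable_rV (V : normedModType C) m (f : V -> 'rV[C]_m) (x : V) :
  (forall j, differentiable (fun v => f v ord0 j : C) x) -> differentiable f x.
Proof.
move=> df.
have -> : f = \sum_(j < m) (fun v => f v ord0 j *: (delta_mx ord0 j : 'rV[C]_m)).
  apply/funext => v; rewrite fct_sumE {1}[f v]matrix_sum_delta big_ord1.
  by apply: eq_bigr.
by apply: differentiable_sum => j; apply: differentiableZl; exact: df.
Qed.

Lemma row_mx_ord0 n (w : C) (z : 'rV[C]_n) : (row_mx w%:M z : 'rV_(1 + n)) ord0 ord0 = w.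
Proof.
have -> : ord0 = lshift n (ord0 : 'I_1) by apply/val_inj.
by rewrite row_mxEl mxE eqxx.
Qed.

Lemma row_mx_lift n (w : C) (z : 'rV[C]_n) (j : 'I_n) :
  (row_mx w%:M z : 'rV_(1 + n)) ord0 (rshift 1 j) = z ord0 j.
Proof. by rewrite row_mxEr. Qed.

Lemma differentiable_row_mxl n (z : 'rV[C]_n) (w : C) :
  differentiable (fun w : C => row_mx w%:M z : 'rV[C]_(1 + n)) w.
Proof.
apply: differentiable_rV => j; case: (split_ordP j) => k ->.
  under eq_fun do rewrite row_mxEl mxE.
  by rewrite !ord1 eqxx.
by under eq_fun do rewrite row_mxEr.
Qed.

Lemma differentiable_row_mxr n (z : 'rV[C]_n) (w : C) :
  differentiable (fun z : 'rV[C]_n => row_mx w%:M z : 'rV[C]_(1 + n)) z.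
Proof.
apply: differentiable_rV => j; case: (split_ordP j) => k ->.
  by under eq_fun do rewrite row_mxEl.
under eq_fun do rewrite row_mxEr.
exact: differentiable_coord.
Qed.

Definition polysquare n (b : 'rV[C]_n) (rho : R) : set 'rV[C]_n :=
  [set z | forall j, square (b ord0 j) rho (z ord0 j)].

Lemma polysquare_row n (b : 'rV[C]_n.+1) rho (w : C) (z : 'rV[C]_n) :
  polysquare b rho (row_mx w%:M z : 'rV_(1 + n)) <->
  square (b ord0 ord0) rho w /\ polysquare (rsubmx (b : 'rV_(1 + n))) rho z.
Proof.
split=> [h|[h1 h2] j].
  split; first by have := h ord0; rewrite row_mx_ord0.
  by move=> j; have := h (rshift 1 j); rewrite row_mx_lift mxE.
case: (@split_ordP 1 n j) => k ->.
  have -> : lshift n k = ord0 by apply/val_inj; rewrite /= ord1.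
  by rewrite row_mx_ord0.
by rewrite row_mx_lift; have := h2 k; rewrite mxE.
Qed.

Local Open Scope ereal_scope.

Lemma cintegral_ge0 n (g : 'rV[C]_n -> \bar R) : (forall z, 0 <= g z) ->
  0 <= cintegral g.
Proof.
elim: n g => [|n IH] g g0 /=; first exact: g0.
by do 2 (apply: integral_ge0 => ? _); apply: IH.
Qed.

Lemma le_cintegral n (f g : 'rV[C]_n -> \bar R) : (forall z, 0 <= f z) ->
  (forall z, f z <= g z) -> cintegral f <= cintegral g.
Proof.
elim: n f g => [|n IH] f g f0 fg /=; first exact: fg.
apply: ge0_le_integral_any => [x|x].
  by apply: integral_ge0 => y _; exact: cintegral_ge0.
apply: ge0_le_integral_any => y; first exact: cintegral_ge0.
exact: IH.
Qed.

Lemma integral_square (b : C) (rho : R) (K : R) : (0 <= rho)%R -> (0 <= K)%R ->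
  \int[mu]_x \int[mu]_y (cst K%:E \_ (square b rho)) (x +i* y)%R =
  (K * (2 * rho) ^+ 2)%:E.
Proof.
move=> rho0 K0; pose X := `[(complex.Re b - rho)%R, (complex.Re b + rho)%R]%classic.
pose Y := `[(complex.Im b - rho)%R, (complex.Im b + rho)%R]%classic.
have mX : measurable X by exact: measurable_itv.
have mY : measurable Y by exact: measurable_itv.
have muX : mu X = (2 * rho)%:E.
  rewrite /X lebesgue_measure_ccitv; last by move: rho0; clear; lra.
  by congr _%:E; ring.
have muY : mu Y = (2 * rho)%:E.
  rewrite /Y lebesgue_measure_ccitv; last by move: rho0; clear; lra.
  by congr _%:E; ring.
have XE (x : R) : (x \in X) = (complex.Re b - rho <= x <= complex.Re b + rho)%R.
  by apply/idP/idP; rewrite inE /X /= in_itv.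
have YE (y : R) : (y \in Y) = (complex.Im b - rho <= y <= complex.Im b + rho)%R.
  by apply/idP/idP; rewrite inE /Y /= in_itv.
have E (x : R) : \int[mu]_y (cst K%:E \_ (square b rho)) (x +i* y)%R =
    (cst (K * (2 * rho))%:E \_ X) x.
  rewrite /patch; case: ifPn => xX.
    transitivity (\int[mu]_y (cst K%:E \_ Y) y).
      apply: eq_integral => y _; rewrite /patch.
      suff -> : ((x +i* y)%R \in square b rho) = (y \in Y) by [].
      rewrite XE in xX.
      rewrite YE; apply/idP/idP => [|h]; first by rewrite inE => -[].
      by rewrite inE; split.
    by rewrite -integral_mkcond integral_cst//= muY -EFinM.
  rewrite integral0_eq// => y _; rewrite /patch; case: ifPn => //.
  by rewrite inE => -[/= xx _]; move: xX; rewrite XE xx.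
under eq_integral do rewrite E.
by rewrite -integral_mkcond integral_cst//= muX -EFinM; congr _%:E; ring.
Qed.

(** Only the bound is integrated exactly, one complex coordinate at a time, giving [K] times the
    volume; [g] itself is merely compared with it. *)
Lemma cintegral_polysquare_le n (b : 'rV[C]_n) (rho K : R) (g : 'rV[C]_n -> \bar R) :
  (0 <= rho)%R -> (0 <= K)%R -> (forall z, 0 <= g z) ->
  (forall z, g z <= (cst K%:E \_ (polysquare b rho)) z) ->
  cintegral g < +oo.
Proof.
move=> rho0 K0 g0 gK.
apply: (@le_lt_trans _ _ (K * (2 * rho) ^+ (2 * n))%:E); last exact: ltry.
apply: (le_trans (le_cintegral g0 gK)).
elim: n b K K0 {g g0 gK} => [|n IH] b K K0.
  by rewrite muln0 expr0 mulr1 /= /patch; case: ifP.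
pose b' := rsubmx (b : 'rV_(1 + n)).
have K'0 : (0 <= K * (2 * rho) ^+ (2 * n))%R.
  by rewrite mulr_ge0 ?exprn_ge0 ?mulr_ge0.
have -> : (K * (2 * rho) ^+ (2 * n.+1) = K * (2 * rho) ^+ (2 * n) * (2 * rho) ^+ 2)%R.
  by rewrite mulnS addnC exprD mulrA.
rewrite -(integral_square (b ord0 ord0) rho0 K'0) /=.
apply: ge0_le_integral_any => [x|x].
  apply: integral_ge0 => y _; apply: cintegral_ge0 => z.
  by apply: erestrict_ge0 => ? _; rewrite lee_fin.
apply: ge0_le_integral_any => y.
  apply: cintegral_ge0 => z.
  by apply: erestrict_ge0 => ? _; rewrite lee_fin.
have := IH b' K K0; rewrite [X in _ -> _ <= X]/patch.
case: ifPn => [|xy _].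
  rewrite inE => xy; apply: le_trans; apply: le_cintegral => z.
    by apply: erestrict_ge0 => ? _; rewrite lee_fin.
  rewrite /patch; case: ifPn => [|_]; last first.
    by case: ifP => // _; rewrite lee_fin.
  by rewrite inE => /polysquare_row[_ zb]; rewrite mem_set.
have -> : (fun z : 'rV[C]_n => (cst K%:E \_ (polysquare b rho))
    (row_mx (x +i* y)%:M z : 'rV_(1 + n))) = cst 0.
  apply/funext => z; rewrite /patch; case: ifPn => //.
  by rewrite inE => /polysquare_row[h _]; move: xy; rewrite notin_setE.
have {}IH m : cintegral (cst 0 : 'rV[C]_m -> \bar R) <= 0.
  elim: m => [|m IHm] //=.
  apply: (@le_trans _ _ (\int[mu]_x \int[mu]_y cst 0 y)); last by rewrite integral0_eq// => ? _; rewrite integral0_eq.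
  apply: ge0_le_integral_any => [u|u]; first by apply: integral_ge0 => v _; exact: cintegral_ge0.
  by apply: ge0_le_integral_any => v; first exact: cintegral_ge0.
exact: IH.
Qed.

Lemma polysquare_mean n (F : 'rV[C]_n -> C) (b : 'rV[C]_n) (rho : R) : (0 < rho)%R ->
  (forall z, polysquare b rho z -> differentiable F z) ->
  ((rho / 4) ^+ (2 * n) * cabs (F b) ^+ 2)%:E <=
  cintegral ((fun z => (cabs (F z) ^+ 2)%:E) \_ (polysquare b rho)).
Proof.
move=> rho0; elim: n F b => [|n IH] F b dF.
  rewrite muln0 expr0 mul1r /= (_ : b = 0%R); last by apply/rowP => -[].
  by rewrite /patch mem_set// => -[].
pose b' := rsubmx (b : 'rV_(1 + n)).
have bE : b = row_mx (b ord0 ord0)%:M b' :> 'rV_(1 + n).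
  apply/rowP => j; case: (@split_ordP 1 n j) => k ->; last by rewrite row_mx_lift mxE.
  have -> : lshift n k = ord0 by apply/val_inj; rewrite /= ord1.
  by rewrite row_mx_ord0.
have bb' : polysquare b' rho b'.
  by move=> j; apply: cabs_square; rewrite subrr cabs0 ltW.
(* Scaling by [s] makes [|f|^2] the very lower bound that the induction hypothesis provides for the
   remaining coordinates, so that [area_mean] applies to it in the first coordinate. *)
pose s : C := ((rho / 4) ^+ n)%:C.
pose f (w : C) : C := (s * F (row_mx w%:M b'))%R.
have df w : square (b ord0 ord0) rho w -> differentiable f w.
  move=> wb; apply: differentiableM; first exact: differentiable_cst.
  apply: (@differentiable_comp _ _ _ _ (fun w : C => row_mx w%:M b' : 'rV[C]_(1 + n)) F).
    exact: differentiable_row_mxl.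
  by apply: dF; apply/polysquare_row.
have s2 w : (cabs (f w) ^+ 2 = (rho / 4) ^+ (2 * n) * cabs (F (row_mx w%:M b')) ^+ 2)%R.
  rewrite /f cabsM exprMn /s cabs_real ger0_norm ?exprn_ge0 ?divr_ge0 ?(ltW rho0)//.
  by rewrite -exprM mulnC.
have -> : ((rho / 4) ^+ (2 * n.+1) * cabs (F b) ^+ 2 =
    rho ^+ 2 / 16 * cabs (f (b ord0 ord0)) ^+ 2)%R.
  rewrite s2 -bE mulnS exprD; move: (_ ^+ (2 * n))%R (cabs _) => t u.
  by field.
apply: (le_trans (area_mean rho0 df)) => /=.
apply: ge0_le_integral_any => [x|x].
  by apply: integral_ge0 => y _; apply: erestrict_ge0 => ? _; rewrite lee_fin sqr_ge0.
apply: ge0_le_integral_any => y.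
  by apply: erestrict_ge0 => ? _; rewrite lee_fin sqr_ge0.
rewrite {1}/patch; case: ifPn => [|_]; last first.
  by apply: cintegral_ge0 => z; apply: erestrict_ge0 => ? _; rewrite lee_fin sqr_ge0.
rewrite inE => xy; rewrite s2.
pose G (z : 'rV[C]_n) : C := F (row_mx (x +i* y)%:M z).
have := IH G b'; rewrite -/(G b') => /(_ _)/le_trans; apply.
  move=> z zb; apply: (@differentiable_comp _ _ _ _
    (fun z : 'rV[C]_n => row_mx (x +i* y)%:M z : 'rV[C]_(1 + n)) F).
    exact: differentiable_row_mxr.
  by apply: dF; apply/polysquare_row.
apply: le_cintegral => z; first by apply: erestrict_ge0 => ? _; rewrite lee_fin sqr_ge0.
rewrite /patch; case: ifPn => [|_]; last by case: ifP => // _; rewrite lee_fin sqr_ge0.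
by rewrite inE => zb; rewrite mem_set//; apply/polysquare_row.
Qed.

End several_variables.

Lemma near0_differentiable (K : numFieldType) (V W : normedModType K) (h : V -> W) (x : V) :
  (\forall y \near x, h y = 0) -> differentiable h x.
Proof.
move=> h0; have hx : h x = 0 by exact: nbhs_singleton h0.
have H : h \o shift x = cst (h x) + (\0 : {linear V -> W}) +o_ 0 id.
  apply/eqaddoP => e e0; move: h0; rewrite (near_shift 0) subr0.
  apply: filterS => y /= hy.
  have -> : (h \o +%R^~ x - (cst (h x) + (\0 : {linear V -> W}))) y = 0.
    by rewrite !fctE /= hy hx addr0 subrr.
  by rewrite normr0 mulr_ge0// ltW.
apply/diff_locallyP.
have -> : 'd h x = (\0 : {linear V -> W}) :> (V -> W).
  by apply: diff_unique => // y; exact: cst_continuous.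
by split=> // y; exact: cst_continuous.
Qed.

(** [crd] and [par] are inverse to each other on the chart only, so composites through charts agree
    with the intended maps just near a point. *)
Lemma near_eq_differentiable (K : numFieldType) (V W : normedModType K) (f g : V -> W) (x : V) :
  (\forall y \near x, f y = g y) -> differentiable f x -> differentiable g x.
Proof.
move=> fg df; have -> : g = f + (g - f) by rewrite addrC subrK.
apply: differentiableD => //; apply: near0_differentiable.
by apply: filterS fg => y fgy; rewrite !fctE fgy subrr.
Qed.

(** * Germs of holomorphic functions on curves *)

Section charts.
Variables (R : realType) (n : nat) (M : complex_manifold R n).
Implicit Types (x y : M) (c d e : chart R M n) (f g : M -> R[i]).

Lemma near_dom c x : dom c x -> \forall y \near x, dom c y.
Proof. by move=> cx; apply: open_nbhs_nbhs; split=> //; exact: open_dom. Qed.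

Lemma near_crd c x : dom c x ->
  \forall z \near crd c x, dom c (par c z) /\ crd c (par c z) = z.
Proof.
move=> cx; have : \forall z \near crd c x, (crd c @` dom c) z.
  by apply: open_nbhs_nbhs; split; [exact: open_crd_dom|exists x].
by apply: filterS => _ [y cy <-]; rewrite crdK.
Qed.

Lemma near_par c x (P : set M) : dom c x ->
  (\forall y \near x, P y) -> \forall z \near crd c x, P (par c z).
Proof.
move=> cx Px; have := @par_continuous _ _ _ c (crd c x) (ex_intro2 _ _ x cx erefl).
by apply; rewrite crdK.
Qed.

Lemma near_par_crd c x (P : set M) : dom c x ->
  (\forall z \near crd c x, P (par c z)) -> \forall y \near x, P y.
Proof.
move=> cx Px; have /(_ _ Px) Py := crd_continuous cx.
apply: filterS2 (near_dom cx) Py => y cy /=.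
by rewrite crdK.
Qed.

Lemma near_of_crd c x (P : set 'rV[R[i]]_n) : dom c x ->
  (\forall z \near crd c x, P z) -> \forall y \near x, P (crd c y).
Proof. by move=> cx Px; exact: crd_continuous cx _ Px. Qed.

Lemma chart_atlas x : exists c, chart_at x c /\ atlas c.
Proof.
have [c ac cx] := atlas_cover x; exists c; split=> //; split=> // d.
exact: atlas_compatible.
Qed.

Lemma chart_exists x : exists c, chart_at x c.
Proof. by have [c [? _]] := chart_atlas x; exists c. Qed.

Lemma chart_at_near x c : chart_at x c -> \forall y \near x, chart_at y c.
Proof. by move=> [cx cc]; apply: filterS (near_dom cx) => y cy; split. Qed.

(** Charts of the maximal atlas are by definition compatible with those of [atlas] only; the change
    of charts passes through one of the latter. *)
Lemma chart_change x c d : chart_at x c -> chart_at x d ->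
  differentiable (crd d \o par c) (crd c x).
Proof.
move=> [cx cc] [dx dd]; have [e [[ex _] ae]] := chart_atlas x.
have [ce _] := cc _ ae; have [_ ed] := dd _ ae.
have h1 : differentiable (crd e \o par c) (crd c x) by apply: ce; exists x.
have h2 : differentiable (crd d \o par e) ((crd e \o par c) (crd c x)).
  rewrite /= (crdK cx); apply: ed; by exists x.
apply: near_eq_differentiable (differentiable_comp h1 h2).
by apply: filterS (near_par cx (near_dom ex)) => z ez /=; rewrite crdK.
Qed.

Lemma holomorphic_at_chart x c f : chart_at x c ->
  differentiable (f \o par c) (crd c x) -> holomorphic_at f x.
Proof.
move=> cx df d dx; have h1 := chart_change dx cx.
have [cx1 _] := cx; have [dx1 _] := dx.
have h2 : differentiable (f \o par c) ((crd c \o par d) (crd d x)) by rewrite /= (crdK dx1); exact: df.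
apply: near_eq_differentiable (differentiable_comp h1 h2).
by apply: filterS (near_par dx1 (near_dom cx1)) => z ez /=; rewrite crdK.
Qed.

Lemma holomorphic_at_continuous x f : holomorphic_at f x -> {for x, continuous f}.
Proof.
move=> hf; have [c cx] := chart_exists x; have [cx1 _] := cx.
have cf := differentiable_continuous (hf c cx).
move=> A; rewrite -{1}(crdK cx1) => /cf fA.
by apply: near_par_crd cx1 fA.
Qed.

Lemma holomorphic_at_cst x (k : R[i]) : holomorphic_at (fun _ : M => k) x.
Proof. by move=> c _; exact: differentiable_cst. Qed.

Lemma holomorphic_atD x f g : holomorphic_at f x -> holomorphic_at g x ->
  holomorphic_at (fun y => f y + g y) x.
Proof. by move=> hf hg c cx; apply: differentiableD; [exact: hf|exact: hg]. Qed.

Lemma holomorphic_atM x f g : holomorphic_at f x -> holomorphic_at g x ->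
  holomorphic_at (fun y => f y * g y) x.
Proof. by move=> hf hg c cx; apply: differentiableM; [exact: hf|exact: hg]. Qed.

Lemma holomorphic_atX x f k : holomorphic_at f x -> holomorphic_at (fun y => f y ^+ k) x.
Proof.
move=> hf; elim: k => [|k IH].
  by under eq_fun do rewrite expr0; exact: holomorphic_at_cst.
by under eq_fun do rewrite exprS; exact: holomorphic_atM.
Qed.

Lemma holomorphic_atV x f : f x != 0 -> holomorphic_at f x ->
  holomorphic_at (fun y => (f y)^-1) x.
Proof.
move=> f0 hf c cx; apply: differentiableV; first exact: hf.
by have [cx1 _] := cx; rewrite /= crdK.
Qed.

Lemma holomorphic_at_sum x (I : Type) (r : seq I) (F : I -> M -> R[i]) :
  (forall i, holomorphic_at (F i) x) -> holomorphic_at (fun y => \sum_(i <- r) F i y) x.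
Proof.
move=> hF; elim: r => [|i r IH].
  by under eq_fun do rewrite big_nil; exact: holomorphic_at_cst.
by under eq_fun do rewrite big_cons; exact: holomorphic_atD.
Qed.

Lemma holomorphic_germ_chart x c f : chart_at x c ->
  (\forall z \near crd c x, differentiable (f \o par c) z) -> holomorphic_germ x f.
Proof.
move=> cx df; have [cx1 _] := cx.
apply: filterS2 (chart_at_near cx) (near_of_crd cx1 df) => y cy dy.
exact: (holomorphic_at_chart cy).
Qed.

Lemma chart_germ_holomorphic x c f : chart_at x c -> holomorphic_germ x f ->
  \forall z \near crd c x, differentiable (f \o par c) z.
Proof.
move=> cx hf; have [cx1 cc] := cx.
have := near_par cx1 hf; apply: filterS2 (near_crd cx1) => z [cz E] /(_ c).
by rewrite E; apply; split.
Qed.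

End charts.

Lemma holomorphic_at_comp (R : realType) (n k : nat) (N : complex_manifold R k)
    (M : complex_manifold R n) (F : N -> M) (x : N) c d (f : M -> R[i]) :
  chart_at x c -> chart_at (F x) d -> {for x, continuous F} ->
  differentiable (crd d \o F \o par c) (crd c x) ->
  holomorphic_at f (F x) -> holomorphic_at (f \o F) x.
Proof.
move=> cx dx cF dF hf; have [cx1 _] := cx; have [dx1 _] := dx.
apply: (holomorphic_at_chart cx).
have h2 : differentiable (f \o par d) ((crd d \o F \o par c) (crd c x)).
  by rewrite /= (crdK cx1); exact: hf.
apply: near_eq_differentiable (differentiable_comp dF h2).
have : \forall y \near x, dom d (F y) by apply: cF; exact: near_dom.
by move=> /(near_par cx1); apply: filterS => z ez /=; rewrite crdK.
Qed.

Lemma holomorphic_map_chart (R : realType) (n k : nat) (N : complex_manifold R k)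
    (M : complex_manifold R n) (F : N -> M) (x : N) c d c' d' :
  chart_at x c -> chart_at (F x) d -> chart_at x c' -> chart_at (F x) d' ->
  {for x, continuous F} ->
  differentiable (crd d \o F \o par c) (crd c x) ->
  differentiable (crd d' \o F \o par c') (crd c' x).
Proof.
move=> cx dx cx' dx' cF dF.
have [cx1 _] := cx; have [dx1 _] := dx; have [cx1' _] := cx'.
have h1 := chart_change cx' cx; have h2 := chart_change dx dx'.
have dF' : differentiable (crd d \o F \o par c) ((crd c \o par c') (crd c' x)).
  by rewrite /= (crdK cx1'); exact: dF.
have h3 := differentiable_comp h1 dF'.
have h2' : differentiable (crd d' \o par d) ((crd d \o F \o par c \o (crd c \o par c')) (crd c' x)).
  by rewrite /= (crdK cx1') (crdK cx1); exact: h2.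
apply: near_eq_differentiable (differentiable_comp h3 h2').
have Fd : \forall y \near x, dom d (F y) by apply: cF; exact: near_dom.
apply: filterS2 (near_par cx1' Fd) (near_par cx1' (near_dom cx1)) => z dz cz.
by rewrite /= crdK ?crdK.
Qed.

Section curve_germs.
Variables (R : realType) (S : complex_manifold R 1) (p : S) (c : chart R S 1).
Hypothesis cp : chart_at p c.
Implicit Types (f g u : S -> R[i]).

Definition lcoord (q : S) : R[i] := crd c q ord0 ord0 - crd c p ord0 ord0.

(** Order at least [N], encoded as a growth bound: this covers the zero germ and passes to sums and
    bounded multiples without any factorization. *)
Definition vanishes_to (f : S -> R[i]) (N : nat) : Prop :=
  exists A : R, \forall q \near p, cabs (f q) <= A * cabs (lcoord q) ^+ N.

Let z0 := crd c p ord0 ord0.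
Let cp1 : dom c p := proj1 cp.

Lemma const_mx00 (v : 'rV[R[i]]_1) : const_mx (v ord0 ord0) = v.
Proof. by apply/rowP => j; rewrite mxE !ord1. Qed.

Lemma near_rV1 (P : set 'rV[R[i]]_1) :
  (\forall v \near crd c p, P v) <-> (\forall z \near z0, P (const_mx z)).
Proof.
split=> [/nbhs_rV_cabs[e e0 eP]|/nbhs_cabs[e e0 eP]].
  apply/nbhs_cabs; exists e => // z zz; apply: eP => j.
  by rewrite mxE !ord1.
apply/nbhs_rV_cabs; exists e => // v vz; rewrite -(const_mx00 v); apply: eP.
exact: vz.
Qed.

Lemma near_curve (P : set S) :
  (\forall q \near p, P q) <-> (\forall z \near z0, P (par c (const_mx z))).
Proof.
split=> [/(near_par cp1)/near_rV1 //|h].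
by apply: (near_par_crd cp1); exact/near_rV1.
Qed.

Lemma lcoord_par : \forall z \near z0, lcoord (par c (const_mx z)) = z - z0.
Proof.
have /near_rV1 := near_crd cp1; apply: filterS => z [_ E].
by rewrite /lcoord E mxE.
Qed.

Lemma lcoord0 : lcoord p = 0. Proof. by rewrite /lcoord subrr. Qed.

Lemma lcoord_holomorphic : holomorphic_germ p lcoord.
Proof.
apply: (holomorphic_germ_chart cp).
have := near_crd cp1; rewrite -near_simpl => /near_join; apply: filterS => v hv.
have h : differentiable (fun v : 'rV[R[i]]_1 => v ord0 ord0 - z0 : R[i]) v.
  by apply: differentiableB; [exact: differentiable_coord|exact: differentiable_cst].
apply: near_eq_differentiable h; apply: filterS hv => w [_ E].
by rewrite /= /lcoord E.
Qed.

Lemma curve_germP f : holomorphic_germ p f <->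
  \forall z \near z0, differentiable (fun z : R[i] => f (par c (const_mx z))) z.
Proof.
split=> [/(chart_germ_holomorphic cp)/near_rV1|h].
  apply: filterS => z df.
  apply: (@differentiable_comp _ _ _ _ (fun z : R[i] => const_mx z : 'rV[R[i]]_1) (f \o par c)).
    by apply: differentiable_rV => j; under eq_fun do rewrite mxE.
  exact: df.
apply: (holomorphic_germ_chart cp); apply/near_rV1.
apply: filterS h => z dz.
have dz' : differentiable (fun z : R[i] => f (par c (const_mx z))) ((const_mx z : 'rV[R[i]]_1) ord0 ord0).
  by rewrite mxE.
have dc : differentiable (fun v : 'rV[R[i]]_1 => v ord0 ord0 : R[i]) (const_mx z).
  exact: differentiable_coord.
have -> : f \o par c = (fun z : R[i] => f (par c (const_mx z))) \o
    (fun v : 'rV[R[i]]_1 => v ord0 ord0).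
  by apply/funext => v; rewrite /= const_mx00.
exact: differentiable_comp dc dz'.
Qed.

Lemma germ_of_coord (g : R[i] -> R[i]) : (\forall z \near z0, differentiable g z) ->
  holomorphic_germ p (fun q => g (crd c q ord0 ord0)).
Proof.
move=> dg; apply/curve_germP.
have /near_rV1 := near_crd cp1; rewrite -near_simpl => /near_join.
apply: filterS2 dg => z dz hz.
apply: near_eq_differentiable dz; apply: filterS hz => w [_ E].
by rewrite E mxE.
Qed.

Lemma curve_order f : holomorphic_germ p f ->
  (\forall q \near p, f q = 0) \/
  exists (k : nat) (u : S -> R[i]), [/\ holomorphic_germ p u, u p != 0 &
    \forall q \near p, f q = lcoord q ^+ k * u q].
Proof.
move=> /curve_germP/vanishing_order[f0|[k [u [du u0 fu]]]].
  by left; apply/near_curve.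
right; exists k, (fun q => u (crd c q ord0 ord0)); split=> //.
  exact: germ_of_coord.
apply/near_curve; have /near_rV1 := near_crd cp1; apply: filterS3 lcoord_par fu => z E1 E2 [_ E3].
by rewrite E1 E2 E3 mxE.
Qed.

Lemma curve_taylor f k : holomorphic_germ p f ->
  exists (a : nat -> R[i]) (g : S -> R[i]), holomorphic_germ p g /\
    \forall q \near p, f q = \sum_(j < k) a j * lcoord q ^+ j + lcoord q ^+ k * g q.
Proof.
move=> /curve_germP/(taylor_near k)[a [g [dg fg]]].
exists a, (fun q => g (crd c q ord0 ord0)); split; first exact: germ_of_coord.
apply/near_curve; have /near_rV1 := near_crd cp1; apply: filterS3 lcoord_par fg => z E1 E2 [_ E3].
by rewrite E1 E2 E3 mxE.
Qed.

Lemma germ_at f : holomorphic_germ p f -> holomorphic_at f p.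
Proof. exact: nbhs_singleton. Qed.

Lemma near_bounded f : {for p, continuous f} ->
  \forall q \near p, cabs (f q) <= cabs (f p) + 1.
Proof.
move=> /cvg_cabsP/(_ _ ltr01); apply: filterS => q fq.
by rewrite -(subrK (f p) (f q)) (le_trans (cabs_leD _ _))// addrC lerD2l ltW.
Qed.

Lemma near_bounded_below f : {for p, continuous f} -> f p != 0 ->
  \forall q \near p, cabs (f p) / 2 <= cabs (f q).
Proof.
move=> cf f0; have f0' : 0 < cabs (f p) / 2 by rewrite divr_gt0 ?cabs_gt0.
move/cvg_cabsP/(_ _ f0') : cf; apply: filterS => q.
by have := cabs_leB (f p) (f p - f q); rewrite opprB addrCA subrr addr0 cabsB; lra.
Qed.

Lemma curve_near_neq (P : set S) (r : R) : (\forall q \near p, P q) -> 0 < r ->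
  exists q, [/\ P q, 0 < cabs (lcoord q) & cabs (lcoord q) < r].
Proof.
move=> /near_curve Pp r0; have [e e0 eP] := (nbhs_cabs _ _).1 (filterI Pp lcoord_par).
pose m := Num.min e r / 2.
have m0 : 0 < m by rewrite divr_gt0// lt_min e0.
have [me mr] : m < e /\ m < r.
  have : Num.min e r <= e by rewrite ge_min lexx.
  have : Num.min e r <= r by rewrite ge_min lexx orbT.
  by rewrite /m; move: m0; rewrite /m; lra.
have zc : cabs (z0 + m%:C - z0) = m by rewrite addrAC subrr add0r cabs_real gtr0_norm.
have := eP (z0 + m%:C); rewrite zc => /(_ me)[h1 h2].
by exists (par c (const_mx (z0 + m%:C))); rewrite h2 zc.
Qed.

Lemma near_lcoord (r : R) : 0 < r -> \forall q \near p, cabs (lcoord q) < r.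
Proof.
move=> r0; have /germ_at/holomorphic_at_continuous/cvg_cabsP/(_ _ r0) := lcoord_holomorphic.
by apply: filterS => q; rewrite lcoord0 subr0.
Qed.

(** For [k < N], dividing by [|t|^k] would bound [|u|] by a multiple of [|t|], against [u p != 0] as
    [t] tends to zero through nonzero values. *)
Lemma vanishes_to_order f u N k : vanishes_to f N -> {for p, continuous u} -> u p != 0 ->
  (\forall q \near p, f q = lcoord q ^+ k * u q) -> (N <= k)%N.
Proof.
move=> [A fA] cu u0 fu; rewrite leqNgt; apply/negP => kN.
have up0 : 0 < cabs (u p) / 2 by rewrite divr_gt0 ?cabs_gt0.
pose r := Num.min 1 (cabs (u p) / 2 / (`|A| + 1)).
have r0 : 0 < r by rewrite lt_min ltr01/= divr_gt0// ltr_wpDl.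
have H : \forall q \near p, [/\ cabs (f q) <= A * cabs (lcoord q) ^+ N,
    f q = lcoord q ^+ k * u q & cabs (u p) / 2 <= cabs (u q)].
  by apply: filterS3 fA fu (near_bounded_below cu u0).
have [q [[h1 h2 h3] t0 tr]] := curve_near_neq H r0.
move: h1; rewrite h2 cabsM cabsX; set t := cabs (lcoord q) in t0 tr *.
rewrite -(subnKC kN) addSnnS exprD mulrCA ler_pM2l ?exprn_gt0// exprS.
have t1 : t <= 1 by move: tr; rewrite lt_min => /andP[/ltW].
have tA : t * (`|A| + 1) < cabs (u p) / 2.
  by rewrite -ltr_pdivlMr ?ltr_wpDl//; move: tr; rewrite lt_min => /andP[].
have tn1 : t ^+ (N - k.+1) <= 1 by rewrite exprn_ile1// ltW.
have tn0 : 0 <= t ^+ (N - k.+1) by rewrite exprn_ge0// ltW.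
move=> h; have : A * (t * t ^+ (N - k.+1)) <= t * (`|A| + 1).
  have := ler_norm A => An.
  apply: (@le_trans _ _ (`|A| * t)); last by rewrite mulrDr mulr1 mulrC lerDl ltW.
  rewrite mulrA; apply: (@le_trans _ _ (`|A| * t * t ^+ (N - k.+1))).
    by rewrite ler_wpM2r// ler_wpM2r// ltW.
  by rewrite ler_piMr// mulr_ge0// ltW.
by move: h h3 tA; lra.
Qed.

Lemma order_vanishes_to f u N k : {for p, continuous u} -> (N <= k)%N ->
  (\forall q \near p, f q = lcoord q ^+ k * u q) -> vanishes_to f N.
Proof.
move=> cu Nk fu; exists (cabs (u p) + 1).
apply: filterS3 fu (near_bounded cu) (near_lcoord ltr01) => q -> uq tq.
rewrite cabsM cabsX mulrC; apply: ler_pM => //; rewrite ?cabs_ge0 ?exprn_ge0 ?cabs_ge0//.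
by rewrite -(subnKC Nk) exprD ler_piMr ?exprn_ge0 ?cabs_ge0// exprn_ile1 ?cabs_ge0// ltW.
Qed.

Lemma curve_division f N : holomorphic_germ p f -> vanishes_to f N ->
  exists g, holomorphic_germ p g /\ \forall q \near p, f q = lcoord q ^+ N * g q.
Proof.
move=> hf vf; have [f0|[k [u [hu u0 fu]]]] := curve_order hf.
  exists (fun=> 0); split.
    by apply: filterS hf => q _; exact: holomorphic_at_cst.
  by apply: filterS f0 => q ->; rewrite mulr0.
have Nk := vanishes_to_order vf (holomorphic_at_continuous (germ_at hu)) u0 fu.
exists (fun q => lcoord q ^+ (k - N) * u q); split.
  apply: filterS2 hu lcoord_holomorphic => q uq lq.
  by apply: holomorphic_atM => //; exact: holomorphic_atX.
by apply: filterS fu => q ->; rewrite mulrA -exprD subnKC.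
Qed.

(** Divide by the [N]-th power of the coordinate and expand the quotient. The [d] coefficients
    obtained are the linear conditions to be counted in [h0_le]. *)
Lemma vanishes_to_taylor f N d : holomorphic_germ p f -> vanishes_to f N ->
  exists a : nat -> R[i],
    vanishes_to (fun q => f q - \sum_(j < d) a j * lcoord q ^+ (N + j)) (N + d).
Proof.
move=> hf vf; have [g [hg fg]] := curve_division hf vf.
have [a [h [hh gh]]] := curve_taylor d hg.
exists a; apply: (@order_vanishes_to _ h _ (N + d)) => //.
  exact: holomorphic_at_continuous (germ_at hh).
apply: filterS2 fg gh => q -> ->; rewrite mulrDr exprD -mulrA mulr_sumr.
under [X in _ - X]eq_bigr do rewrite exprD mulrCA.
by rewrite addrAC subrr add0r.
Qed.

Lemma vanishes_to0 f : {for p, continuous f} -> vanishes_to f 0.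
Proof.
move=> cf; exists (cabs (f p) + 1); apply: filterS (near_bounded cf) => q.
by rewrite expr0 mulr1.
Qed.

Lemma vanishes_toD f g N : vanishes_to f N -> vanishes_to g N ->
  vanishes_to (fun q => f q + g q) N.
Proof.
move=> [A fA] [B gB]; exists (A + B); apply: filterS2 fA gB => q hf hg.
by rewrite (le_trans (cabs_leD _ _))// mulrDl lerD.
Qed.

Lemma vanishes_toM f g N : {for p, continuous f} -> vanishes_to g N ->
  vanishes_to (fun q => f q * g q) N.
Proof.
move=> cf [A gA]; exists ((cabs (f p) + 1) * A).
apply: filterS2 (near_bounded cf) gA => q hf hg.
by rewrite cabsM -mulrA; apply: ler_pM; rewrite ?cabs_ge0.
Qed.

Lemma vanishes_to_sum (I : Type) (r : seq I) (F : I -> S -> R[i]) N :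
  (forall i, vanishes_to (F i) N) -> vanishes_to (fun q => \sum_(i <- r) F i q) N.
Proof.
move=> hF; elim: r => [|i r IH].
  exists 0; apply: filterS (near_lcoord ltr01) => q _.
  by rewrite big_nil cabs0 mul0r.
by under [X in vanishes_to X]eq_fun do rewrite big_cons; exact: vanishes_toD.
Qed.

Lemma vanishes_to_near_eq f g N : (\forall q \near p, f q = g q) ->
  vanishes_to f N -> vanishes_to g N.
Proof. by move=> fg [A fA]; exists A; apply: filterS2 fg fA => q ->. Qed.

Lemma vanishes_to_le f N N' : (N' <= N)%N -> vanishes_to f N -> vanishes_to f N'.
Proof.
move=> NN [A fA]; exists `|A|; apply: filterS2 fA (near_lcoord ltr01) => q fq tq.
rewrite (le_trans fq)//; apply: (@le_trans _ _ (`|A| * cabs (lcoord q) ^+ N)).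
  by rewrite ler_wpM2r ?exprn_ge0 ?cabs_ge0// ler_norm.
rewrite ler_wpM2l// -(subnKC NN) exprD ler_piMr ?exprn_ge0 ?cabs_ge0//.
by rewrite exprn_ile1 ?cabs_ge0// ltW.
Qed.

End curve_germs.

(** * Multiplier ideals along a curve *)

Section weight_bounds.
Variable R : realType.
Local Open Scope ereal_scope.

(* With [S] the sum of the [|f_l|^2], the form of the weights of a metric with
   analytic singularities. *)
Definition log_weight (alpha S v : R) : \bar R := (alpha / 2)%:E * lne S%:E + v%:E.

Lemma log_weight_le (alpha S v S' v' : R) : (0 <= alpha)%R -> (0 <= S)%R ->
  (S <= S')%R -> (0 < S')%R -> (v <= v')%R ->
  log_weight alpha S v <= (alpha / 2 * ln S' + v')%:E.
Proof.
move=> a0 S0 SS S'0 vv; rewrite EFinD; apply: leeD; last by rewrite lee_fin.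
rewrite [leRHS]EFinM; apply: lee_wpmul2l; first by rewrite lee_fin divr_ge0.
rewrite -lne_EFin// lee_lne ?lee_fin// in_itv /= ?lee_fin ?leey ?andbT//.
exact: ltW.
Qed.

Lemma expeR_weight_ge (m : nat) (psi : \bar R) (b : R) : psi <= b%:E ->
  (expR (- (2 * (m%:R * b))))%:E <= expeR (- (2%:E * (m%:R%:E * psi))).
Proof.
move=> pb; rewrite -[leLHS]/(expeR (- (2 * (m%:R * b)))%:E) lee_expeR EFinN leeN2 !EFinM.
by do 2 (apply: lee_wpmul2l; first by rewrite lee_fin).
Qed.

(** In [exp (- 2 m phi)] the singular factor is [S] to the power [- m alpha]; as [M >= m alpha] and
    [S] is bounded, [S ^+ M] compensates for it, and [v] contributes a bounded factor. *)
Lemma weight_upper (m M : nat) (alpha S0 B K0 : R) : (0 <= alpha)%R ->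
  (m%:R * alpha <= M%:R)%R -> (0 < M)%N -> (0 <= K0)%R ->
  exists2 K : R, (0 <= K)%R & forall S v W : R, (0 <= S <= S0)%R -> (`|v| <= B)%R ->
    (0 <= W)%R -> (W <= K0 * S ^+ M)%R ->
    W%:E * expeR (- (2%:E * (m%:R%:E * log_weight alpha S v))) <= K%:E.
Proof.
move=> a0 mM M0 K00.
pose S1 := Num.max 1%R S0.
have S10 : (1 <= S1)%R by rewrite le_max lexx.
pose K := (K0 * expR ((M%:R - m%:R * alpha) * ln S1) * expR (2 * m%:R * B))%R.
exists K; first by rewrite !mulr_ge0 ?expR_ge0.
move=> S v W /andP[Sge SS0] vB W0 WS.
(* Here the exponential may be [+oo]; since [M] is positive, [W = 0], and [0 * +oo = 0]. *)
have [SE|Sn0] := eqVneq S 0%R.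
  have -> : W = 0%R.
    by apply/eqP; rewrite eq_le W0 andbT (le_trans WS)// SE expr0n eqn0Ngt M0 mulr0.
  by rewrite mul0e lee_fin !mulr_ge0 ?expR_ge0.
have Sp : (0 < S)%R by rewrite lt_neqAle eq_sym Sn0.
have -> : log_weight alpha S v = (alpha / 2 * ln S + v)%:E by rewrite /log_weight lne_EFin.
rewrite -[leLHS]/((W * expR (- (2 * (m%:R * (alpha / 2 * ln S + v)))))%:E) lee_fin.
have SM : (S ^+ M = expR (M%:R * ln S))%R.
  by rewrite mulrC expRM_natr lnK ?posrE.
apply: (@le_trans _ _ (K0 * (S ^+ M * expR (- (2 * (m%:R * (alpha / 2 * ln S + v)))))))%R.
  by rewrite [leRHS]mulrA ler_wpM2r ?expR_ge0.
rewrite SM -expRD /K -[leRHS]mulrA -[X in (_ <= _ * X)%R]expRD ler_wpM2l// ler_expR.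
have lS : (ln S <= ln S1)%R.
  have SS1 : (S <= S1)%R by rewrite le_max SS0 orbT.
  by rewrite ler_ln ?posrE// (lt_le_trans Sp).
have h1 : ((M%:R - m%:R * alpha) * ln S <= (M%:R - m%:R * alpha) * ln S1)%R.
  by rewrite ler_wpM2l// subr_ge0.
have h2 : (- (m%:R * v) <= m%:R * B)%R.
  by rewrite -mulrN ler_wpM2l// (le_trans _ vB)// -normrN ler_norm.
move: h1 h2; set x := ln S; set y := ln S1.
rewrite !mulrBl [(2 * m%:R * B)%R](_ : _ = 2 * (m%:R * B))%R; last by rewrite mulrA.
rewrite [(- (2 * (m%:R * (alpha / 2 * x + v))))%R](_ : _ = - (m%:R * alpha * x) + 2 * (- (m%:R * v)))%R; last by field.
set p := (M%:R * x)%R; set p' := (M%:R * y)%R; set q := (m%:R * alpha * x)%R; set q' := (m%:R * alpha * y)%R.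
by clear; lra.
Qed.

End weight_bounds.

Lemma squareS (R : realType) (b : R[i]) (r r' : R) : r <= r' ->
  square b r `<=` square b r'.
Proof.
by move=> rr z [/andP[? ?] /andP[? ?]]; split; apply/andP; split; lra.
Qed.

Lemma near_forall_fin (T : topologicalType) (x : T) (I : finType) (P : I -> T -> Prop) :
  (forall i, \forall y \near x, P i y) -> \forall y \near x, forall i, P i y.
Proof. by move=> H; apply: filter_forall. Qed.

(** [expR (la * ln t)] is the real power of [t] with exponent [la]; for negative [la] it is
    unbounded as [t] tends to zero. *)
Lemma power_bound (R : realType) (C0 la I : R) : 0 < C0 ->
  (forall r : R, 0 < r -> exists2 t : R, 0 < t < r & C0 * expR (la * ln t) <= I) -> 0 <= la.
Proof.
move=> C00 H; rewrite leNgt; apply/negP => la0.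
pose I1 : R := `|I| + 1.
have I10 : 0 < I1 by rewrite ltr_wpDl.
have [t /andP[t0 tr]] := H (expR (ln (I1 / C0) / la)) (expR_gt0 _).
apply/negP; rewrite -ltNge; apply: (@lt_trans _ _ I1).
  by rewrite /I1; have := ler_norm I; lra.
rewrite mulrC -ltr_pdivrMr// -[ltLHS]lnK ?posrE ?divr_gt0// ltr_expR.
have tl : ln t < ln (I1 / C0) / la by rewrite -ltr_expR lnK ?posrE.
by move: tl; rewrite ltr_ndivlMr// [_ * la]mulrC.
Qed.

Section upper_inclusion.
Variables (R : realType) (n : nat) (M : complex_manifold R n) (S : complex_manifold R 1).
Variables (e : S -> M) (p : S) (c : chart R S 1) (d : chart R M n).
Hypotheses (cp : chart_at p c) (dp : chart_at (e p) d).
Hypothesis axis : \forall q \near p, dom d (e q) /\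
  crd d (e q) = \row_(j < n) (if val j == 0%N then crd c q ord0 ord0 else 0).
Variables (psi : M -> \bar R) (alpha B : R) (k : nat) (f : 'I_k -> M -> R[i]).
Hypotheses (alpha0 : 0 <= alpha) (hf : forall l, holomorphic_germ (e p) (f l)).
Hypothesis psiE : \forall y \near e p, exists2 v : R, `|v| <= B &
  psi y = log_weight alpha (\sum_(l < k) cabs (f l y) ^+ 2) v.
Variable a : nat.
Hypothesis fa : forall l, vanishes_to p c (f l \o e) a.

(** The complex line from [e q] to a point [z] of the polydisc stays in the chart up to parameters
    of size [1 / |t|^a], where [f l] is bounded. By [square_lipschitz], [f l] moves by a multiple of
    [|t|^a] at most between the parameters 0 and 1, and at 0 it is of that size by [fa]. *)
Lemma near_lipschitz : exists A e0 : R, [/\ 0 < A, 0 < e0 &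
  \forall q \near p, forall (z : 'rV[R[i]]_n), 
     polysquare (crd d (e q)) (e0 * cabs (lcoord p c q) ^+ a) z ->
     forall l, cabs (f l (par d z)) <= A * cabs (lcoord p c q) ^+ a].
Proof.
have [dp1 _] := dp.
pose M' := \sum_l (cabs (f l (e p)) + 1).
have M'l l : cabs (f l (e p)) + 1 <= M'.
  rewrite /M' (bigD1 l)//= lerDl sumr_ge0// => j _.
  by rewrite addr_ge0 ?cabs_ge0.
have M'0 : 0 <= M' by apply: sumr_ge0 => l _; rewrite addr_ge0 ?cabs_ge0.
have G1 : \forall z \near crd d (e p), forall l,
    differentiable (f l \o par d) z /\ cabs (f l (par d z)) <= M'.
  apply: near_forall_fin => l.
  have cl : {for e p, continuous (f l)}.
    by apply: holomorphic_at_continuous; exact: nbhs_singleton (hf l).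
  have bl : \forall y \near e p, cabs (f l y) <= M'.
    move/cvg_cabsP/(_ _ ltr01) : cl; apply: filterS => y fy.
    apply: le_trans (M'l l); rewrite -(subrK (f l (e p)) (f l y)).
    by rewrite (le_trans (cabs_leD _ _))// addrC lerD2l ltW.
  by apply: filterS2 (chart_germ_holomorphic dp (hf l)) (near_par dp1 bl).
have [r r0 rP] := (nbhs_rV_cabs _ _).1 G1.
pose Al l := projT1 (cid (fa l)).
have Alp l : \forall q \near p, cabs (f l (e q)) <= Al l * cabs (lcoord p c q) ^+ a.
  by rewrite /Al; case: cid.
pose A := \sum_l `|Al l|.
have AA l : Al l <= A.
  rewrite /A (bigD1 l)//= (le_trans (ler_norm _))// lerDl sumr_ge0//.
have A0 : 0 <= A by apply: sumr_ge0.
exists (A + 2 * M' + 1), (r / 32); split.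
- by rewrite ltr_wpDl// addr_ge0// mulr_ge0.
- by rewrite divr_gt0.
have Alq : \forall q \near p, forall l, cabs (f l (e q)) <= Al l * cabs (lcoord p c q) ^+ a.
  exact: near_forall_fin.
have r4 : 0 < Num.min 1 (r / 4) by rewrite lt_min ltr01 divr_gt0.
have [_ axp] := nbhs_singleton axis.
apply: filterS3 axis Alq (near_lcoord cp r4) => q [dq axq] fq.
rewrite lt_min => /andP[t1 tr] z zb l.
set t := cabs (lcoord p c q) in t1 tr zb fq *.
have t0 : 0 <= t ^+ a by rewrite exprn_ge0 ?cabs_ge0.
have ta1 : t ^+ a <= 1 by rewrite exprn_ile1 ?cabs_ge0// ltW.
apply: (@le_trans _ _ ((A + 2 * M') * t ^+ a)); last by rewrite ler_wpM2r// lerDl.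
rewrite -(subrK (f l (e q)) (f l (par d z))) (le_trans (cabs_leD _ _))// addrC mulrDl.
apply: lerD; first by rewrite (le_trans (fq l))// ler_wpM2r.
have zj j : cabs (z ord0 j - crd d (e q) ord0 j) <= r / 16 * t ^+ a.
  have := square_cabs (zb j); rewrite mulrA.
  by rewrite [2 * (r / 32)](_ : _ = r / 16); last by field.
have bj j : cabs (crd d (e q) ord0 j - crd d (e p) ord0 j) < r / 4.
  rewrite axq axp !mxE; case: ifP => _; first exact: tr.
  by rewrite subrr cabs0 divr_gt0.
(* At [q = p] with [a > 0] the polydisc is reduced to its centre. *)
have [ta0|tan0] := eqVneq (t ^+ a) 0.
  have -> : z = crd d (e q).
    apply/rowP => j; apply/eqP; rewrite -subr_eq0 -cabs_eq0.
    by rewrite eq_le cabs_ge0 andbT (le_trans (zj j))// ta0 mulr0.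
  by rewrite crdK// subrr cabs0 ta0 mulr0.
have tap : 0 < t ^+ a by rewrite lt_neqAle eq_sym tan0.
(* Parameters of modulus up to [2 * T] move each coordinate by at most
   [2 * T * (r / 16 * t ^+ a) = r / 2], and [T >= 4] puts the parameter 1 within [T / 2] of 0. *)
pose T := 4 / t ^+ a.
have T4 : 4 <= T by rewrite ler_pdivlMr// -[leRHS]mulr1 ler_wpM2l.
have T0 : 0 < T by rewrite (lt_le_trans _ T4).
pose b := crd d (e q).
pose h (s : R[i]) : R[i] := f l (par d (b + s *: (z - b))).
have hin s : square 0 T s -> forall j,
    cabs ((b + s *: (z - b)) ord0 j - crd d (e p) ord0 j) < r.
  move=> /square_cabs; rewrite subr0 => sT j.
  have -> : (b + s *: (z - b)) ord0 j - crd d (e p) ord0 j =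
      (crd d (e q) ord0 j - crd d (e p) ord0 j) + s * (z ord0 j - crd d (e q) ord0 j).
    by rewrite !mxE addrAC.
  rewrite (le_lt_trans (cabs_leD _ _))// cabsM.
  have : cabs s * cabs (z ord0 j - crd d (e q) ord0 j) <= (2 * T) * (r / 16 * t ^+ a).
    by apply: ler_pM; rewrite ?cabs_ge0.
  have -> : (2 * T) * (r / 16 * t ^+ a) = r / 2 by rewrite /T; field.
  by move: (bj j); lra.
have dh s : square 0 T s -> differentiable h s.
  move=> /hin/rP/(_ l)[df _].
  apply: (@differentiable_comp _ _ _ _ (fun s : R[i] => b + s *: (z - b)) (f l \o par d)); last exact: df.
  apply: differentiableD; first exact: differentiable_cst.
  by apply: differentiableZl.
have hM s : square 0 T s -> cabs (h s) <= M' by move=> /hin/rP/(_ l)[].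
have := @square_lipschitz _ h 0 T M' T0 dh hM 1.
rewrite subr0 cabs1 mulr1 => /(_ _) H.
have h1 : h 1 = f l (par d z) by rewrite /h scale1r addrC subrK.
have h0 : h 0 = f l (e q) by rewrite /h scale0r addr0 /b crdK.
rewrite -h1 -h0 (le_trans (H _))//.
  by rewrite ltr_pdivlMr// mul1r (lt_le_trans _ T4)// ltr_nat.
rewrite le_eqVlt; apply/orP; left; apply/eqP; rewrite /T; field.
by rewrite tan0.
Qed.

(* On the polydisc of radius [e0 * |t|^a] around [e q], where [t] is the coordinate
   of [q], all [|f_l|] are at most [A * |t|^a].  The sub-mean value inequality for
   [|F|^2] on it bounds [|F (e q)|^2 * |t|^(2 a n)] by a multiple of
   [|t|^(2 a m alpha)] times the integral, and [q] tends to [p]. *)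
Lemma order_lower_bound (F : M -> R[i]) (K m : nat) (u : S -> R[i]) :
  holomorphic_germ (e p) F ->
  locally_integrable_at (fun y => ((cabs (F y) ^+ 2)%:E *
    expeR (- (2%:E * (m%:R%:E * psi y))))%E) (e p) ->
  {for p, continuous u} -> u p != 0 ->
  (\forall q \near p, F (e q) = lcoord p c q ^+ K * u q) ->
  a%:R * (m%:R * alpha) <= K%:R + a%:R * n%:R.
Proof.
move=> hF intF cu u0 Fu.
have [dp1 _] := dp; have [V [oV Vp Vd intV]] := intF _ dp.
pose g y : \bar R := ((cabs (F y) ^+ 2)%:E * expeR (- (2%:E * (m%:R%:E * psi y))))%E.
rewrite -/g in intV.
have g0 y : (0 <= g y)%E.
  by apply: mule_ge0; rewrite ?expeR_ge0// lee_fin sqr_ge0.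
have [A [e0 [A0 e00 lip]]] := near_lipschitz.
have G1 : \forall z \near crd d (e p), [/\ V z, differentiable (F \o par d) z &
    exists2 v : R, `|v| <= B &
    psi (par d z) = log_weight alpha (\sum_(l < k) cabs (f l (par d z)) ^+ 2) v].
  have nV : nbhs (crd d (e p)) V by apply: open_nbhs_nbhs.
  by apply: filterS3 nV (chart_germ_holomorphic dp hF) (near_par dp1 psiE).
have [r r0 rP] := (nbhs_rV_cabs _ _).1 G1.
(* On the polydisc the sum of the [|f_l|^2] is at most [S1] times the square of [t ^+ a]; the added
   1 keeps the argument of [ln] positive even for [k = 0]. *)
pose S1 := k%:R * A ^+ 2 + 1.
have S10 : 0 < S1 by rewrite ltr_wpDl// mulr_ge0// exprn_ge0// ltW.
pose e1 := Num.min e0 (r / 4).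
have e10 : 0 < e1 by rewrite lt_min e00 divr_gt0.
pose I := fine (cintegral ((g \o par d) \_ V)).
have IE : I%:E = cintegral ((g \o par d) \_ V).
  rewrite fineK// ge0_fin_numE//; apply: cintegral_ge0 => z.
  by apply: erestrict_ge0 => ? _; exact: g0.
have up0 : 0 < cabs (u p) / 2 by rewrite divr_gt0 ?cabs_gt0.
pose C0 : R := (e1 / 4) ^+ (2 * n) * (cabs (u p) / 2) ^+ 2 *
  expR (- (m%:R * alpha * ln S1 + 2 * m%:R * B)).
have C00 : 0 < C0.
  apply: mulr_gt0; last exact: expR_gt0.
  by apply: mulr_gt0; apply: exprn_gt0; rewrite // divr_gt0.
(* Exponent of [t] in the final inequality: [2 K] comes from [|F|^2], [2 a n] from the volume of the
   polydisc, and the negative term from the weight. *)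
pose la : R := 2 * (K%:R + a%:R * n%:R - a%:R * (m%:R * alpha)).
suff : 0 <= la by rewrite /la pmulr_rge0// subr_ge0.
apply: (@power_bound _ C0 la I C00) => r1 r10.
have r2 : 0 < Num.min (Num.min r1 1) (r / 4) by rewrite !lt_min r10 ltr01 divr_gt0.
have [_ axp] := nbhs_singleton axis.
have near_all : \forall q \near p, [/\ dom d (e q) /\
    crd d (e q) = \row_(j < n) (if val j == 0%N then crd c q ord0 ord0 else 0),
    forall (z : 'rV[R[i]]_n), polysquare (crd d (e q)) (e0 * cabs (lcoord p c q) ^+ a) z ->
      forall l, cabs (f l (par d z)) <= A * cabs (lcoord p c q) ^+ a,
    F (e q) = lcoord p c q ^+ K * u q & cabs (u p) / 2 <= cabs (u q)].
  near=> q; split; near: q; [exact: axis|exact: lip|exact: Fu|exact: near_bounded_below].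
have [q [[[dq axq] fz Fq uq] t0 tr]] := curve_near_neq cp near_all r2.
set t := cabs (lcoord p c q) in t0 tr fz.
move: tr; rewrite !lt_min => /andP[/andP[tr1 t1] tr].
exists t; first by rewrite t0.
have ta0 : 0 < t ^+ a by rewrite exprn_gt0.
have ta1 : t ^+ a <= 1 by rewrite exprn_ile1// ltW.
pose b := crd d (e q).
pose rho := e1 * t ^+ a.
have rho0 : 0 < rho by rewrite mulr_gt0.
have e1e0 : e1 <= e0 by rewrite ge_min lexx.
have e1r : e1 <= r / 4 by rewrite ge_min lexx orbT.
have rhor : rho <= r / 4 by rewrite (le_trans _ e1r)// ler_piMr// ltW.
have zin z : polysquare b rho z -> forall j, cabs (z ord0 j - crd d (e p) ord0 j) < r.
  move=> zb j; have := square_cabs (zb j).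
  have : cabs (b ord0 j - crd d (e p) ord0 j) < r / 4.
    rewrite /b axq axp !mxE; case: ifP => _; first exact: tr.
    by rewrite subrr cabs0 divr_gt0.
  have := cabs_leD (z ord0 j - b ord0 j) (b ord0 j - crd d (e p) ord0 j).
  by rewrite addrA subrK; lra.
pose W := alpha / 2 * ln (S1 * (t ^+ a) ^+ 2) + B.
pose E := expR (- (2 * (m%:R * W))).
have E0 : 0 <= E := expR_ge0 _.
have St0 : 0 < S1 * (t ^+ a) ^+ 2 by rewrite mulr_gt0// exprn_gt0.
have psiW z : polysquare b rho z -> (psi (par d z) <= W%:E)%E.
  move=> zb; have [_ _ [v vB ->]] := rP z (zin z zb).
  apply: log_weight_le => //; last by rewrite (le_trans _ vB)// ler_norm.
    by apply: sumr_ge0 => l _; rewrite sqr_ge0.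
  apply: (@le_trans _ _ (k%:R * (A * t ^+ a) ^+ 2)).
    rewrite -[k in k%:R]card_ord -sum1_card natr_sum mulr_suml; apply: ler_sum => l _.
    rewrite mul1r; apply: lerXn2r; rewrite ?nnegrE ?cabs_ge0 ?mulr_ge0 ?(ltW A0) ?(ltW ta0)//.
    by apply: fz => j; apply: (squareS _ (zb j)); rewrite ler_wpM2r// ltW.
  by rewrite exprMn mulrA ler_wpM2r ?sqr_ge0// lerDl.
(* The lower bound [E] of the exponential is absorbed into the holomorphic function by its square
   root, so that after [polysquare_mean] only a pointwise comparison of integrands remains. *)
pose F2 z : R[i] := (Num.sqrt E)%:C * F (par d z).
have dF2 z : polysquare b rho z -> differentiable F2 z.
  move=> /zin/rP[_ dF _]; apply: differentiableM; first exact: differentiable_cst.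
  exact: dF.
have F2E z : cabs (F2 z) ^+ 2 = E * cabs (F (par d z)) ^+ 2.
  by rewrite /F2 cabsM exprMn cabs_real ger0_norm ?sqrtr_ge0// sqr_sqrtr.
have := polysquare_mean rho0 dF2; rewrite F2E => H.
have : ((rho / 4) ^+ (2 * n) * (E * cabs (F (par d b)) ^+ 2) <= I).
  rewrite -lee_fin IE; apply: (le_trans H); apply: le_cintegral => z.
    by apply: erestrict_ge0 => ? _; rewrite lee_fin sqr_ge0.
  rewrite /patch; case: ifPn => [|_]; last first.
    by case: ifP => // _; exact: g0.
  rewrite inE => zb; have [Vz _ _] := rP z (zin z zb).
  rewrite mem_set// /g /= F2E mulrC EFinM; apply: lee_wpmul2l.
    by rewrite lee_fin sqr_ge0.
  by apply: expeR_weight_ge; exact: psiW.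
apply: le_trans; rewrite /b crdK// Fq cabsM cabsX -/t.
have Klog (N : nat) (y : R) : 0 < y -> y ^+ N = expR (N%:R * ln y).
  by move=> y0; rewrite mulrC expRM_natr lnK ?posrE.
have -> : E = expR (- (m%:R * alpha * ln S1 + 2 * m%:R * B)) *
    expR (- (2 * a%:R * (m%:R * alpha) * ln t)).
  rewrite /E /W -expRD; congr expR; rewrite lnM ?posrE ?exprn_gt0//.
  by rewrite -exprM Klog// expRK natrM; field.
have -> : (rho / 4) ^+ (2 * n) = (e1 / 4) ^+ (2 * n) * expR (2 * a%:R * n%:R * ln t).
  have aE : (a * (2 * n))%:R = 2 * a%:R * n%:R :> R by rewrite !natrM; ring.
  by rewrite /rho mulrAC exprMn -exprM (Klog _ t t0) aE.
have -> : (t ^+ K * cabs (u q)) ^+ 2 = expR (2 * K%:R * ln t) * cabs (u q) ^+ 2.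
  by rewrite exprMn -exprM (Klog _ t t0) natrM [_ * 2]mulrC.
have -> : expR (la * ln t) = expR (- (2 * a%:R * (m%:R * alpha) * ln t)) *
   expR (2 * a%:R * n%:R * ln t) * expR (2 * K%:R * ln t).
  by rewrite -!expRD; congr expR; rewrite /la; ring.
have uq2 : (cabs (u p) / 2) ^+ 2 <= cabs (u q) ^+ 2.
  by apply: lerXn2r; rewrite ?nnegrE ?cabs_ge0// ltW.
rewrite /C0.
move: (expR_ge0 (- (m%:R * alpha * ln S1 + 2 * m%:R * B))).
move: (expR_ge0 (- (2 * a%:R * (m%:R * alpha) * ln t))).
move: (expR_ge0 (2 * a%:R * n%:R * ln t)) (expR_ge0 (2 * K%:R * ln t)).
have : 0 <= (e1 / 4) ^+ (2 * n) by rewrite exprn_ge0// divr_ge0// ltW.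
move: uq2; move: (expR _) (expR _) (expR _) (expR _) ((e1 / 4) ^+ _) => x1 x2 x3 x4 x5.
move: (_ ^+ 2) (_ ^+ 2) => y1 y2 y12 h5 h2 h3 h4 h1.
rewrite [leLHS](_ : _ = (x5 * x1 * x2 * x3 * x4) * y2); last by ring.
rewrite [leRHS](_ : _ = (x5 * x1 * x2 * x3 * x4) * y1); last by ring.
by rewrite ler_wpM2l// !mulr_ge0.
Unshelve. all: by end_near. Qed.

End upper_inclusion.

Lemma bounded_locally_integrable (R : realType) (n : nat) (M : complex_manifold R n)
    (x : M) (G : M -> \bar R) (K : R) : (forall y, 0 <= G y)%E ->
  (\forall y \near x, (G y <= K%:E)%E) -> locally_integrable_at G x.
Proof.
move=> G0 GK c cx; have [cx1 _] := cx.
have K0 : 0 <= K.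
  by have := nbhs_singleton GK; rewrite -lee_fin; apply: le_trans.
have : \forall z \near crd c x, (crd c @` dom c) z /\ (G (par c z) <= K%:E)%E.
  apply: filterS2 (near_crd cx1) (near_par cx1 GK) => z [cz E] Gz.
  by split=> //; exists (par c z).
move=> /nbhs_rV_cabs[r r0 rP].
pose P : set 'rV[R[i]]_n := [set z | forall j, cabs (z ord0 j - crd c x ord0 j) < r].
exists (P°); split.
- exact: open_interior.
- by apply/nbhs_rV_cabs; exists r.
- by move=> z /interior_subset /rP[].
- apply: (@cintegral_polysquare_le _ _ (crd c x) r K) => //.
  + exact: ltW.
  + by move=> z; apply: erestrict_ge0 => ? _ /=; exact: G0.
  + move=> z; rewrite /patch; case: ifPn => [|_]; last by case: ifP.
    rewrite inE => /interior_subset zP; rewrite mem_set; first by have [] := rP z zP.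
    by move=> j; apply: cabs_square; rewrite ltW.
Qed.

(** * Analytic weights under changes of trivialization *)

Section metric.
Variables (R : realType) (n : nat) (X : complex_manifold R n) (L : cocycle R X)
  (phi : weights L).
Hypotheses (lbL : is_line_bundle L) (metL : positive_singular_metric phi).

Lemma near_lb_dom (i : lb_idx L) x : lb_dom i x -> \forall y \near x, lb_dom i y.
Proof. by move=> ix; apply: open_nbhs_nbhs; split=> //; have [oL _ _ _] := lbL. Qed.

Lemma log_weight_sub (alpha s v r : R) :
  (log_weight alpha s v - r%:E)%E = log_weight alpha s (v - r).
Proof. by rewrite /log_weight -addeA -EFinB. Qed.

Lemma weight_change (i j : lb_idx L) y (alpha s v : R) : lb_dom i y -> lb_dom j y ->
  phi i y = log_weight alpha s v ->
  phi j y = log_weight alpha s (v - ln (cabs (lb_trans i j y))).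
Proof.
move=> iy jy pE; have [trans _ _] := metL; have [_ _ tr _] := lbL.
have [t0 _] := tr i j y iy jy.
have := trans i j y 1 iy jy; rewrite mulr1 cabs1 mul1e.
have -> : (cabs (lb_trans i j y))%:E = expeR (ln (cabs (lb_trans i j y)))%:E.
  by rewrite /= lnK// posrE cabs_gt0.
rewrite -expeRD => /expeR_inj E.
by rewrite -log_weight_sub -pE -[LHS]oppeK -E oppeD// oppeK addeC.
Qed.

Definition local_form (x : X) (psi : X -> \bar R) (alpha : R) (k : nat)
    (f : 'I_k -> X -> R[i]) (B : R) : Prop :=
  [/\ 0 <= alpha, forall l, holomorphic_germ x (f l) &
    \forall y \near x, exists2 v : R, `|v| <= B &
      psi y = log_weight alpha (\sum_(l < k) cabs (f l y) ^+ 2) v].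

(** Only the bounded term changes, by the logarithm of the modulus of a transition function, which
    is continuous near [x] as that function has no zero. *)
Lemma local_form_change (i j : lb_idx L) x alpha k (f : 'I_k -> X -> R[i]) B :
  lb_dom i x -> lb_dom j x -> local_form x (phi i) alpha f B ->
  exists B', local_form x (phi j) alpha f B'.
Proof.
move=> ix jx [a0 hf pE]; have [_ _ tr _] := lbL; have [t0 ht] := tr i j x ix jx.
have ct : {for x, continuous (fun y => ln (cabs (lb_trans i j y)))}.
  apply: (@continuous_comp _ _ _ (fun y => cabs (lb_trans i j y))).
    apply: (continuous_comp (holomorphic_at_continuous ht)).
    exact: continuous_cabs.
  by apply: continuous_ln; rewrite cabs_gt0.
pose b := ln (cabs (lb_trans i j x)).
exists (B + (`|b| + 1)); split=> //.
move/cvgrPdist_lt/(_ _ ltr01) : ct => ct.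
have idom := near_lb_dom ix; have jdom := near_lb_dom jx.
near=> y; have [v vB pv] : exists2 v : R, `|v| <= B &
    phi i y = log_weight alpha (\sum_(l < k) cabs (f l y) ^+ 2) v by near: y.
exists (v - ln (cabs (lb_trans i j y))).
  rewrite (le_trans (ler_normB _ _))// lerD//.
  rewrite -(subrK b (ln _)) (le_trans (ler_normD _ _))// addrC lerD2l distrC ltW//.
  by near: y.
by apply: weight_change => //; near: y.
Unshelve. all: by end_near. Qed.

Lemma analytic_local_form (i : lb_idx L) x : analytic_singularities phi -> lb_dom i x ->
  exists alpha k (f : 'I_k -> X -> R[i]) B, local_form x (phi i) alpha f B.
Proof.
move=> an ix; have [V [alpha [k [f [v [[oV Vx] [Vi a0] hf [B vB] pE]]]]]] := an i x ix.
have nV : nbhs x V by apply: open_nbhs_nbhs.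
exists alpha, k, f, B; split=> //.
  by move=> l; apply: filterS nV => y; exact: hf.
by apply: filterS nV => y Vy; exists (v y); [exact: vB|exact: pE].
Qed.

End metric.

(** * Charts in which a curve is the first coordinate axis *)

Definition axis_charts (R : realType) (n : nat) (X : complex_manifold R n)
    (S : complex_manifold R 1) (e : S -> X) (p : S) (c : chart R S 1) (d : chart R X n) : Prop :=
  [/\ chart_at p c, chart_at (e p) d & forall q, dom c q -> dom d (e q) /\
    crd d (e q) = \row_(j < n) (if val j == 0%N then crd c q ord0 ord0 else 0)].

Section axis.
Variables (R : realType) (n : nat) (X : complex_manifold R n) (S : complex_manifold R 1)
  (e : S -> X).
Implicit Types (p : S) (c : chart R S 1) (d : chart R X n).

Lemma axis_continuous p c d : axis_charts e p c d -> {for p, continuous e}.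
Proof.
move=> [cp dp ax] A eA; have [cp1 _] := cp; have [dp1 _] := dp.
have [r r0 rP] := (nbhs_rV_cabs _ _).1 (near_par dp1 eA).
have [_ axp] := ax p cp1.
apply: filterS2 (near_dom cp1) (near_lcoord cp r0) => q cq tq.
have [deq axq] := ax q cq; rewrite /preimage /= -(crdK deq); apply: rP => j.
by rewrite axq axp !mxE; case: ifP => _ //; rewrite subrr cabs0.
Qed.

Lemma axis_charts_near p c d : axis_charts e p c d -> \forall q \near p, axis_charts e q c d.
Proof.
move=> axp; have ce := axis_continuous axp; move: axp => [cp dp ax].
apply: filterS2 (chart_at_near cp) (ce _ (chart_at_near dp)) => q cq dq.
by split.
Qed.

Lemma axis_differentiable p c d : axis_charts e p c d ->
  differentiable (crd d \o e \o par c) (crd c p).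
Proof.
move=> [cp dp ax]; have [cp1 _] := cp.
have h : differentiable (fun z : 'rV[R[i]]_1 =>
    \row_(j < n) (if val j == 0%N then z ord0 ord0 else 0) : 'rV[R[i]]_n) (crd c p).
  apply: differentiable_rV => j; under eq_fun do rewrite mxE.
  case: (val j == 0%N); last exact: differentiable_cst.
  exact: differentiable_coord.
apply: near_eq_differentiable h; apply: filterS (near_crd cp1) => z [cz E].
by have [_ /= ->] := ax _ cz; rewrite E.
Qed.

Lemma axis_holomorphic_at p c d (f : X -> R[i]) : axis_charts e p c d ->
  holomorphic_at f (e p) -> holomorphic_at (f \o e) p.
Proof.
move=> axp; have := axis_differentiable axp; have := axis_continuous axp.
by case: axp => cp dp _ ce de; exact: holomorphic_at_comp cp dp ce de.
Qed.

Lemma axis_germ p c d (f : X -> R[i]) : axis_charts e p c d ->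
  holomorphic_germ (e p) f -> holomorphic_germ p (f \o e).
Proof.
move=> axp hf; apply: filterS2 (axis_charts_near axp) (axis_continuous axp hf) => q.
exact: axis_holomorphic_at.
Qed.

End axis.

(** Lets the results on [axis_charts] apply to the pulled-back metric, by taking the curve itself,
    of dimension 1, as ambient manifold. *)
Lemma axis_charts_id (R : realType) (S : complex_manifold R 1) (p : S) c :
  chart_at p c -> axis_charts (@id S) p c c.
Proof.
move=> cp; split=> // q cq; split=> //.
by apply/rowP => j; rewrite mxE !ord1.
Qed.

Lemma lcoord_neq0 (R : realType) (S : complex_manifold R 1) (p q : S) c :
  dom c p -> dom c q -> q <> p -> lcoord p c q != 0.
Proof.
move=> cp cq qp; apply/eqP => /eqP; rewrite subr_eq0 => /eqP E; apply: qp.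
by rewrite -(crdK cp) -(crdK cq); congr par; apply/rowP => j; rewrite !ord1.
Qed.

(* Positive even when [m alpha = 0], so that [S ^+ ceil_mult m alpha] vanishes
   where [S] does and offsets the weight [-oo] of [log_weight] there. *)
Definition ceil_mult (R : realType) (m : nat) (alpha : R) : nat :=
  (Num.truncn (m%:R * alpha)).+1.

Lemma ceil_mult_bounds (R : realType) (m : nat) (alpha : R) : 0 <= alpha ->
  m%:R * alpha <= (ceil_mult m alpha)%:R <= m%:R * alpha + 1.
Proof.
move=> a0; have ma0 : 0 <= m%:R * alpha by rewrite mulr_ge0.
have /andP[h1 h2] := truncn_itv ma0.
by rewrite /ceil_mult (ltW h2) -natr1 lerD2r.
Qed.

Section order_of_multiplier.
Variables (R : realType) (n : nat) (M : complex_manifold R n) (S : complex_manifold R 1)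
  (e : S -> M) (p : S) (c : chart R S 1) (d : chart R M n).
Hypothesis axp : axis_charts e p c d.

(** [order_lower_bound] gives [a * m alpha - a * n] as a lower bound of the order;
    [ceil_mult m alpha] exceeds [m alpha] by at most 1, which costs one more [a]. *)
Lemma multiplier_vanishes_to (psi : M -> \bar R) alpha k (f : 'I_k -> M -> R[i]) B a m
    (F : M -> R[i]) :
  local_form (e p) psi alpha f B -> (forall l, vanishes_to p c (f l \o e) a) ->
  holomorphic_germ (e p) F ->
  locally_integrable_at (fun y => ((cabs (F y) ^+ 2)%:E *
    expeR (- (2%:E * (m%:R%:E * psi y))))%E) (e p) ->
  vanishes_to p c (F \o e) (a * ceil_mult m alpha - a * n.+1).
Proof.
move=> [a0 hf pE] fa hF intF; have [cp dp ax] := axp; have [cp1 _] := cp.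
have [F0|[K [u [hu u0 Fu]]]] := curve_order cp (axis_germ axp hF).
  by exists 0; apply: filterS F0 => q ->; rewrite cabs0 mul0r.
have cu := holomorphic_at_continuous (germ_at hu).
have axn : \forall q \near p, dom d (e q) /\
    crd d (e q) = \row_(j < n) (if val j == 0%N then crd c q ord0 ord0 else 0).
  by apply: filterS (near_dom cp1) => q; exact: ax.
have H := order_lower_bound cp dp axn a0 hf pE fa hF intF cu u0 Fu.
apply: (@order_vanishes_to _ _ _ _ cp (F \o e) u _ K cu _ Fu).
rewrite leq_subLR addnC -(ler_nat R) natrD !natrM -[n.+1%:R]natr1 mulrDr mulr1.
have /andP[_ h2] := ceil_mult_bounds m a0.
have := ler_wpM2l (ler0n R a) h2; rewrite mulrDr mulr1.
by move: H; lra.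
Qed.

End order_of_multiplier.

(** * Local orders of the weights along the curve *)

Section good_points.
Variables (R : realType) (n : nat) (X : complex_manifold R n) (L : cocycle R X)
  (phi : weights L) (S : complex_manifold R 1) (e : S -> X).
Hypotheses (lbL : is_line_bundle L) (metL : positive_singular_metric phi)
  (anL : analytic_singularities phi).

(* Up to bounded terms, the weights pull back along [e] to [alpha * a * log |t|],
   with [t] the coordinate centered at [p]. *)
Definition good (p : S) (c : chart R S 1) (a : nat) (alpha : R) : Prop :=
  exists (i : lb_idx L) (k : nat) (f : 'I_k -> X -> R[i]) (B : R) (u : S -> R[i]) (l0 : 'I_k),
  [/\ lb_dom i (e p), local_form (e p) (phi i) alpha f B,
      forall l, vanishes_to p c (f l \o e) a,
      holomorphic_germ p u /\ u p != 0 &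
      \forall q \near p, f l0 (e q) = lcoord p c q ^+ a * u q].

Definition bad (p : S) : Prop := exists i : lb_idx L,
  lb_dom i (e p) /\ \forall q \near p, phi i (e q) = -oo%E.

(** For positive [alpha], [a] is the least order along the curve of those [f_l] that do not vanish
    identically on it near [p]; if all of them do, the weight is [-oo] there. *)
Lemma good_or_bad p c d : axis_charts e p c d -> (exists a alpha, good p c a alpha) \/ bad p.
Proof.
move=> axp; have [cp _ _] := axp; have [_ cov _ _] := lbL; have [i ip] := cov (e p).
have [alpha [k [f [B lf]]]] := analytic_local_form anL ip.
have [a0 hf pE] := lf; have [al0|aln0] := eqVneq alpha 0.
  (* For [alpha = 0] the logarithmic term is zero whatever the [f_l], even at their common zeros
     since [0 * -oo = 0]; a single constant function 1 may replace them. *)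
  left; exists 0%N, alpha, i, 1%N, (fun _ _ => 1), B, (fun=> 1), ord0; split=> //.
  - split=> //; first by move=> l; near=> y; exact: holomorphic_at_cst.
    apply: filterS pE => y [v vB pv]; exists v => //.
    by rewrite pv /log_weight al0 mul0r !mul0e.
  - by move=> l; apply: vanishes_to0; exact: cst_continuous.
  - by split; [near=> q; exact: holomorphic_at_cst|exact: oner_neq0].
  - by near=> q; rewrite expr0 mulr1.
have hfe l : holomorphic_germ p (f l \o e) by apply: axis_germ axp (hf l).
pose P a := `[< exists (l : 'I_k) (u : S -> R[i]), [/\ holomorphic_germ p u, u p != 0 &
  \forall q \near p, f l (e q) = lcoord p c q ^+ a * u q] >].
have [exP|nP] := pselect (exists a, P a); last first.
  right; exists i; split=> //.
  have f0 l : \forall q \near p, f l (e q) = 0.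
    have [//|[a [u H]]] := curve_order cp (hfe l).
    by exfalso; apply: nP; exists a; apply/asboolP; exists l, u.
  have ce := axis_continuous axp.
  apply: filterS2 (near_forall_fin f0) (ce _ pE) => q fq /= [v _ ->].
  rewrite /log_weight big1 => [|l _]; last by rewrite fq cabs0 expr0n.
  rewrite le0_lneNy// gt0_muleNy ?addNye// lte_fin divr_gt0//.
  by rewrite lt_neqAle eq_sym aln0.
left; pose a := ex_minn exP.
have [/asboolP[l0 [u [hu u0 fu]]] amin] : P a /\ forall b, P b -> (a <= b)%N.
  by rewrite /a; case: ex_minnP.
exists a, alpha, i, k, f, B, u, l0; split=> //.
move=> l; have [f0|[b [w [hw w0 fw]]]] := curve_order cp (hfe l).
  by exists 0; apply: filterS f0 => q ->; rewrite cabs0 mul0r.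
apply: (@order_vanishes_to _ _ _ _ cp _ w _ b) => //.
  exact: holomorphic_at_continuous (germ_at hw).
by apply: amin; apply/asboolP; exists l, w.
Unshelve. all: by end_near. Qed.

(** Near [p] but off [p], [f l0] is nonzero on the curve by its factorization. The same local form
    then serves at [q], with order 0 and [f l0] itself as unit. *)
Lemma good_near p c d a alpha : axis_charts e p c d -> good p c a alpha ->
  \forall q \near p, q <> p -> forall c', chart_at q c' -> good q c' 0 alpha.
Proof.
move=> axp [i [k [f [B [u [l0 [ip [a0 hf pE] fa [hu u0] fu]]]]]]].
have [cp _ _] := axp; have [cp1 _] := cp; have ce := axis_continuous axp.
have cu := holomorphic_at_continuous (germ_at hu).
have hfn : \forall q \near p, forall l, holomorphic_germ (e q) (f l).
  apply: near_forall_fin => l.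
  have H : \forall y \near e p, holomorphic_germ y (f l).
    by have := hf l; rewrite /holomorphic_germ -near_simpl => /near_join.
  exact: ce _ H.
have pEn : \forall q \near p, \forall y \near e q, exists2 v : R, `|v| <= B &
      phi i y = log_weight alpha (\sum_(l < k) cabs (f l y) ^+ 2) v.
  have H : \forall x \near e p, \forall y \near x, exists2 v : R, `|v| <= B &
      phi i y = log_weight alpha (\sum_(l < k) cabs (f l y) ^+ 2) v.
    by move: pE; rewrite -near_simpl => /near_join.
  exact: ce _ H.
have idom := ce _ (near_lb_dom lbL ip).
have un : \forall q \near p, u q != 0.
  apply: filterS (near_bounded_below cu u0) => q uq.
  by rewrite -cabs_gt0 (lt_le_trans _ uq)// divr_gt0 ?cabs_gt0.
near=> q; move=> qp c' cq'.
have axq : axis_charts e q c d by near: q; exact: axis_charts_near.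
have hfq l : holomorphic_germ (e q) (f l) by move: l; near: q.
exists i, k, f, B, (f l0 \o e), l0; split.
- by near: q.
- by split=> //; near: q.
- move=> l; apply: vanishes_to0; apply: holomorphic_at_continuous.
  by apply: germ_at; exact: axis_germ axq (hfq l).
- split; first exact: axis_germ axq (hfq l0).
  have fqE : f l0 (e q) = lcoord p c q ^+ a * u q by near: q.
  rewrite /= fqE mulf_neq0//; last by near: q.
  rewrite expf_neq0//; apply: lcoord_neq0 => //.
  by near: q; exact: near_dom.
- by near=> q'; rewrite expr0 mul1r.
Unshelve. all: by end_near. Qed.

Lemma bad_phi p j : bad p -> lb_dom j (e p) -> phi j (e p) = -oo%E.
Proof.
move=> [i [ip pi]] jp; have pip := nbhs_singleton pi; rewrite /= in pip.
(* The value [-oo] is presented as the weight with [alpha = 1] and zero sum, to which a change of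
   trivialization applies. *)
have := @weight_change _ _ _ _ _ lbL metL i j (e p) 1 0 0 ip jp.
rewrite /log_weight le0_lneNy// gt0_muleNy ?lte_fin ?divr_gt0// !addNye.
by apply.
Qed.

(** At nearby points other than [p] the local form is finite, while a bad weight is [-oo]; two
    trivializations differ there by a finite logarithm. *)
Lemma good_not_bad p c d a alpha : axis_charts e p c d -> good p c a alpha -> ~ bad p.
Proof.
move=> axp [i [k [f [B [u [l0 [ip [a0 hf pE] fa [hu u0] fu]]]]]]] [j [jp pj]].
have [cp _ _] := axp; have ce := axis_continuous axp.
have cu := holomorphic_at_continuous (germ_at hu).
have idom := ce _ (near_lb_dom lbL ip); have jdom := ce _ (near_lb_dom lbL jp).
have pE' := ce _ pE.
have H : \forall q \near p, [/\ lb_dom i (e q) /\ lb_dom j (e q),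
    phi j (e q) = -oo%E, exists2 v : R, `|v| <= B &
      phi i (e q) = log_weight alpha (\sum_(l < k) cabs (f l (e q)) ^+ 2) v,
    f l0 (e q) = lcoord p c q ^+ a * u q & cabs (u p) / 2 <= cabs (u q)].
  near=> q; split; [split| | | |]; near: q => //.
  exact: near_bounded_below.
have [q [[[iq jq] pjq [v vB piq] fq uq] tq _]] := curve_near_neq cp H ltr01.
have := weight_change lbL metL iq jq piq; rewrite pjq /log_weight.
rewrite lne_EFin//.
apply: (@lt_le_trans _ _ (cabs (f l0 (e q)) ^+ 2)); last first.
  by rewrite (bigD1 l0)//= lerDl sumr_ge0// => l _; rewrite sqr_ge0.
rewrite exprn_gt0// fq cabsM cabsX mulr_gt0 ?exprn_gt0// (lt_le_trans _ uq)//.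
by rewrite divr_gt0 ?cabs_gt0.
Unshelve. all: by end_near. Qed.

Lemma bad_near p : (exists c d, axis_charts e p c d) -> bad p -> \forall q \near p, bad q.
Proof.
move=> [c [d axp]] [i [ip pi]]; have ce := axis_continuous axp.
have idom : \forall q \near p, lb_dom i (e q) by exact: ce _ (near_lb_dom lbL ip).
move: pi; rewrite -near_simpl => /near_join pi.
by near=> q; exists i; split; near: q.
Unshelve. all: by end_near. Qed.

End good_points.

Section multiplier_membership.
Variables (R : realType) (n : nat) (X : complex_manifold R n) (L : cocycle R X)
  (phi : weights L).
Hypotheses (lbL : is_line_bundle L) (metL : positive_singular_metric phi).

(** The map [F] is left general to cover both ideals: [F = e] for the metric pulled back to the
    curve, [F = id] for the metric on [X]. *)
Lemma multiplier_of_bound (n' : nat) (M : complex_manifold R n') (F : M -> X) (p : M)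
    (i : lb_idx L) alpha k (f : 'I_k -> X -> R[i]) B (m : nat) (K0 : R) (G : M -> R[i]) :
  {for p, continuous F} -> lb_dom i (F p) -> local_form (F p) (phi i) alpha f B ->
  holomorphic_germ p G -> 0 <= K0 ->
  (\forall q \near p, cabs (G q) ^+ 2 <=
    K0 * (\sum_(l < k) cabs (f l (F q)) ^+ 2) ^+ ceil_mult m alpha) ->
  multiplier_ideal (weights_pow (weights_pull F phi) m) p G.
Proof.
move=> cF ip lf hG K00 GK; split=> // j jp.
have [B' [a0 hf pE]] := local_form_change lbL metL ip jp lf.
pose S0 : R := \sum_(l < k) (cabs (f l (F p)) + 1) ^+ 2.
have SS0 : \forall y \near F p, \sum_(l < k) cabs (f l y) ^+ 2 <= S0.
  have : \forall y \near F p, forall l : 'I_k, cabs (f l y) <= cabs (f l (F p)) + 1.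
    apply: near_forall_fin => l.
    have /cvg_cabsP/(_ _ ltr01) := holomorphic_at_continuous (nbhs_singleton (hf l)).
    apply: filterS => y fy.
    by rewrite -(subrK (f l (F p)) (f l y)) (le_trans (cabs_leD _ _))// addrC lerD2l ltW.
  apply: filterS => y fy; apply: ler_sum => l _.
  by rewrite lerXn2r ?nnegrE ?cabs_ge0// (le_trans (cabs_ge0 _) (fy l)).
have /andP[mM _] := ceil_mult_bounds m a0.
have [K K1 KP] := @weight_upper R m (ceil_mult m alpha) alpha S0 B' K0 a0 mM (ltn0Sn _) K00.
apply: (@bounded_locally_integrable _ _ _ _ _ K).
  by move=> y; rewrite mule_ge0 ?expeR_ge0// lee_fin sqr_ge0.
apply: filterS3 GK (cF _ SS0) (cF _ pE) => q Gq Sq [v vB pv].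
rewrite /weights_pow /weights_pull [phi j (F q)]pv; apply: KP => //.
  apply/andP; split; last exact: Sq.
  by rewrite sumr_ge0// => l _; rewrite sqr_ge0.
by rewrite sqr_ge0.
Qed.

Variables (S : complex_manifold R 1) (e : S -> X) (p : S) (c : chart R S 1)
  (d : chart R X n) (a : nat) (alpha : R).
Hypotheses (axp : axis_charts e p c d) (gp : good phi e p c a alpha).

Lemma vanishes_to_multiplier (m : nat) (g : S -> R[i]) : holomorphic_germ p g ->
  vanishes_to p c g (a * ceil_mult m alpha) ->
  multiplier_ideal (weights_pow (weights_pull e phi) m) p g.
Proof.
move=> hg [A gA].
have [i [k [f [B [u [l0 [ip lf fa [hu u0] fu]]]]]]] := gp.
have [cp _ _] := axp.
have cu := holomorphic_at_continuous (germ_at hu).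
set M := ceil_mult m alpha in gA *.
pose b : R := cabs (u p) / 2.
have b0 : 0 < b by rewrite divr_gt0 ?cabs_gt0.
(* Near [p], [|g|^2] is at most [A^2 |t|^(2 a M)], and the sum of the [|f_l|^2] is at least
   [b^2 |t|^(2 a)] because of [f l0] alone; the constant is the quotient after raising the latter to
   the power [M]. *)
apply: (@multiplier_of_bound _ _ _ p i alpha k f B m (A ^+ 2 / b ^+ (2 * M))) => //.
- exact: axis_continuous axp.
- by rewrite divr_ge0 ?sqr_ge0// exprn_ge0// ltW.
have bu : \forall q \near p, b <= cabs (u q) by exact: near_bounded_below.
apply: filterS3 gA fu bu => q gq fq uq.
set t := cabs (lcoord p c q) in gq *.
have t0 : 0 <= t by exact: cabs_ge0.
have g2 : cabs (g q) ^+ 2 <= A ^+ 2 * t ^+ (2 * (a * M)).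
  rewrite mulnC exprM -exprMn lerXn2r ?nnegrE ?cabs_ge0//.
  exact: le_trans (cabs_ge0 _) gq.
have fS : (b * t ^+ a) ^+ 2 <= \sum_(l < k) cabs (f l (e q)) ^+ 2.
  apply: (@le_trans _ _ (cabs (f l0 (e q)) ^+ 2)).
    have bta : 0 <= b * t ^+ a by rewrite mulr_ge0 ?exprn_ge0// ltW.
    rewrite lerXn2r// ?nnegrE ?cabs_ge0//.
    by rewrite fq cabsM cabsX mulrC ler_wpM2l// exprn_ge0.
  by rewrite (bigD1 l0)//= lerDl sumr_ge0// => l _; rewrite sqr_ge0.
apply: (le_trans g2); rewrite -mulrA ler_wpM2l ?sqr_ge0//.
rewrite mulrC ler_pdivlMr ?exprn_gt0// mulrC.
have bt0 : 0 <= (b * t ^+ a) ^+ 2 by rewrite sqr_ge0.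
apply: le_trans (lerXn2r M _ _ fS); rewrite ?nnegrE//; last exact: le_trans fS.
by rewrite -(exprM (b * t ^+ a) 2 M) (exprMn _ b) -(exprM t a (2 * M)) (mulnCA a).
Qed.

(** Writing [g] as [t^(a M) g1], with [M] the rounded exponent, and [f l0] as [t^a u] on the curve,
    one has [g = (g1 / u^M) f_l0^M]; the power of [f l0] lies in the ideal on [X], since [|f l0|^2]
    is one term of the sum of squares. *)
Lemma vanishes_to_restricted (m : nat) (g : S -> R[i]) : holomorphic_germ p g ->
  vanishes_to p c g (a * ceil_mult m alpha) ->
  restricted_ideal e (multiplier_ideal (weights_pow phi m)) p g.
Proof.
move=> hg vg; have [cp _ _] := axp.
have [i [k [f [B [u [l0 [ip lf fa [hu u0] fu]]]]]]] := gp.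
have [g1 [hg1 gE]] := curve_division cp hg vg.
have un : \forall q \near p, u q != 0.
  have cu := holomorphic_at_continuous (germ_at hu).
  apply: filterS (near_bounded_below cu u0) => q uq.
  by rewrite -cabs_gt0 (lt_le_trans _ uq)// divr_gt0 ?cabs_gt0.
pose M := ceil_mult m alpha.
exists 1%N, (fun _ q => g1 q * (u q ^+ M)^-1), (fun _ y => f l0 y ^+ M); split.
- move=> _; apply: filterS3 hg1 hu un => q g1q uq uq0.
  apply: holomorphic_atM; first exact: g1q.
  apply: holomorphic_atV; first by rewrite expf_neq0.
  exact: holomorphic_atX.
- move=> _; have [_ hf _] := lf.
  apply: (@multiplier_of_bound _ _ id (e p) i alpha k f B m 1
    (fun y => f l0 y ^+ M) _ ip lf _ ler01).
  - exact: cvg_id.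
  - by apply: filterS (hf l0) => y; exact: holomorphic_atX.
  near=> y; rewrite mul1r cabsX exprAC lerXn2r ?nnegrE ?sqr_ge0 ?sumr_ge0//.
  by move=> l _; rewrite sqr_ge0.
  by rewrite (bigD1 l0)//= lerDl sumr_ge0// => l _; rewrite sqr_ge0.
- apply: filterS3 gE fu un => q -> fq uq; rewrite big_ord1 fq exprMn -exprM.
  by rewrite mulrACA mulVf ?expf_neq0// mulr1 mulrC.
Unshelve. all: by end_near. Qed.

Lemma restricted_vanishes_to (m : nat) (g : S -> R[i]) :
  restricted_ideal e (multiplier_ideal (weights_pow phi m)) p g ->
  vanishes_to p c g (a * ceil_mult m alpha - a * n.+2).
Proof.
have [i [k [f [B [u [l0 [ip lf fa _ _]]]]]]] := gp; have [cp _ _] := axp.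
move=> [r [b [h [hb Jh gE]]]].
(* The estimate on [X] gives [n.+1]; it is weakened to the value [n.+2] that also suits the
   pulled-back metric when [n = 0]. *)
apply: (@vanishes_to_le _ _ _ _ cp _ (a * ceil_mult m alpha - a * n.+1)).
  by rewrite leq_sub2l// leq_mul2l leqnSn orbT.
have gE' : \forall q \near p, \sum_(l < r) b l q * h l (e q) = g q.
  by apply: filterS gE => q ->.
apply: vanishes_to_near_eq gE' _; apply: vanishes_to_sum => // l.
apply: vanishes_toM; first exact: holomorphic_at_continuous (germ_at (hb l)).
have [hh inth] := Jh l.
exact: multiplier_vanishes_to axp _ _ _ _ _ _ _ _ lf fa hh (inth i ip).
Qed.

(** This is the estimate of [multiplier_vanishes_to] for the identity of the curve, in dimension 1:
    the loss is [a * 2]. *)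
Lemma multiplier_pull_vanishes_to (m : nat) (g : S -> R[i]) :
  multiplier_ideal (weights_pow (weights_pull e phi) m) p g ->
  vanishes_to p c g (a * ceil_mult m alpha - a * n.+2).
Proof.
have [i [k [f [B [u [l0 [ip [a0 hf pE] fa _ _]]]]]]] := gp; have [cp _ _] := axp.
move=> [hg intg].
apply: (@vanishes_to_le _ _ _ _ cp _ (a * ceil_mult m alpha - a * 2)).
  by rewrite leq_sub2l// leq_mul2l !ltnS orbT.
apply: (multiplier_vanishes_to (axis_charts_id cp) (psi := phi i \o e) (f := fun l => f l \o e)
  (B := B)) => //; last exact: intg i ip.
split=> //; first by move=> l; exact: axis_germ axp (hf l).
exact: axis_continuous axp _ pE.
Qed.

End multiplier_membership.

(** Each point has a neighbourhood in which it is the only possible exception. Compactness is used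
    in its near-covering form, along the filter of lists that contain a given list, and so yields
    one list for all points. *)
Lemma compact_finite_exceptions (T : topologicalType) (Q : T -> Prop) :
  compact [set: T] -> (forall p, \forall q \near p, q <> p -> Q q) ->
  exists s : seq T, forall q, q \notin s -> Q q.
Proof.
move=> /compact_near_coveringP cT H.
pose B (s0 : seq T) := [set s : seq T | {subset s0 <= s}].
have FF : Filter (filter_from [set: seq T] B).
  apply: filter_fromT_filter; first by exists [::].
  move=> s1 s2; exists (s1 ++ s2) => s ss; split=> x xs; apply: ss.
    by rewrite mem_cat xs.
  by rewrite mem_cat xs orbT.
have [|s _ sP] := cT _ _ (fun (s : seq T) q => q \notin s -> Q q) FF.
  move=> p _; exists ([set q | q <> p -> Q q], B [:: p]) => //=.
    by split; [exact: H|exists [:: p]].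
  move=> [q s] /= [qQ ps] qs; apply: qQ => qp; move: qs.
  by rewrite qp ps// mem_head.
by exists s => q; apply: (sP s).
Qed.

Section all_points_good.
Variables (R : realType) (n : nat) (X : complex_manifold R n) (L : cocycle R X)
  (phi : weights L) (S : complex_manifold R 1) (e : S -> X).
Hypotheses (lbL : is_line_bundle L) (metL : positive_singular_metric phi)
  (anL : analytic_singularities phi).
Hypotheses (compS : compact [set: S]) (connS : connected [set: S])
  (axS : forall p, exists c d, axis_charts e p c d)
  (finS : weights_not_minus_infty_on phi (range e)).

(** The bad points form an open set; so do the others, which are good, as are all points near them.
    One bad point would make the whole connected curve bad, against [finS]. *)
Lemma not_bad p : ~ bad phi e p.
Proof.
have near_not_bad q : ~ bad phi e q -> \forall q' \near q, ~ bad phi e q'.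
  move=> nb; have [c [d axq]] := axS q.
  have [[a [alpha gq]]|//] := good_or_bad lbL anL axq.
  apply: filterS (good_near lbL axq gq) => q' H.
  have [->//|/eqP /H H'] := eqVneq q' q.
  have [c' [d' axq']] := axS q'; have [cq' _ _] := axq'.
  by have := good_not_bad lbL metL axq' (H' _ cq').
move=> bp; have bT : bad phi e = [set: S].
  apply: connS; first by exists p.
    exists (bad phi e); last by rewrite setTI.
    by rewrite openE => q bq; apply: bad_near => //; exact: axS.
  exists (bad phi e); last by rewrite setTI.
  rewrite -[X in closed X]setCK; apply: open_closedC.
  by rewrite openE => q; exact: near_not_bad.
have [i [_ [[q _ <-] iq]]] := finS; apply.
have bq : bad phi e q by rewrite bT.
exact: (bad_phi lbL metL bq iq).
Qed.

(** The data depend on the point but not on [m], which is what makes the later error term uniform.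
    Outside the finite list any chart will do, with order 0. *)
Lemma local_orders : exists (s : seq S) (ch : S -> chart R S 1) (a : S -> nat) (alpha : S -> R),
  forall p, [/\ exists d, axis_charts e p (ch p) d,
    good phi e p (ch p) (a p) (alpha p) & p \notin s -> a p = 0%N].
Proof.
have [s sP] : exists s : seq S, forall q, q \notin s ->
    exists alpha, forall c, chart_at q c -> good phi e q c 0 alpha.
  apply: compact_finite_exceptions => // p; have [c [d axp]] := axS p.
  have [[a [alpha gp]]|/not_bad//] := good_or_bad lbL anL axp.
  by apply: filterS (good_near lbL axp gp) => q H /H; exists alpha.
have /choice[x xP] : forall p, exists x : chart R S 1 * nat * R,
    [/\ exists d, axis_charts e p x.1.1 d, good phi e p x.1.1 x.1.2 x.2 & 
        p \notin s -> x.1.2 = 0%N].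
  move=> p; have [c [d axp]] := axS p; have [cp _ _] := axp.
  have [ps|/sP[alpha H]] := boolP (p \in s).
    have [[a [alpha gp]]|/not_bad//] := good_or_bad lbL anL axp.
    by exists (c, a, alpha); split=> //; exists d.
  by exists (c, 0%N, alpha); split=> //; [exists d|exact: H].
by exists s, (fun p => (x p).1.1), (fun p => (x p).1.2), (fun p => (x p).2).
Qed.

End all_points_good.

(** * Comparison of sections *)

Section compare_sections.
Variables (R : realType) (S : complex_manifold R 1) (L : cocycle R S)
  (J J' : ideal_sheaf R S).
Hypothesis lbL : is_line_bundle L.
Variables (s : seq S) (ch : S -> chart R S 1) (N : S -> nat) (D : nat).
Hypotheses (chP : forall p, chart_at p (ch p)) (N0 : forall p, p \notin s -> N p = 0%N)
  (J_sub : forall p f, J p f -> vanishes_to p (ch p) f (N p - D))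
  (sub_J' : forall p f, holomorphic_germ p f -> vanishes_to p (ch p) f (N p) -> J' p f).

Lemma section_germ (K : ideal_sheaf R S) (t : lb_idx L -> S -> R[i]) i x :
  is_section K t -> lb_dom i x -> holomorphic_germ x (t i).
Proof.
by move=> [ht _ _] ix; apply: filterS (near_lb_dom lbL ix) => y; exact: ht.
Qed.

(** Once the combined Taylor coefficients vanish at the points of [s], the order there rises from
    [N p - D] to at least [N p]. The coefficients are taken in one trivialization per point; another
    one only multiplies by a holomorphic function. *)
Lemma combination_section (k : nat) (sec : 'I_k -> lb_idx L -> S -> R[i])
    (b : 'I_k -> R[i]) (ix : S -> lb_idx L) (a : S -> 'I_k -> nat -> R[i]) :
  (forall l, is_section J (sec l)) -> (forall p, lb_dom (ix p) p) ->
  (forall p l, vanishes_to p (ch p)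
    (fun q => sec l (ix p) q - \sum_(j < D) a p l j * lcoord p (ch p) q ^+ (N p - D + j))
    (N p - D + D)) ->
  (forall p (j : 'I_D), p \in s -> \sum_(l < k) b l * a p l j = 0) ->
  is_section J' (fun i x => \sum_(l < k) b l * sec l i x).
Proof.
move=> secJ ixP aP ba; have [_ _ tr _] := lbL.
have hol i x : lb_dom i x -> holomorphic_at (fun y => \sum_(l < k) b l * sec l i y) x.
  move=> xi; apply: holomorphic_at_sum => l; apply: holomorphic_atM.
    exact: holomorphic_at_cst.
  by have [h _ _] := secJ l; exact: h.
have nd := near_lb_dom lbL.
split=> //.
  move=> i j x xi xj; rewrite mulr_sumr; apply: eq_bigr => l _.
  by have [_ h _] := secJ l; rewrite (h i j)// mulrCA.
move=> i x xi; apply: sub_J'; first by apply: filterS (nd _ _ xi); exact: hol.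
have [xs|/N0 ->] := boolP (x \in s); last first.
  by apply: vanishes_to0; apply: holomorphic_at_continuous; exact: hol.
have [_ ht] := tr _ _ _ xi (ixP x).
apply: (@vanishes_to_near_eq _ _ _ _
  (fun y => lb_trans i (ix x) y * \sum_(l < k) b l * sec l (ix x) y)).
  apply: filterS2 (nd _ _ xi) (nd _ _ (ixP x)) => y yi yx; rewrite mulr_sumr.
  by apply: eq_bigr => l _; have [_ h _] := secJ l; rewrite (h i (ix x))// mulrCA.
apply: vanishes_toM; first exact: holomorphic_at_continuous.
(* Subtraction is truncated, so [N x - D + D] may exceed [N x]. *)
apply: (@vanishes_to_le _ _ _ _ _ _ (N x - D + D)) => //.
  by rewrite addnC -leq_subLR.
apply: (@vanishes_to_near_eq _ _ _ _ (fun y => \sum_(l < k) b l * (sec l (ix x) y -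
  \sum_(j < D) a x l j * lcoord x (ch x) y ^+ (N x - D + j)))).
  near=> y; under eq_bigr do rewrite mulrBr mulr_sumr.
  rewrite sumrB exchange_big/= [X in _ - X]big1 ?subr0// => j _.
  by under eq_bigr do rewrite mulrA; rewrite -mulr_suml ba// mul0r.
apply: vanishes_to_sum => // l; apply: vanishes_toM; first exact: cst_continuous.
exact: aP.
Unshelve. all: by end_near. Qed.

(* A section of [J] is one of [J'] as soon as its [D] Taylor coefficients from order
   [N p - D] on vanish at each [p] of [s]: these are [size s * D] linear conditions. *)
Lemma h0_le : (h0 L J <= h0 L J' + (size s * D)%:R%:E)%E.
Proof.
apply: ge_ereal_sup => _ [k [sec [secJ indep]] <-].
have [_ cov _ _] := lbL; have /choice[ix ixP] := cov.
have /choice[a aP] : forall p, exists a : 'I_k -> nat -> R[i], forall l,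
    vanishes_to p (ch p) (fun q => sec l (ix p) q -
      \sum_(j < D) a l j * lcoord p (ch p) q ^+ (N p - D + j)) (N p - D + D).
  move=> p; pose P l (al : nat -> R[i]) := vanishes_to p (ch p) (fun q => sec l (ix p) q -
      \sum_(j < D) al j * lcoord p (ch p) q ^+ (N p - D + j)) (N p - D + D).
  suff /choice[al alP] : forall l, exists al, P l al by exists al.
  move=> l.
  have := section_germ (secJ l) (ixP p).
  move=> /(vanishes_to_taylor (chP p) D); apply; apply: J_sub.
  by have [_ _ h] := secJ l; exact: h.
pose A : 'M[R[i]]_(k, size s * D) :=
  \matrix_(l < k) mxvec (\matrix_(r < size s, j < D) a (tnth (in_tuple s) r) l j).
(* The rows of [K] form a basis of the coefficient vectors whose combinations satisfy all the
   conditions; freeness of [K] carries independence over to [sec']. *)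
pose K := row_base (kermx A).
have KA : K *m A = 0.
  by apply/sub_kermxP; rewrite eq_row_base.
have freeK : row_free K by exact: row_base_free.
pose sec' (b : 'I_(\rank (kermx A))) i x : R[i] := \sum_(l < k) K b l * sec l i x.
have sec'J b : is_section J' (sec' b).
  apply: (@combination_section _ _ _ ix a) => // p j ps.
  have [r pE] : exists r, p = tnth (in_tuple s) r by exact/tnthP.
  have := congr1 (fun B : 'M[R[i]]_(_, _) => B b (mxvec_index r j)) KA; rewrite !mxE => KA0.
  rewrite -[RHS]KA0; apply: eq_bigr => l _.
  by rewrite !mxE mxvecE mxE pE.
have indep' : independent_sections sec'.
  move=> w w0; pose v : 'rV[R[i]]_(\rank (kermx A)) := \row_b w b.
  have vK : v *m K = 0.
    apply/rowP => l; rewrite !mxE.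
    under eq_bigr do rewrite mxE.
    apply: (indep (fun l => \sum_b w b * K b l)) => i x xi.
    rewrite -[RHS](w0 i x xi).
    under eq_bigr do rewrite mulr_suml.
    rewrite exchange_big/=; apply: eq_bigr => b _; rewrite mulr_sumr.
    by apply: eq_bigr => l' _; rewrite mulrA.
  move=> b; have := congr1 (fun u : 'rV[R[i]]_(_) => u ord0 b) (row_free_inj freeK (etrans vK (esym (mul0mx _ _)))).
  by rewrite !mxE.
(* By rank-nullity, [k] is the dimension of the kernel plus the rank of [A], and the latter is at
   most the number of columns. *)
apply: (@le_trans _ _ ((\rank (kermx A))%:R%:E + (size s * D)%:R%:E)%E).
  rewrite -EFinD lee_fin -natrD ler_nat mxrank_ker.
  rewrite -[leqLHS](subnK (rank_leq_row A)) leq_add2l; exact: rank_leq_col.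
rewrite leeD2r//; apply: ereal_sup_ubound; exists (\rank (kermx A)) => //.
by exists sec'.
Qed.

End compare_sections.

Section comparison_on_curve.
Variables (R : realType) (n : nat) (X : complex_manifold R n) (L : cocycle R X)
  (phi : weights L) (S : complex_manifold R 1) (e : S -> X).
Hypotheses (lbL : is_line_bundle L) (metL : positive_singular_metric phi)
  (anL : analytic_singularities phi).
Hypotheses (compS : compact [set: S]) (connS : connected [set: S])
  (axS : forall p, exists c d, axis_charts e p c d)
  (finS : weights_not_minus_infty_on phi (range e)).

Lemma axis_is_line_bundle m : is_line_bundle (lb_pow (lb_pull e L) m : cocycle R S).
Proof.
have [oL cov tr coc] := lbL; split.
- move=> i; rewrite openE => q iq; have [c [d axq]] := axS q.
  exact: axis_continuous axq _ (near_lb_dom lbL iq).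
- by move=> q; have [i iq] := cov (e q); exists i.
- move=> i j q iq jq /=; have [t0 ht] := tr i j _ iq jq; split; first by rewrite expf_neq0.
  have [c [d axq]] := axS q; apply: holomorphic_atX.
  exact: axis_holomorphic_at axq ht.
- by move=> i j k q iq jq kq /=; rewrite -exprMn; congr (_ ^+ _); exact: coc.
Qed.

Lemma h0_compare : exists K : R, 0 <= K /\ forall m : nat,
  let h0_pull := h0 (lb_pow (lb_pull e L) m)
    (multiplier_ideal (weights_pow (weights_pull e phi) m)) in
  let h0_res := h0 (lb_pow (lb_pull e L) m)
    (restricted_ideal e (multiplier_ideal (weights_pow phi m))) in
  ((h0_pull <= h0_res + K%:E) /\ (h0_res <= h0_pull + K%:E))%E.
Proof.
have [s [ch [a [alpha H]]]] := local_orders lbL metL anL compS connS axS finS.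
(* A uniform bound for the gap between the two orders: off [s] the order [a p] is 0, so the finite
   maximum bounds it everywhere. *)
pose D := (\max_(p <- s) (a p * n.+2))%N.
have aD p : (a p * n.+2 <= D)%N.
  have [ps|ps] := boolP (p \in s); first by rewrite /D (big_rem p ps)/= leq_max leqnn.
  by have [_ _ ->] := H p.
have chP p : chart_at p (ch p) by have [[d []]] := H p.
exists (size s * D)%:R; split=> // m.
have N0 p : p \notin s -> (a p * ceil_mult m (alpha p) = 0)%N.
  by move=> ps; have [_ _ ->] := H p.
have lbm := axis_is_line_bundle m.
split; apply: (h0_le lbm chP N0) => p f.
- move=> Jf; have [[d axp] gp _] := H p.
  apply: (vanishes_to_le (chP p) _ (multiplier_pull_vanishes_to axp gp Jf)).
  by rewrite leq_sub2l.
- have [[d axp] gp _] := H p; move=> hf vf; exact: (vanishes_to_restricted lbL metL axp gp hf vf).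
- move=> Jf; have [[d axp] gp _] := H p.
  apply: (vanishes_to_le (chP p) _ (restricted_vanishes_to axp gp Jf)).
  by rewrite leq_sub2l.
- have [[d axp] gp _] := H p; move=> hf vf; exact: (vanishes_to_multiplier lbL metL axp gp hf vf).
Qed.

End comparison_on_curve.

(** * Normalization of a smooth curve *)

Section biholomorphism.
Variables (R : realType) (n : nat) (M N : complex_manifold R n) (g : M -> N) (g' : N -> M).
Hypotheses (gK : cancel g g') (g'K : cancel g' g)
  (hg : holomorphic_map g) (hg' : holomorphic_map g').

(** Integrability quantifies over all charts. The transported chart has the same coordinate image,
    so integrals on [M] and [N] coincide literally, without any change of variables. *)
Lemma transport_chart x (c : chart R M n) : chart_at x c ->
  exists c' : chart R N n, [/\ chart_at (g x) c', dom c' = g' @^-1` dom c,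
    crd c' = crd c \o g' & par c' = g \o par c].
Proof.
move=> [cx cc]; have [cg dg] := hg; have [cg' dg'] := hg'.
have imE A : (crd c \o g') @` (g' @^-1` A) = crd c @` A.
  apply/seteqP; split=> [_ [y Ay <-]|_ [y Ay <-]]; first by exists (g' y).
  by exists (g y); rewrite /= gK.
have odom : open (g' @^-1` dom c).
  by apply: open_comp; [move=> y _; exact: cg'|exact: open_dom].
have ocrd : open ((crd c \o g') @` (g' @^-1` dom c)).
  by rewrite imE; exact: open_crd_dom.
have K y : (g' @^-1` dom c) y -> (g \o par c) ((crd c \o g') y) = y.
  by move=> yc; rewrite /= crdK.
have ccrd y : (g' @^-1` dom c) y -> {for y, continuous (crd c \o g')}.
  by move=> yc; apply: continuous_comp; [exact: cg'|exact: crd_continuous].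
have cpar z : ((crd c \o g') @` (g' @^-1` dom c)) z -> {for z, continuous (g \o par c)}.
  rewrite imE => zc; apply: continuous_comp; last exact: cg.
  exact: par_continuous.
exists (Chart odom ocrd K ccrd cpar); split=> //; split=> /=; first by rewrite gK.
move=> d ad; split=> /= z [y [yc yd] <-] /=.
  apply: (dg _ c d); last by rewrite g'K; split=> // d' ad'; exact: atlas_compatible.
  by split.
apply: (dg' _ d c); last by split.
by split=> // d' ad'; exact: atlas_compatible.
Qed.

Lemma locally_integrable_transport (G : N -> \bar R) x :
  locally_integrable_at G (g x) -> locally_integrable_at (G \o g) x.
Proof.
move=> GI c cx; have [c' [cx' dE cE pE]] := transport_chart cx.
have [V [oV Vx Vd VI]] := GI c' cx'; exists V; split=> //.
- by move: Vx; rewrite cE /= gK.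
- move=> z /Vd; rewrite cE dE => -[y yc <-] /=; by exists (g' y).
- by move: VI; rewrite pE.
Qed.

Lemma holomorphic_at_pull (f : N -> R[i]) x : holomorphic_at f (g x) -> holomorphic_at (f \o g) x.
Proof.
have [cg dg] := hg; have [c cx] := chart_exists x; have [d dx] := chart_exists (g x).
exact: holomorphic_at_comp cx dx (cg x) (dg x c d cx dx).
Qed.

(** Stated as an inequality, since the inverse biholomorphism supplies the other one. *)
Lemma h0_pull_le (L : cocycle R N) (phi : weights L) :
  (h0 L (multiplier_ideal phi) <=
   h0 (lb_pull g L) (multiplier_ideal (weights_pull g phi)))%E.
Proof.
apply: ge_ereal_sup => _ [k [sec [secJ indep]] <-].
apply: ereal_sup_ubound; exists k => //.
exists (fun l i => sec l i \o g); split.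
  move=> l; have [h1 h2 h3] := secJ l; split=> /=.
  - by move=> i x ix; apply: holomorphic_at_pull; exact: h1.
  - by move=> i j x ix jx; exact: h2.
  - move=> i x ix; have [hf If] := h3 i (g x) ix; split.
      have [cg _] := hg; have hf' : \forall y \near x, holomorphic_at (sec l i) (g y).
        exact: cg x _ hf.
      by apply: filterS hf' => y; exact: holomorphic_at_pull.
    move=> j jx; exact: locally_integrable_transport (If j jx).
move=> w w0; apply: indep => i y yi; rewrite -(g'K y).
by apply: (w0 i (g' y)); rewrite /= /preimage /= g'K.
Qed.

End biholomorphism.

Lemma holomorphic_map_id (R : realType) (n : nat) (M : complex_manifold R n) :
  holomorphic_map (@id M).
Proof.
split; first by move=> x; exact: cvg_id.
by move=> x c d cx dx; exact: chart_change cx dx.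
Qed.

Lemma holomorphic_map_comp (R : realType) (n k l : nat) (M : complex_manifold R n)
    (N : complex_manifold R k) (P : complex_manifold R l) (f : M -> N) (g : N -> P) :
  holomorphic_map f -> holomorphic_map g -> holomorphic_map (g \o f).
Proof.
move=> [cf df] [cg dg]; split.
  by move=> x; apply: continuous_comp; [exact: cf|exact: cg].
move=> x c d cx dx; have [b bx] := chart_exists (f x).
have [cx1 _] := cx; have [bx1 _] := bx.
have h1 := df x c b cx bx; have h2 := dg (f x) b d bx dx.
have h2' : differentiable (crd d \o g \o par b) ((crd b \o f \o par c) (crd c x)).
  by rewrite /= crdK.
apply: near_eq_differentiable (differentiable_comp h1 h2').
apply: filterS (near_par cx1 (cf x _ (near_dom bx1))) => z bz.
by rewrite /= crdK.
Qed.

Section normalization.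
Variables (R : realType) (n : nat) (X : complex_manifold R n) (C Ct : complex_manifold R 1)
  (e : C -> X) (nu : Ct -> X).
Hypotheses (compC : compact [set: C]) (connC : connected [set: C]) (inje : injective e)
  (axC : forall p, exists c d, axis_charts e p c d) (norm : is_normalization (range e) nu).

Lemma axis_continuousT : continuous e.
Proof. by move=> p; have [c [d axp]] := axC p; exact: axis_continuous axp. Qed.

Lemma axis_holomorphic_map : holomorphic_map e.
Proof.
split; first exact: axis_continuousT.
move=> p c' d' cp' dp'; have [c [d axp]] := axC p; have [cp dp _] := axp.
exact: holomorphic_map_chart cp dp cp' dp' (axis_continuous axp) (axis_differentiable axp).
Qed.

(** In dimension 0 a chart of [X] has a single point, while [e] is injective on a chart of the curve
    with more than one. The result makes a first coordinate available. *)
Lemma axis_dim_gt0 (p : C) : (0 < n)%N.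
Proof.
have [c [d [cp _ ax]]] := axC p; have [cp1 _] := cp.
have [q [cq tq _]] := curve_near_neq cp (near_dom cp1) ltr01.
rewrite lt0n; apply/eqP => n0.
have [dq1 dq2] := ax q cq; have [dp1 dp2] := ax p cp1.
have qp : q = p.
  apply: inje; rewrite -(crdK dq1) -(crdK dp1); congr par.
  by apply/rowP => j; suff : (j < 0)%N by []; rewrite -[X in (_ < X)%N]n0.
by move: tq; rewrite qp lcoord0 cabs0 ltxx.
Qed.

(** [g] is the factorization of [e] through [nu], and [g'] sends [y] to the only point of [C] over
    [nu y]. Injectivity of [e] gives one cancellation, the uniqueness in the universal property of
    [nu] the other. *)
Lemma normalization_iso : exists (g : C -> Ct) (g' : Ct -> C),
  [/\ cancel g g', cancel g' g, holomorphic_map g, holomorphic_map g' & nu \o g = e].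
Proof.
have [connCt hnu ncnu rnu univ] := norm; have [cnu dnu] := hnu.
have he := axis_holomorphic_map.
have nce : nonconstant e.
  have [x [y xy]] := ncnu.
  have [_ [p _ px]] : (range nu) (nu x) /\ (range e) (nu x) by split; [exists x|apply: rnu; exists x].
  have [q _ qy] : (range e) (nu y) by apply: rnu; exists y.
  by exists p, q; rewrite px qy.
have [g [[hg nug] _]] := univ C e connC he nce (@subset_refl _ _).
have /choice[g' eg'] : forall y, exists p, e p = nu y.
  by move=> y; have [p _ pE] : (range e) (nu y) by [apply: rnu; exists y]; exists p.
have cg' : continuous g'.
  (* [e] is a closed map *)
  move=> y U; rewrite nbhsE => -[V [oV Vy] VU].
  have ck : compact (e @` (~` V)).
    apply: continuous_compact; first exact: continuous_subspaceT axis_continuousT.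
    by apply: subclosed_compact compC _ => //; exact: open_closedC.
  have oW : open (~` (e @` (~` V))).
    by apply: closed_openC; exact: compact_closed (@manifold_hausdorff _ _ X) ck.
  have Wy : (~` (e @` (~` V))) (nu y).
    move=> [p Vp]; rewrite -eg' => /inje pE; apply: Vp.
    by rewrite pE.
  have : \forall y' \near y, (~` (e @` (~` V))) (nu y').
    by apply: (cnu y); exact: open_nbhs_nbhs.
  apply: filterS => y' Wy'; apply: VU; apply: contrapT => Vy'; apply: Wy'.
  by exists (g' y').
have hg' : holomorphic_map g'.
  split=> // y b c' by' cy'.
  have [c [d axp]] := axC (g' y); have [cp dp ax] := axp.
  apply: (holomorphic_map_chart by' cp by' cy' (cg' y)).
  have n0 := axis_dim_gt0 (g' y).
  have [by1 _] := by'.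
  have dpnu : chart_at (nu y) d by rewrite -eg'.
  (* As [e] is the first axis in these charts, the coordinate of [g'] is the first coordinate of
     [nu], which is holomorphic. *)
  apply: (@near_eq_differentiable _ _ _ (fun z => const_mx
      ((crd d \o nu \o par b) z ord0 (Ordinal n0)) : 'rV[R[i]]_1)).
    have cn : \forall z \near crd b y, dom c (g' (par b z)).
      have [cp1 _] := cp; have cy : \forall y' \near y, dom c (g' y').
        exact: cg' y _ (near_dom cp1).
      exact: near_par by1 cy.
    apply: filterS cn => z cz; apply/rowP => j; rewrite mxE (ord1 j) /=.
    by have [_] := ax _ cz; rewrite eg' => ->; rewrite mxE.
  apply: differentiable_rV => j; under eq_fun do rewrite mxE.
  apply: (@differentiable_comp _ _ _ _ (crd d \o nu \o par b)
    (fun v : 'rV[R[i]]_n => v ord0 (Ordinal n0) : R[i])).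
    exact: dnu.
  exact: differentiable_coord.
exists g, g'; split=> //.
  by move=> p; apply: inje; rewrite eg' -[LHS]/((nu \o g) p) nug.
(* Both [g \o g'] and the identity factor [nu] through itself, hence they are equal. *)
have [h [_ huniq]] := univ Ct nu connCt hnu ncnu rnu.
have h1 : h = g \o g'.
  apply: huniq; split; first exact: holomorphic_map_comp.
  by apply/funext => y /=; rewrite -[LHS]/((nu \o g) (g' y)) nug.
have h2 : h = id by apply: huniq; split; first exact: holomorphic_map_id.
by move=> y; rewrite -[LHS]/((g \o g') y) -h1 h2.
Qed.

End normalization.

(** * Upper limits of the normalized dimensions, and conclusion *)

Lemma limn_esup_le_near (R : realType) (u v : nat -> \bar R) :
  (forall eps : R, 0 < eps -> \forall m \near \oo, (u m <= v m + eps%:E)%E) ->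
  (limn_esup u <= limn_esup v)%E.
Proof.
move=> uv; apply/lee_addgt0Pr => eps eps0; rewrite -leeBlDr//.
apply: le_ereal_inf_tmp => _ [V VF <-]; rewrite leeBlDr//.
apply: (@le_trans _ _ (ereal_sup [set u x | x in V `&` [set m | (u m <= v m + eps%:E)%E]])).
  apply: ereal_inf_lbound.
  exists (V `&` [set m | (u m <= v m + eps%:E)%E]) => //.
  by apply: filterI => //; exact: uv.
apply: ge_ereal_sup => _ [m [Vm um] <-]; apply: (le_trans um).
by rewrite leeD2r//; apply: ereal_sup_ubound; exists m.
Qed.

(** The error [K / m] is eventually below any [eps]. Nonnegativity of [v] lets the product
    distribute over a sum that may be infinite. *)
Lemma limn_esup_mean_le (R : realType) (u v : nat -> \bar R) (K : R) : 0 <= K ->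
  (forall m, (0 <= v m)%E) -> (forall m, (u m <= v m + K%:E)%E) ->
  (limn_esup (fun m => (m%:R^-1)%:E * u m) <= limn_esup (fun m => (m%:R^-1)%:E * v m))%E.
Proof.
move=> K0 v0 uv; apply: limn_esup_le_near => eps eps0.
near=> m; have m0 : (0 <= (m%:R : R)^-1) by rewrite invr_ge0.
apply: (@le_trans _ _ ((m%:R^-1)%:E * (v m + K%:E))%E).
  by rewrite lee_wpmul2l ?lee_fin.
rewrite ge0_muleDr ?lee_fin// leeD2l// -EFinM lee_fin.
have mK : K / eps <= m%:R by near: m; exact: nbhs_infty_ger.
have [->|mn0] := eqVneq (m%:R : R) 0; first by rewrite invr0 mul0r ltW.
by rewrite mulrC ler_pdivrMr ?lt0r ?mn0//= mulrC -ler_pdivrMr.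
Unshelve. all: by end_near. Qed.

Lemma h0_ge0 (R : realType) (n : nat) (M : complex_manifold R n) (L : cocycle R M)
  (J : ideal_sheaf R M) : (0 <= h0 L J)%E.
Proof.
apply: ereal_sup_ubound; exists 0%N => //; exists (fun _ _ _ => 0).
by split=> [[]//|w _ []].
Qed.

Theorem proposition2p11 (R : realType) (n : nat) (X : complex_manifold R n)
    (L : cocycle R X) (phi : weights L)
    (C : complex_manifold R 1) (inc : C -> X)
    (Ct : complex_manifold R 1) (nu : Ct -> X) :
  quasi_projective X ->
  is_line_bundle L ->
  pseudo_effective L ->
  positive_singular_metric phi ->
  analytic_singularities phi ->
  smooth_curve_in inc ->
  weights_not_minus_infty_on phi (range inc) ->
  is_normalization (range inc) nu ->
  intersection_number phi nu =
  limn_esup (fun m : nat =>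
    ((m%:R^-1)%:E *
     h0 (lb_pow (lb_pull inc L) m)
        (restricted_ideal inc (multiplier_ideal (weights_pow phi m))))%E).
Proof.
move=> _ lbL _ metL anL [compC connC injinc axC] finC norm.
have [g [g' [gK g'K hg hg' nug]]] := normalization_iso compC connC injinc axC norm.
have [K [K0 HK]] := h0_compare lbL metL anL compC connC axC finC.
have nug' : inc \o g' = nu by rewrite -nug; apply/funext => y /=; rewrite g'K.
have h0E m : h0 (lb_pow (lb_pull nu L) m)
      (multiplier_ideal (weights_pow (weights_pull nu phi) m)) =
    h0 (lb_pow (lb_pull inc L) m)
      (multiplier_ideal (weights_pow (weights_pull inc phi) m)).
  apply/eqP; rewrite eq_le; apply/andP; split.
    (* Pulling back along a composite is convertible to pulling back twice, also after taking
       powers, so [h0_pull_le] applies as soon as [inc] is written [nu \o g]. *)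
    rewrite -[in leRHS]nug.
    exact: (h0_pull_le gK g'K hg hg' (weights_pow (weights_pull nu phi) m)).
  rewrite -[in leRHS]nug'.
  exact: (h0_pull_le g'K gK hg' hg (weights_pow (weights_pull inc phi) m)).
rewrite /intersection_number; under eq_fun do rewrite h0E.
by apply/eqP; rewrite eq_le; apply/andP; split;
  apply: (limn_esup_mean_le K0) => m; (exact: h0_ge0) || by have [] := HK m.
Qed.
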